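(* Let $V\in L^1_{loc}(\Omega)$ be a nonnegative Borel function, let $u_0\in L^2(\Omega)$, $u_0\ge 0$, and let $0<T\le\infty$. Assume that $u$ is a nonnegative solution of the heat equation $-\frac{\partial u}{\partial t}=L_0u-Vu$ in $(0,T)\times\Omega$, $u(t,\cdot)=0$ on $\Omega^c$ for $0<t<T$, $u(0,\cdot)=u_0$ in $\Omega$. Then for all $0<t_1<t_2<T$ and all $\Phi\in C_c^\infty(\Omega)$, $$\int_\Omega\Phi^2V\,dx-\mathcal{E}_\Omega[\Phi]\le\frac{1}{t_2-t_1}\int_\Omega\ln\Big(\frac{u(t_2)}{u(t_1)}\Big)\Phi^2\,dx.$$
   Context: Setting: $d\ge 1$, $0<\alpha<\min(2,d)$, and $\Omega\subset\mathbb{R}^d$ is an open bounded set with Lipschitz boundary. On $L^2(\mathbb{R}^d)$ let $$\mathcal{E}(f,g)=\tfrac12\mathcal{A}(d,\alpha)\int_{\mathbb{R}^d}\int_{\mathbb{R}^d}\frac{(f(x)-f(y))(g(x)-g(y))}{|x-y|^{d+\alpha}}\,dx\,dy,\quad \mathcal{A}(d,\alpha)=\frac{\alpha\Gamma(\frac{d+\alpha}{2})}{2^{1-\alpha}\pi^{d/2}\Gamma(1-\frac{\alpha}{2})},$$ with domain $W^{\alpha/2,2}(\mathbb{R}^d)=\{f\in L^2(\mathbb{R}^d):\mathcal{E}[f]:=\mathcal{E}(f,f)<\infty\}$. Let $W_0^{\alpha/2,2}(\Omega)=\{f\in W^{\alpha/2,2}(\mathbb{R}^d): f=0\ \text{q.e.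 on }\Omega^c\}$ (quasi-everywhere with respect to the $\mathcal{E}$-capacity), and let $\mathcal{E}_\Omega$ be the restriction of $\mathcal{E}$ to $W_0^{\alpha/2,2}(\Omega)$, with $\mathcal{E}_\Omega[f]:=\mathcal{E}_\Omega(f,f)$. $L_0=(-\Delta)^{\alpha/2}|_\Omega$ is the selfadjoint operator in $L^2(\Omega)$ associated with the closed form $\mathcal{E}_\Omega$. Notion of solution: let $0<T\le\infty$. A Borel function $u:[0,T)\times\mathbb{R}^d\to\mathbb{R}$ is a solution of the heat equation if: (1) $u\in\mathcal{L}^2_{loc}([0,T),L^2_{loc}(\Omega))$, where $\mathcal{L}^2$ denotes the Lebesgue space of square integrable functions; (2) $u\in L^1_{loc}((0,T)\times\Omega,dt\otimes V\,dx)$; (3) for every $t>0$, $u(t,\cdot)=0$ a.e. on $\Omega^c$; (4) for every $0\le t<T$ and every Borel function $\phi:[0,T)\times\mathbb{R}^d\to\mathbb{R}$ such that $\mathrm{supp}\,\phi\subset[0,T)\times\Omega$, $\phi,\frac{\partial\phi}{\partial t}\in L^2((0,T)\times\Omega)$, $\phi(t,\cdot)\in D(L_0)$ for all $t$ and $\int_0^t\int_\Omega u(s,x)L_0\phi(s,x)\,dx\,ds<\infty$, one has $$\int_\Omega\big((u\phi)(t,x)-u_0(x)\phi(0,x)\big)dx+\int_0^t\int_\Omega u(s,x)(-\phi_s(s,x)+L_0\phi(s,x))\,dx\,ds=\int_0^t\int_\Omega u(s,x)\phi(s,x)V(x)\,dx\,ds.$$ Here $u(t)$ denotes $u(t,\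cdot)$.
   Formalization: The case where both u_0 = 0 a.e. and u(t_2) = 0 a.e. in Ω (e.g. u ≡ 0) is excluded, since ln(u(t_2)/u(t_1)) is then ln(0/0), undefined; ''∫∫ u L_0φ < ∞'' is read as integrability of the positive part, the weak identity then asserting that its integrals converge. *)

(* Defs.v *)
From HB Require Import structures.
From mathcomp Require Import all_boot all_order all_algebra.
From mathcomp Require Import all_classical all_reals all_analysis.
From mathcomp Require Import measurable_realfun.

Set Implicit Arguments.
Unset Strict Implicit.
Unset Printing Implicit Defensive.

Import Order.TTheory GRing.Theory Num.Theory.
Import numFieldNormedType.Exports.
Local Open Scope classical_set_scope.
Local Open Scope ring_scope.

(* Borel sigma-algebra of R^n, generated by the open sets. *)
Section borel_rV.
Context {R : realType} {n : nat}.

Definition borel_rV : set (set 'rV[R]_n) := <<s @open 'rV[R]_n >>.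

HB.instance Definition _ := @isMeasurable.Build (sigma_display (@open 'rV[R]_n))
  'rV[R]_n borel_rV (@sigma_algebra0 _ setT _) (@sigma_algebraC _ _)
  (@sigma_algebra_bigcup _ setT _).

End borel_rV.

Lemma open_measurable_rV (R : realType) n (U : set 'rV[R]_n) :
  open U -> measurable U.
Proof. by move=> oU; exact: sub_sigma_algebra. Qed.

Lemma continuous_measurable_rV (R : realType) n (f : 'rV[R]_n -> R) :
  continuous f -> measurable_fun setT f.
Proof.
move=> /continuousP cf; apply: (measurability _ (RGenOpens.measurableE R)).
move=> _ [_ [a [b ->] <-]]; rewrite setTI.
by apply: open_measurable_rV; apply: cf; exact: interval_open.
Qed.

Lemma open_rV_bigcup (R : realType) n (U : set 'rV[R]_n) : open U ->
  U = \bigcup_(p in [set p : 'rV[rat]_n * rat |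
        ball (map_mx ratr p.1 : 'rV[R]_n) (ratr p.2) `<=` U])
      ball (map_mx ratr p.1 : 'rV[R]_n) (ratr p.2).
Proof.
move=> oU; apply/seteqP; split=> [x Ux|x [p /= pU /pU//]].
have /nbhs_ballP[e /= e0 eU] := open_nbhs_nbhs (conj oU Ux).
have /rat_in_itvoo[q] : (0 : R) < e / 2 by rewrite divr_gt0.
rewrite in_itv/= => /andP[q0 qe].
have H i : {r : rat | `|x 0 i - ratr r| < (ratr q : R)}.
  apply: cid; have /rat_in_itvoo[r] : x 0 i - ratr q < x 0 i + ratr q.
    by rewrite ltrD2l gtrN.
  rewrite in_itv/= => /andP[r1 r2]; exists r.
  by rewrite distrC ltr_distl r1 r2.
exists (\row_i sval (H i), q).
  move=> y [/= _ yq]; apply: eU; split=> // i j.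
  have := yq i j; rewrite !mxE /ball/= => yj; move: yj.
  case: (H j) => r /= xr yr; rewrite (ord1 i) in yr *.
  rewrite (splitr e) -[x 0 j](subrK (ratr r)) -addrA.
  rewrite (le_lt_trans (ler_normD _ _))// ltrD//; first exact: lt_trans xr qe.
  exact: lt_trans yr qe.
split=> //= i j; rewrite !mxE /ball/= (ord1 i).
by case: (H j) => r /=; rewrite distrC.
Qed.

Lemma measurable_fun_rVP d (T : measurableType d) (R : realType) n
    (f : T -> 'rV[R]_n) :
  (forall i, measurable_fun setT (fun t => f t 0 i)) -> measurable_fun setT f.
Proof.
move=> mf; apply: (@measurability _ _ _ _ setT f (@open 'rV[R]_n)) => //.
move=> _ [U oU <-]; rewrite setTI (open_rV_bigcup oU) preimage_bigcup.
rewrite bigcup_mkcond; apply: countable_bigcupT_measurable => // p.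
case: ifPn => // _; have [p0|p0] := ltP 0 (ratr p.2 : R); last first.
  rewrite [X in measurable X](_ : _ = set0)//; apply/seteqP; split=> // t /=.
  by case; rewrite ltNge p0.
rewrite [X in measurable X](_ : _ = \bigcap_(i in setT)
    ((fun t => f t 0 i) @^-1` (ball (ratr (p.1 0 i) : R) (ratr p.2)))).
  apply: fin_bigcap_measurable => // i _; rewrite -[X in measurable X]setTI.
  by apply: mf => //; apply: open_measurable; exact: ball_open.
apply/seteqP; split=> [t [_ /= tp] i _ /=|t /= tp].
  by have := tp 0 i; rewrite mxE.
by split=> // i j; rewrite (ord1 i) mxE; exact: tp.
Qed.

(* Lebesgue measure on R^n, by recursion on n: the Dirac mass on R^0, then the
   image of the product measure under R x R^n ~ R^(n+1). *)
Section lebesgue_rV.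
Context {R : realType}.

Definition rV_cons n (p : measurableTypeR R * 'rV[R]_n) : 'rV[R]_n.+1 :=
  \row_i (if unlift ord0 i is Some j then p.2 0 j else p.1).

Lemma measurable_rV_cons n : measurable_fun setT (@rV_cons n).
Proof.
apply: measurable_fun_rVP => i.
rewrite [X in measurable_fun _ X](_ : _ = fun p : measurableTypeR R * 'rV[R]_n =>
  if unlift ord0 i is Some j then p.2 0 j else p.1); last first.
  by apply/funext => p; rewrite mxE.
case: (unlift ord0 i) => [j|]; last exact: measurable_fst.
apply: (@measurableT_comp _ _ _ _ _ _ (fun v : 'rV[R]_n => v 0 j) _ snd) => //.
by apply: continuous_measurable_rV; exact: coord_continuous.
Qed.

Section step.
Variables (n : nat) (mu : {sigma_finite_measure set 'rV[R]_n -> \bar R}).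

Definition leb_cons : set 'rV[R]_n.+1 -> \bar R :=
  pushforward (@lebesgue_measure R \x mu)%E (@rV_cons n).

Let leb_cons0 : leb_cons set0 = 0%E.
Proof. by rewrite /leb_cons /pushforward preimage_set0 measure0. Qed.

Let leb_cons_ge0 A : (0 <= leb_cons A)%E.
Proof. by rewrite /leb_cons /pushforward; exact: measure_ge0. Qed.

Let leb_cons_sigma_additive : semi_sigma_additive leb_cons.
Proof.
exact: (@measure_semi_sigma_additive _ _ _
  (measure_function_pushforward__canonical__measure_function_Measure
    (@lebesgue_measure R \x mu)%E (@measurable_rV_cons n))).
Qed.

HB.instance Definition _ := isMeasure.Build _ _ _ leb_cons
  leb_cons0 leb_cons_ge0 leb_cons_sigma_additive.

Let leb_cons_sigma_finite : sigma_finite setT leb_cons.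
Proof.
pose g (v : 'rV[R]_n.+1) : measurableTypeR R * 'rV[R]_n :=
  (v 0 ord0, \row_j v 0 (lift ord0 j)).
have mc i : measurable_fun setT (fun v : 'rV[R]_n.+1 => v 0 i).
  by apply: continuous_measurable_rV; exact: coord_continuous.
have mg : measurable_fun setT g.
  apply/measurable_fun_pairP; split; first exact: mc.
  apply: measurable_fun_rVP => i.
  rewrite [X in measurable_fun _ X](_ : _ = fun v : 'rV[R]_n.+1 =>
    v 0 (lift ord0 i)); first exact: mc.
  by apply/funext => v; rewrite /= mxE.
have gK p : g (rV_cons p) = p.
  case: p => a v; congr pair; first by rewrite mxE unlift_none.
  by apply/rowP => j; rewrite !mxE liftK.
have /sigma_finiteP[F [TF ndF Foo]] := sigma_finiteT (@lebesgue_measure R).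
have /sigma_finiteP[G [TG ndG Goo]] := sigma_finiteT mu.
exists (fun k => g @^-1` (F k `*` G k)).
  apply/esym; rewrite -subTset => v _.
  have [i _ Fi] : (\bigcup_i F i) (g v).1 by rewrite -TF.
  have [j _ Gj] : (\bigcup_i G i) (g v).2 by rewrite -TG.
  exists (maxn i j) => //; split.
    by move: Fi; exact/subsetPset/ndF/leq_maxl.
  by move: Gj; exact/subsetPset/ndG/leq_maxr.
move=> k; have [mF Fk] := Foo k; have [mG Gk] := Goo k.
have mFG : measurable (F k `*` G k) by exact: measurableX.
split; first by rewrite -[X in measurable X]setTI; exact: mg.
rewrite /leb_cons /pushforward (_ : _ @^-1` _ = F k `*` G k).
  by rewrite product_measure1E// lte_mul_pinfty// ge0_fin_numE.
by apply/funext => p; exact: (congr1 (F k `*` G k) (gK p)).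
Qed.

HB.instance Definition _ := Measure_isSigmaFinite.Build _ _ _ leb_cons
  leb_cons_sigma_finite.

End step.

Fixpoint leb n : {sigma_finite_measure set 'rV[R]_n -> \bar R} :=
  if n is m.+1 then leb_cons (leb m) else \d_(0 : 'rV[R]_0).

End lebesgue_rV.

Section euclidean.
Context {R : realType} {d : nat}.
Implicit Types x y : 'rV[R]_d.

Definition dotp x y : R := \sum_i x 0 i * y 0 i.

(* The library norm of 'rV[R]_d is the sup norm. *)
Definition enorm x : R := Num.sqrt (dotp x x).

(* Near each boundary point and up to a choice of orthonormal axes, Omega is the
   part lying above the graph of a Lipschitz function: e is the vertical axis,
   x - dotp x e *: e is the projection of x on the hyperplane orthogonal to e. *)
Definition lipschitz_boundary (Omega : set 'rV[R]_d) :=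
  forall z, closure Omega z -> ~ interior Omega z ->
  exists (r k : R) (e : 'rV[R]_d) (gamma : 'rV[R]_d -> R),
    [/\ 0 < r, dotp e e = 1, k.-lipschitz gamma &
      forall x, enorm (x - z) < r ->
        Omega x <-> gamma (x - dotp x e *: e) < dotp x e].

Fixpoint Cn (k : nat) (f : 'rV[R]_d -> R) : Prop :=
  continuous f /\
  if k is j.+1 then
    forall i : 'I_d, (forall x, derivable f x (delta_mx 0 i)) /\
                     Cn j (fun x => 'D_(delta_mx 0 i) f x)
  else True.

Definition supp (f : 'rV[R]_d -> R) := closure [set x | f x != 0].

Definition Cc_infty (Omega : set 'rV[R]_d) (f : 'rV[R]_d -> R) :=
  [/\ forall k, Cn k f, compact (supp f) & supp f `<=` Omega].

End euclidean.

Definition sq_integrable (R : realType) d (T : measurableType d)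
    (mu : set T -> \bar R) (D : set T) (f : T -> R) :=
  measurable_fun D f /\ (\int[mu]_(x in D) (f x ^+ 2)%:E < +oo)%E.

Definition Gamma (R : realType) (x : R) : R :=
  \int[lebesgue_measure]_(t in `]0, +oo[) (t `^ (x - 1) * expR (- t)).

Section dirichlet_form.
Context {R : realType} (d : nat) (alpha : R).
Implicit Types (f g h : 'rV[R]_d -> R) (A U Omega : set 'rV[R]_d).
Local Open Scope ereal_scope.

Definition calA : R :=
  (alpha * Gamma ((d%:R + alpha) / 2) /
   (2 `^ (1 - alpha) * pi `^ (d%:R / 2) * Gamma (1 - alpha / 2)))%R.

Definition Eform f g : \bar R :=
  (calA / 2)%:E *
  \int[leb d \x leb d]_z
    ((f z.1 - f z.2) * (g z.1 - g z.2) /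
     enorm (z.1 - z.2) `^ (d%:R + alpha))%:E.

Definition sobolev f := sq_integrable (leb d) setT f /\ Eform f f < +oo.

Definition cap_open U : \bar R :=
  ereal_inf [set Eform f f + \int[leb d]_x (f x ^+ 2)%:E | f in
    [set f | sobolev f /\ {ae leb d, forall x, U x -> (1 <= f x)%R}]].

Definition cap A : \bar R :=
  ereal_inf [set cap_open U | U in [set U | open U /\ A `<=` U]].

Definition quasi_continuous g :=
  forall eps : R, (0 < eps)%R ->
  exists U, [/\ open U, cap U < eps%:E & {within ~` U, continuous g}].

(* The condition "f = 0 q.e. on the complement" refers to a quasi-continuous
   version g of f; all such versions agree q.e. *)
Definition sobolev0 Omega f :=
  sobolev f /\
  exists g, [/\ quasi_continuous g, {ae leb d, forall x, f x = g x} &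
                cap [set x | ~ Omega x /\ g x <> 0%R] = 0].

(* is_L0 Omega f h: f is in D(L_0) and L_0 f = h a.e. on Omega, where L_0 is the
   operator of the form restricted to sobolev0 (representation theorem). *)
Definition is_L0 Omega f h :=
  [/\ sobolev0 Omega f, sq_integrable (leb d) Omega h &
      forall g, sobolev0 Omega g ->
        Eform f g = \int[leb d]_(x in Omega) (h x * g x)%:E].

End dirichlet_form.

Section heat_equation.
Context {R : realType} (d : nat) (alpha : R).
Variables (Omega : set 'rV[R]_d) (V : 'rV[R]_d -> R) (T : \bar R).
Implicit Types (u phi h : R -> 'rV[R]_d -> R).
Local Open Scope ereal_scope.

Local Notation spacetime := (measurableTypeR R * 'rV[R]_d)%type.

Definition dtdx : set spacetime -> \bar R :=
  @lebesgue_measure R \x leb d.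

HB.instance Definition _ := Measure.on dtdx.

(* [0, T[ and ]0, T[ for T in ]0, +oo]. *)
Definition time_co : set R := [set t | (0 <= t)%R /\ t%:E < T].
Definition time_oo : set R := [set t | (0 < t)%R /\ t%:E < T].

(* d/dt is the classical derivative at every point of [0, T[ x R^d. Only the
   values of phi on [0, T[ x R^d matter: a phi having a right derivative at t = 0
   extends linearly to t < 0, so two-sided derivability at 0 is no restriction. *)
Definition dt phi (t : R) (x : 'rV[R]_d) : R := derive1 (phi ^~ x) t.

Definition admissible phi :=
  [/\ measurable_fun (time_co `*` setT : set spacetime)
        (fun z => phi z.1 z.2),
      forall t x, time_co t ->
        closure [set z : R * 'rV[R]_d | time_co z.1 /\ phi z.1 z.2 != 0%R] (t, x) ->
        Omega x,
      forall t x, time_co t -> derivable (phi ^~ x) t 1,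
      sq_integrable dtdx (time_oo `*` Omega) (fun z => phi z.1 z.2) &
      sq_integrable dtdx (time_oo `*` Omega) (fun z => dt phi z.1 z.2)].

(* h s stands for L_0 (phi s). The condition that the integral of u * L_0 phi be
   less than +oo says that the positive part is integrable, the value -oo not
   being excluded; the weak identity then asserts that its integrals converge. *)
Definition weak_identity (u0 : 'rV[R]_d -> R) u :=
  forall (t : R) phi h, time_co t -> admissible phi ->
  measurable_fun (time_co `*` Omega : set spacetime)
    (fun z => h z.1 z.2) ->
  (forall s, time_co s -> is_L0 alpha Omega (phi s) (h s)) ->
  let Q : set spacetime := `]0%R, t[ `*` Omega in
  let I0 := fun x => (u t x * phi t x - u0 x * phi 0%R x)%:E in
  let I1 := fun z : spacetime =>
    (u z.1 z.2 * (- dt phi z.1 z.2 + h z.1 z.2))%:E in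
  let I2 := fun z : spacetime =>
    (u z.1 z.2 * phi z.1 z.2 * V z.2)%:E in
  \int[dtdx]_(z in Q) (Num.max (u z.1 z.2 * h z.1 z.2) 0)%:E < +oo ->
  [/\ (leb d).-integrable Omega I0, dtdx.-integrable Q I1,
      dtdx.-integrable Q I2 &
      \int[leb d]_(x in Omega) I0 x + \int[dtdx]_(z in Q) I1 z =
      \int[dtdx]_(z in Q) I2 z].

Record is_solution (u0 : 'rV[R]_d -> R) u : Prop := {
  sol_borel : measurable_fun
    (time_co `*` setT : set spacetime)
    (fun z => u z.1 z.2) ;
  sol_L2loc : forall (t : R) (K : set 'rV[R]_d), time_co t ->
    compact K -> K `<=` Omega ->
    \int[dtdx]_(z in `[0%R, t] `*` K) (u z.1 z.2 ^+ 2)%:E < +oo ;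
  sol_L1loc : forall K : set (R * 'rV[R]_d),
    compact K -> K `<=` time_oo `*` Omega ->
    \int[dtdx]_(z in K) (`|u z.1 z.2| * V z.2)%:E < +oo ;
  sol_exterior : forall t, time_oo t ->
    {ae leb d, forall x, ~ Omega x -> u t x = 0%R} ;
  sol_weak : weak_identity u0 u }.

End heat_equation.

(* Main.v *)
Require Import Defs.
From mathcomp Require Import all_boot all_order all_algebra.
From mathcomp Require Import all_classical all_reals all_analysis.
From mathcomp Require Import measurable_realfun.
From mathcomp Require Import ring lra.

Set Implicit Arguments.
Unset Strict Implicit.
Unset Printing Implicit Defensive.

Import Order.TTheory GRing.Theory Num.Theory.
Import numFieldNormedType.Exports HBSimple.
Local Open Scope classical_set_scope.
Local Open Scope ring_scope.

(** The argument is a localised logarithmic energy estimate.  Formally, multiply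
    the equation by Phi^2 / u and integrate over ]t1, t2[ x Omega: the time
    derivative becomes d/dt ln u and produces the right-hand side, the potential
    produces (t2 - t1) times the integral of Phi^2 V, and the operator produces
    the integral of (L0 u) Phi^2 / u.  The latter is at most E[Phi] at each time:
    the symmetrized integrand is controlled by the Picone inequality
    (a^2 / p - b^2 / q) (p - q) <= (a - b)^2 ([picone]).

    Three things are missing to make this rigorous: u solves the equation only
    in a weak sense, it has no energy bound, and it may vanish.

    Mollification.  The weak identity is tested against theta(s) rho_e(x - y),
    where theta is a time cutoff and rho_e a mollifier with second differences
    bounded by a multiple of min(1, |z|^2).  Such a function lies in the domain of L0 with
    L0 rho_e an absolutely convergent integral ([is_L0_tame]).  Moreover L0 rho_e
    is bounded, and at most a negative constant on bounded sets outside the support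
    of rho_e, so that the integrability contained in the weak identity yields u in
    L1(]0, t[ x Omega) ([rintegrable_ut]).  The mollified solution w = u(t) *
    rho_e then satisfies an integrated ordinary differential equation at each
    point x ([weak_ode]), whence a differential inequality for ln (w + delta)
    ([ln_growth], [growth_ln]).  Because L0 commutes with mollification, the
    Picone inequality applies to w; it is proved for truncated kernels, where the
    double integrals may be split and symmetrized, and the truncation is then
    removed ([picone_conv]).  Integrating in x and letting e tend to 0 by means
    of the L1 continuity of translations gives the estimate for ln (u + delta)
    ([log_inequality]), with u V truncated at a level k.

    Positivity.  Letting delta tend to 0 requires u > 0.  The kernel of the
    operator is bounded below on bounded sets by some c0 > 0, so the Picone
    estimate keeps a surplus of c0 (integral of u) (integral of Phi^2 / u): mass
    anywhere in Omega feeds every other point.  This surplus pays for a moving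
    regularisation delta(r) = delta + kappa (t - r) with kappa at most c0 times
    the mass of u(r).  If u(s) is not null the mass stays away from 0 for a while,
    and at time s the regularisation is at least a fixed positive number; hence
    the integral of Phi^2 ln (u(t) + delta) is bounded below uniformly in delta
    for t > s ([log_lower_bound]).  By monotone convergence u(t) > 0 almost
    everywhere where Phi does not vanish and Phi^2 ln u(t) is integrable, and
    dominated convergence gives the estimate for ln u ([main_inequality]).

    It remains to find s < t1 with u(s) not null.  If u(t1) is not null, time
    continuity of the mollifications provides s ([not_vanishing_before]).  If
    u(t1) is null, then so is u0, since otherwise u would be positive at t1 where
    Phi does not vanish; by hypothesis u(t2) is then not null, hence positive there,
    and the right-hand side of the claim is infinite. *)

(** * Translation and reflection invariance of Lebesgue measure *)

Section lebesgue_1d.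
Context {R : realType}.
Local Notation lam := (@lebesgue_measure R).
Local Open Scope ereal_scope.

Lemma lebesgue_measure_shift (a : R) (A : set R) : measurable A ->
  pushforward lam ((fun x => x + a)%R : measurableTypeR R -> measurableTypeR R) A
  = lam A.
Proof.
have mf : measurable_fun setT
    ((fun x => x + a)%R : measurableTypeR R -> measurableTypeR R).
  by apply: measurable_funD.
pose m := measure_function_pushforward__canonical__measure_function_Measure lam mf.
move=> mA; apply/esym/(@lebesgue_measure_unique R m) => //= _ [[b c]] _ <-.
rewrite /m/= /pushforward.
rewrite (_ : _ @^-1` _ = `](b - a)%R, (c - a)%R]%classic); last first.
  by apply/seteqP; split => x /=; rewrite !in_itv/= ltrBlDr lerBrDr.
rewrite !lebesgue_measure_itv/= !lte_fin ltrD2r; case: ifP => // _.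
by rewrite -!EFinB; congr (_%:E); ring.
Qed.

Lemma ge0_integral_shift1 (a : R) (f : measurableTypeR R -> \bar R) :
  measurable_fun setT f -> (forall x, 0 <= f x) ->
  \int[lam]_x f (x + a)%R = \int[lam]_x f x.
Proof.
move=> mf f0.
have ms : measurable_fun setT
    ((fun x => x + a)%R : measurableTypeR R -> measurableTypeR R).
  by apply: measurable_funD.
rewrite -[LHS](@ge0_integral_pushforward _ _ _ _ _ _ ms lam setT f) //.
by apply: eq_measure_integral => A mA _; exact: lebesgue_measure_shift.
Qed.

Lemma ge0_integral_opp1 (f : measurableTypeR R -> \bar R) :
  measurable_fun setT f -> (forall x, 0 <= f x) ->
  \int[lam]_x f (- x)%R = \int[lam]_x f x.
Proof.
move=> mf f0.
have ms : measurable_fun setT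
    (-%R : measurableTypeR R -> measurableTypeR R) by [].
rewrite -[LHS](@ge0_integral_pushforward _ _ _ _ _ _ ms lam setT f) //.
by apply: eq_measure_integral => A mA _; exact: lebesgue_measureN.
Qed.

End lebesgue_1d.

Section lebesgue_nd.
Context {R : realType}.
Local Notation lam := (@lebesgue_measure R).

Lemma measurable_shift n (v : 'rV[R]_n) : measurable_fun setT (fun x : 'rV[R]_n => x + v).
Proof.
apply: measurable_fun_rVP => i.
rewrite [X in measurable_fun _ X](_ : _ = (fun x : 'rV[R]_n => x 0 i + v 0 i)).
  apply: measurable_funD => //.
  by apply: continuous_measurable_rV; exact: coord_continuous.
by apply/funext => x; rewrite mxE.
Qed.

Lemma measurable_oppV n : measurable_fun setT (fun x : 'rV[R]_n => - x).
Proof.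
apply: measurable_fun_rVP => i.
rewrite [X in measurable_fun _ X](_ : _ = (fun x : 'rV[R]_n => - x 0 i)).
  apply: measurableT_comp => //.
  by apply: continuous_measurable_rV; exact: coord_continuous.
by apply/funext => x; rewrite mxE.
Qed.

Lemma rV_consD n a b (v w : 'rV[R]_n) :
  rV_cons (a, v) + rV_cons (b, w) = rV_cons (a + b, v + w).
Proof.
by apply/rowP => i; rewrite !mxE; case: (unlift ord0 i) => //= j; rewrite mxE.
Qed.

Lemma rV_consN n a (v : 'rV[R]_n) : - rV_cons (a, v) = rV_cons (- a, - v).
Proof.
by apply/rowP => i; rewrite !mxE; case: (unlift ord0 i) => //= j; rewrite mxE.
Qed.

Lemma rV_cons_surj n (w : 'rV[R]_n.+1) :
  w = rV_cons (w 0 ord0, \row_j w 0 (lift ord0 j)).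
Proof.
by apply/rowP => i; rewrite !mxE; case: unliftP => [j ->|->] //=; rewrite mxE.
Qed.

Local Open Scope ereal_scope.

(** Lebesgue measure in dimension n + 1 is by construction an image of a product
    measure; invariance and the volume of balls follow from this iterated
    integral by induction on the dimension. *)
Lemma ge0_integral_cons n (f : 'rV[R]_n.+1 -> \bar R) :
  measurable_fun setT f -> (forall x, 0 <= f x) ->
  \int[leb n.+1]_x f x = \int[lam]_a \int[leb n]_v f (rV_cons (a, v)).
Proof.
move=> mf f0.
have mc := @measurable_rV_cons R n.
transitivity (\int[(lam \x leb n)%E]_z f (rV_cons z)).
  exact: (@ge0_integral_pushforward _ _ _ _ _ _ mc (lam \x leb n)%E setT f).
rewrite (fubini_tonelli1 (fun z => f (rV_cons z)))//.
exact: measurableT_comp.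
Qed.

Lemma measurable_rV_cons2 n (a : R) :
  measurable_fun setT (fun v : 'rV[R]_n => rV_cons (a, v)).
Proof.
apply: (@measurableT_comp _ _ _ _ _ _ (@rV_cons R n)).
  exact: measurable_rV_cons.
exact: measurable_pair1.
Qed.

Lemma leb_shift n (v : 'rV[R]_n) (f : 'rV[R]_n -> \bar R) :
  measurable_fun setT f -> (forall x, 0 <= f x) ->
  \int[leb n]_x f (x + v)%R = \int[leb n]_x f x.
Proof.
elim: n v f => [|n IH] v f mf f0.
  by apply: eq_integral => x _; congr f; apply/rowP => -[].
rewrite [RHS](ge0_integral_cons mf f0).
have mfv : measurable_fun setT (fun x : 'rV[R]_n.+1 => f (x + v)%R).
  exact: (measurableT_comp mf (measurable_shift v)).
rewrite [LHS](ge0_integral_cons mfv (fun x => f0 _)).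
rewrite (rV_cons_surj v); set a := v _ _; set w := \row__ _.
under eq_integral.
  move=> b _.
  under eq_integral do rewrite rV_consD.
  rewrite (IH w (fun x => f (rV_cons ((b + a)%R, x))))//; last first.
    by apply: measurableT_comp => //; exact: measurable_rV_cons2.
  over.
rewrite (@ge0_integral_shift1 _ a (fun b => \int[leb n]_x f (rV_cons (b, x))))//.
  apply: (measurable_fun_fubini_tonelli_F (fun z => f (rV_cons z))) => //.
  by apply: measurableT_comp => //; exact: measurable_rV_cons.
by move=> b; apply: integral_ge0.
Qed.

Lemma leb_opp n (f : 'rV[R]_n -> \bar R) :
  measurable_fun setT f -> (forall x, 0 <= f x) ->
  \int[leb n]_x f (- x)%R = \int[leb n]_x f x.
Proof.
elim: n f => [|n IH] f mf f0.
  by apply: eq_integral => x _; congr f; apply/rowP => -[].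
rewrite [RHS](ge0_integral_cons mf f0).
have mfo : measurable_fun setT (fun x : 'rV[R]_n.+1 => f (- x)%R).
  exact: (measurableT_comp mf (@measurable_oppV _)).
rewrite [LHS](ge0_integral_cons mfo (fun x => f0 _)).
under eq_integral.
  move=> b _.
  under eq_integral do rewrite rV_consN.
  rewrite (IH (fun x => f (rV_cons ((- b)%R, x))))//; last first.
    by apply: measurableT_comp => //; exact: measurable_rV_cons2.
  over.
rewrite (@ge0_integral_opp1 _ (fun b => \int[leb n]_x f (rV_cons (b, x))))//.
  apply: (measurable_fun_fubini_tonelli_F (fun z => f (rV_cons z))) => //.
  by apply: measurableT_comp => //; exact: measurable_rV_cons.
by move=> b; apply: integral_ge0.
Qed.

Lemma normrV_lt n (v : 'rV[R]_n) (r : R) : (0 < r)%R ->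
  (`|v| < r)%R <-> forall i, (`|v 0%R i| < r)%R.
Proof.
move=> r0; split => [vr i|h].
  apply: le_lt_trans vr.
  rewrite [leRHS]mx_normrE.
  exact: (le_bigmax _ (fun i : 'I_1 * 'I_n => `|v i.1 i.2|%R) (0%R, i)).
rewrite [ltLHS]mx_normrE; apply/bigmax_ltP; split => // -[i j] _ /=.
by rewrite (ord1 i).
Qed.

Lemma leb_ball n (r : R) : (0 < r)%R ->
  leb n [set v : 'rV[R]_n | (`|v| < r)%R] = ((2 * r) ^+ n)%:E.
Proof.
move=> r0; elim: n => [|n IH].
  rewrite /= diracE mem_set ?expr0//=.
  by apply/normrV_lt => // -[].
rewrite /=/leb_cons/pushforward.
rewrite (_ : _ @^-1` _ = `](- r)%R, r[%classic `*` [set v : 'rV[R]_n | (`|v| < r)%R]).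
  rewrite product_measure1E//; last first.
    apply: open_measurable_rV.
    rewrite (_ : [set _ | _] = ball 0%R r) ?ball_normE//.
      exact: ball_open.
    by apply/seteqP; split => x /=; rewrite -ball_normE/= ?sub0r ?normrN.
  rewrite /= IH lebesgue_measure_itv/= lte_fin gtrN// -EFinB -EFinM exprS.
  by congr (_%:E); ring.
apply/seteqP; split => -[a v] /=.
  rewrite normrV_lt// in_itv/= => h; split.
    by have := h ord0; rewrite mxE unlift_none/= ltr_norml.
  by apply/normrV_lt => // i; have := h (lift ord0 i); rewrite mxE liftK.
rewrite in_itv/= => -[h1 /normrV_lt h2]; apply/normrV_lt => // i.
by rewrite mxE; case: (unlift ord0 i) => //=; [exact: h2|rewrite ltr_norml].
Qed.

End lebesgue_nd.

(** * Integrability of the kernel *)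

Section kernel_integrability.
Context {R : realType}.

Lemma powRX (x r : R) j : 0 <= x -> (x ^+ j) `^ r = (x `^ r) ^+ j.
Proof.
by move=> x0; rewrite -powR_mulrn// powRAC powR_mulrn// powR_ge0.
Qed.

Lemma sum_geometric_lty (C q : R) (F : nat -> \bar R) : 0 <= C -> 0 <= q < 1 ->
  (forall j, 0 <= F j <= (C * q ^+ j)%:E)%E ->
  (\sum_(j <oo) F j < +oo)%E.
Proof.
move=> C0 /andP[q0 q1] Fb; apply: (@le_lt_trans _ _ (C / (1 - q))%:E); last first.
  exact: ltry.
apply: lime_le.
  by apply: is_cvg_nneseries => n _ _; have /andP[] := Fb n.
apply: nearW => n /=.
apply: (@le_trans _ _ (\sum_(0 <= i < n) (C * q ^+ i)%:E)).
  by apply: lee_sum => i _; have /andP[] := Fb i.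
rewrite sumEFin lee_fin.
rewrite -[X in X <= _]/(series (geometric C q) n) geometric_seriesE ?lt_eqF//.
rewrite ler_wpM2r// ?invr_ge0 ?subr_ge0 ?(ltW q1)//.
by rewrite ler_piMr// lerBlDr lerDl exprn_ge0.
Qed.

Lemma measurable_normV n : measurable_fun setT (fun z : 'rV[R]_n => `|z|).
Proof. by apply: continuous_measurable_rV; exact: norm_continuous. Qed.

Lemma measurable_set_lt d (T : measurableType d) (f : T -> R) (c : R) :
  measurable_fun setT f -> measurable [set x | f x < c].
Proof.
move=> mf; rewrite (_ : [set _ | _] = f @^-1` `]-oo, c[%classic).
  by rewrite -[X in measurable X]setTI; exact: mf.
by apply/seteqP; split => x /=; rewrite in_itv.
Qed.

Lemma measurable_set_le d (T : measurableType d) (f : T -> R) (c : R) :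
  measurable_fun setT f -> measurable [set x | f x <= c].
Proof.
move=> mf; rewrite (_ : [set _ | _] = f @^-1` `]-oo, c]%classic).
  by rewrite -[X in measurable X]setTI; exact: mf.
by apply/seteqP; split => x /=; rewrite in_itv.
Qed.

Lemma measurable_ballV n (r : R) : measurable [set v : 'rV[R]_n | `|v| < r].
Proof. by apply: measurable_set_lt; exact: measurable_normV. Qed.

Lemma measurable_punctured n :
  measurable [set v : 'rV[R]_n | (0 < `|v|) && (`|v| < 1)].
Proof.
rewrite (_ : [set _ | _] =
    ~` [set v : 'rV[R]_n | `|v| <= 0] `&` [set v : 'rV[R]_n | `|v| < 1]).
  apply: measurableI; last exact: measurable_ballV.
  by apply: measurableC; apply: measurable_set_le; exact: measurable_normV.
apply/seteqP; split => v /=; first by move=> /andP[v0 ->]; rewrite leNgt v0.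
by move=> [/negP]; rewrite -ltNge => -> ->.
Qed.

Lemma measurable_far n : measurable [set v : 'rV[R]_n | 1 <= `|v|].
Proof.
rewrite (_ : [set _ | _] = ~` [set v : 'rV[R]_n | `|v| < 1]).
  by apply: measurableC; exact: measurable_ballV.
by apply/seteqP; split => v /=; rewrite leNgt => /negP.
Qed.

(** Layer estimate: g is cut into shells on which it is at most c j and which lie
    in the ball of radius r j, and the volumes of the balls make a geometric
    series.  It replaces polar coordinates in the integration of powers of the
    norm. *)
Lemma shell_bound n (g : 'rV[R]_n -> R) (c r : nat -> R) (C q : R) :
  measurable_fun setT g -> (forall z, 0 <= g z) ->
  (forall z, g z != 0 -> exists j, g z <= c j /\ `|z| < r j) ->
  (forall j, 0 <= c j) -> (forall j, 0 < r j) ->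
  (forall j, c j * (2 * r j) ^+ n <= C * q ^+ j) ->
  0 <= C -> 0 <= q < 1 ->
  (\int[leb n]_z (g z)%:E < +oo)%E.
Proof.
move=> mg g0 gb c0 r0 cr C0 q01.
have mB j := @measurable_ballV n (r j).
pose G j (z : 'rV[R]_n) := (c j * \1_([set v : 'rV[R]_n | `|v| < r j]) z)%:E.
have mG j : measurable_fun setT (G j).
  by apply/measurable_EFinP; apply: measurable_funM => //; exact: measurable_indic.
have G0 j z : (0 <= G j z)%E by rewrite lee_fin mulr_ge0.
apply: (@le_lt_trans _ _ (\int[leb n]_z (\sum_(j <oo) G j z))%E).
  apply: ge0_le_integral => //.
  - by move=> z _; rewrite lee_fin.
  - exact/measurable_EFinP.
  - by apply: ge0_emeasurable_sum => // ? ? _ _; exact: G0.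
  move=> z _; have [->|/gb[j [gc zr]]] := eqVneq (g z) 0.
    by apply: nneseries_ge0 => j _ _; exact: G0.
  apply: le_trans (nneseries_lim_ge j.+1 _) => //.
  rewrite big_nat_recr//= -[leLHS]add0e leeD//; first exact: sume_ge0.
  by rewrite /G indicE mem_set// mulr1 lee_fin.
rewrite integral_nneseries//.
apply: (sum_geometric_lty C0 q01) => j; rewrite integral_ge0//=.
rewrite /G; under eq_integral do rewrite EFinM.
rewrite ge0_integralZl_EFin//; last first.
  by apply/measurable_EFinP; exact: measurable_indic.
rewrite integral_indic// setIT [X in (_ * X)%E](leb_ball n (r0 j)) -EFinM.
by rewrite lee_fin cr.
Qed.

Lemma half_pow_lt (x : R) : 0 < x -> exists j, (2^-1 : R) ^+ j <= x.
Proof.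
move=> x0; have := @cvg_expr R (2^-1).
rewrite ger0_norm ?invr_ge0// invf_lt1// ltr1n => /(_ isT) /cvgrPdist_lt /(_ _ x0)[N _].
move=> /(_ N (leqnn N)); rewrite sub0r normrN ger0_norm ?exprn_ge0 ?invr_ge0//.
by move=> /ltW; exists N.
Qed.

Lemma half_shell (x : R) : 0 < x < 1 ->
  exists j, (2^-1 : R) ^+ j.+1 <= x < 2^-1 ^+ j.
Proof.
move=> /andP[x0 x1].
have /ex_minnP[[|m] hm hmin] : exists j, (2^-1 : R) ^+ j <= x.
  exact: half_pow_lt.
  by move: hm; rewrite expr0 leNgt x1.
exists m; rewrite hm/=.
have := hmin m; case: ltP => // h /(_ isT); rewrite ltnn//.
Qed.

Lemma two_shell (x : R) : 1 <= x -> exists j, (2 : R) ^+ j <= x < 2 ^+ j.+1.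
Proof.
move=> x1; have x0 := lt_le_trans ltr01 x1.
have [|j] := half_pow_lt (x := x^-1); first by rewrite invr_gt0.
rewrite exprVn lef_pV2 ?posrE ?exprn_gt0// => xj.
have /ex_minnP[[|m] hm hmin] : exists j, x < (2 : R) ^+ j.
  exists j.+1; apply: le_lt_trans xj _; rewrite exprS ltr_pMl ?exprn_gt0//.
  by rewrite ltr1n.
  by move: hm; rewrite expr0 ltNge x1.
exists m; rewrite hm andbT.
by case: leP => // /hmin; rewrite ltnn.
Qed.

Lemma powR2V (a : R) : (2^-1 : R) `^ (- a) = 2 `^ a.
Proof. by rewrite -[2^-1]powR_inv1// -powRrM mulN1r opprK. Qed.

Lemma measurable_powRV n (a : R) :
  measurable_fun setT (fun z : 'rV[R]_n => `|z| `^ a).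
Proof.
apply: (measurableT_comp (measurable_powR a)); exact: measurable_normV.
Qed.

(** Dyadic shells 2^-(j+1) <= |z| < 2^-j, each contributing a multiple of
    2^((a - n) j). *)
Lemma int_powR_near n (a : R) : a < n%:R ->
  (\int[leb n]_z (`|z| `^ (- a) *
     \1_[set v : 'rV[R]_n | (0 < `|v|) && (`|v| < 1)] z)%:E < +oo)%E.
Proof.
move=> an.
pose q := 2 `^ (a - n%:R) : R.
have q01 : 0 <= q < 1.
  rewrite powR_ge0/= /q /powR pnatr_eq0/= expR_lt1 nmulr_rlt0 ?subr_lt0//.
  by rewrite ln_gt0// ltr1n.
apply: (@shell_bound n _ (fun j => 2 `^ `|a| * (2 `^ a) ^+ j)
   (fun j => 2^-1 ^+ j) (2 `^ `|a| * 2 ^+ n) q) => //.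
- apply: measurable_funM; first exact: measurable_powRV.
  by apply: measurable_indic; exact: measurable_punctured.
- move=> z; rewrite indicE; have [/set_mem/=|_] := boolP (z \in _);
    last by rewrite mulr0 eqxx.
  move=> /half_shell[j /andP[zj jz]] _; exists j; split => //.
  rewrite mulr1.
  have hj0 k : 0 < (2^-1 : R) ^+ k by rewrite exprn_gt0.
  have [a0|a0] := leP 0 a.
    apply: (@le_trans _ _ ((2^-1 ^+ j.+1) `^ (- a))).
      rewrite !powRN lef_pV2 ?posrE ?powR_gt0 ?(lt_le_trans _ zj)//.
      by rewrite ge0_ler_powR// nnegrE ltW// (lt_le_trans _ zj).
    by rewrite powRX// powR2V exprS ger0_norm.
  apply: (@le_trans _ _ ((2^-1 ^+ j) `^ (- a))).
    by rewrite ge0_ler_powR ?oppr_ge0 ?nnegrE ?(ltW a0)// ltW.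
  rewrite powRX// powR2V ler_peMl ?exprn_ge0 ?powR_ge0//.
  rewrite -[leLHS](@powRr0 R 2) ler_powR ?ler1n//.
- move=> j; rewrite /q powRB ?pnatr_eq0 ?implybT// powR_mulrn// exprMn.
  rewrite exprMn -exprM mulnC exprM exprVn.
  rewrite le_eqVlt; apply/orP; left; apply/eqP; rewrite -!exprVn; ring.
Qed.

(** Dyadic shells 2^j <= |z| < 2^(j+1), each contributing a multiple of
    2^((n - a) j). *)
Lemma int_powR_far n (a : R) : n%:R < a ->
  (\int[leb n]_z (`|z| `^ (- a) *
     \1_[set v : 'rV[R]_n | 1 <= `|v|] z)%:E < +oo)%E.
Proof.
move=> na; have a0 : 0 < a by rewrite (le_lt_trans _ na).
pose q := 2 `^ (n%:R - a) : R.
have q01 : 0 <= q < 1.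
  rewrite powR_ge0/= /q /powR pnatr_eq0/= expR_lt1 nmulr_rlt0 ?subr_lt0//.
  by rewrite ln_gt0// ltr1n.
apply: (@shell_bound n _ (fun j => (2 `^ (- a)) ^+ j)
   (fun j => 2 ^+ j.+1) (4 ^+ n) q) => //.
- apply: measurable_funM; first exact: measurable_powRV.
  by apply: measurable_indic; exact: measurable_far.
- move=> z; rewrite indicE; have [/set_mem/=|_] := boolP (z \in _);
    last by rewrite mulr0 eqxx.
  move=> /two_shell[j /andP[zj jz]] _; exists j; split => //.
  have hj0 k : 0 < (2 : R) ^+ k by rewrite exprn_gt0.
  rewrite mulr1 -powRX// !powRN lef_pV2 ?posrE ?powR_gt0 ?(lt_le_trans _ zj)//.
  by rewrite ge0_ler_powR ?(ltW a0)// nnegrE ltW// (lt_le_trans _ zj).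
- move=> j; rewrite /q powRB ?pnatr_eq0 ?implybT// powR_mulrn// powRN exprMn.
  rewrite -exprM mulnC exprM exprS [X in _ <= X * _](_ : _ = 2 ^+ n * 2 ^+ n).
    rewrite [(_ / _) ^+ _]exprMn; set A := _ ^+ j; set B := _ ^+ j.
    by rewrite le_eqVlt; apply/orP; left; apply/eqP; ring.
  by rewrite -exprMn; congr (_ ^+ _); ring.
Qed.

Lemma measurable_dotp n : measurable_fun setT (fun z : 'rV[R]_n => dotp z z).
Proof.
apply: measurable_sum => i; apply: measurable_funM;
  by apply: continuous_measurable_rV; exact: coord_continuous.
Qed.

Lemma measurable_enorm n : measurable_fun setT (fun z : 'rV[R]_n => enorm z).
Proof.
apply: (@measurableT_comp _ _ _ _ _ _ (@Num.sqrt R) _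
  (fun z : 'rV[R]_n => dotp z z)); last exact: measurable_dotp.
by apply: continuous_measurable_fun; exact: sqrt_continuous.
Qed.

(** The kernel is built on the Euclidean norm, as the form is; estimates compare
    it with the sup norm, whose balls are cubes. *)
Definition kern n (s : R) (z : 'rV[R]_n) : R := enorm z `^ (- s).

Lemma measurable_kern n s : measurable_fun setT (@kern n s).
Proof. by apply: (measurableT_comp (measurable_powR _)); exact: measurable_enorm. Qed.

Lemma kern_ge0 n s (z : 'rV[R]_n) : 0 <= kern s z.
Proof. exact: powR_ge0. Qed.

Lemma kernN n s (z : 'rV[R]_n) : kern s (- z) = kern s z.
Proof.
congr (_ `^ _); congr Num.sqrt; apply: eq_bigr => i _.
by rewrite mxE mulrNN.
Qed.

Lemma dotp_ge0 n (z : 'rV[R]_n) : 0 <= dotp z z.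
Proof. by apply: sumr_ge0 => i _; rewrite -expr2 sqr_ge0. Qed.

Lemma normrV_le n (v : 'rV[R]_n) (r : R) : 0 <= r ->
  `|v| <= r <-> forall i, `|v 0 i| <= r.
Proof.
move=> r0; split => [vr i|h].
  apply: le_trans vr.
  rewrite [leRHS]mx_normrE.
  exact: (le_bigmax _ (fun i : 'I_1 * 'I_n => `|v i.1 i.2|) (0, i)).
rewrite [leLHS]mx_normrE; apply/bigmax_leP; split => // -[i j] _ /=.
by rewrite (ord1 i).
Qed.

Lemma coord_le_normrV n (v : 'rV[R]_n) i : `|v 0 i| <= `|v|.
Proof. by apply: (normrV_le v (normr_ge0 v)).1. Qed.

Lemma normr_le_enorm n (z : 'rV[R]_n) : `|z| <= enorm z.
Proof.
apply/normrV_le => [|i]; first exact: sqrtr_ge0.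
rewrite -sqrtr_sqr ler_sqrt ?dotp_ge0// /dotp (bigD1 i)//= expr2 lerDl.
by apply: sumr_ge0 => j _; rewrite -expr2 sqr_ge0.
Qed.

Lemma dotp_le n (z w : 'rV[R]_n) : `|dotp z w| <= n%:R * (`|z| * `|w|).
Proof.
apply: le_trans (ler_norm_sum _ _ _) _.
apply: (@le_trans _ _ (\sum_(i < n) (`|z| * `|w|))).
  by apply: ler_sum => i _; rewrite normrM ler_pM// coord_le_normrV.
by rewrite sumr_const card_ord mulr_natl.
Qed.

Lemma enorm_le n (z : 'rV[R]_n) : enorm z <= Num.sqrt n%:R * `|z|.
Proof.
rewrite -[X in _ <= _ * X]ger0_norm// -sqrtr_sqr -sqrtrM// ler_sqrt.
  by apply: le_trans (ler_norm _) _; rewrite expr2 dotp_le.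
by rewrite mulr_ge0 ?sqr_ge0.
Qed.

Lemma enorm0 n : enorm (0 : 'rV[R]_n) = 0.
Proof.
apply/eqP; rewrite -[_ == _]/(_ == 0) eq_le sqrtr_ge0 andbT.
by apply: le_trans (enorm_le _) _; rewrite normr0 mulr0.
Qed.

Lemma kern0 n s : s != 0 -> kern s (0 : 'rV[R]_n) = 0.
Proof. by move=> s0; rewrite /kern enorm0 powR0// oppr_eq0. Qed.

Lemma kern_le n s (z : 'rV[R]_n) : 0 < s -> kern s z <= `|z| `^ (- s).
Proof.
move=> s0; have [->|z0] := eqVneq z 0.
  by rewrite kern0 ?gt_eqF// powR_ge0.
have z1 : 0 < `|z| by rewrite normr_gt0.
rewrite /kern !powRN lef_pV2 ?posrE ?powR_gt0 ?(lt_le_trans z1)//;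
  last exact: normr_le_enorm.
by rewrite ge0_ler_powR ?nnegrE// ?(ltW s0)// ?sqrtr_ge0// normr_le_enorm.
Qed.

(** The kernel is integrable at infinity because s > n, and near the origin it is
    integrable against |z|^2 because s < n + 2. *)
Lemma kern_integrable n (s : R) : 0 < s -> n%:R < s < n%:R + 2 ->
  (\int[leb n]_z (Num.min 1 (`|z| ^+ 2) * kern s z)%:E < +oo)%E.
Proof.
move=> s0 /andP[ns sn].
have m1 : measurable_fun setT (fun z : 'rV[R]_n => (`|z| `^ (- (s - 2)) *
     \1_[set v : 'rV[R]_n | (0 < `|v|) && (`|v| < 1)] z)%:E).
  apply/measurable_EFinP; apply: measurable_funM; first exact: measurable_powRV.
  by apply: measurable_indic; exact: measurable_punctured.
have m2 : measurable_fun setT (fun z : 'rV[R]_n => (`|z| `^ (- s) *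
     \1_[set v : 'rV[R]_n | 1 <= `|v|] z)%:E).
  apply/measurable_EFinP; apply: measurable_funM; first exact: measurable_powRV.
  by apply: measurable_indic; exact: measurable_far.
apply: (@le_lt_trans _ _ (\int[leb n]_z ((`|z| `^ (- (s - 2)) *
     \1_[set v : 'rV[R]_n | (0 < `|v|) && (`|v| < 1)] z)%:E +
   (`|z| `^ (- s) * \1_[set v : 'rV[R]_n | 1 <= `|v|] z)%:E))%E).
  apply: ge0_le_integral => //.
  - by move=> z _; rewrite lee_fin mulr_ge0 ?kern_ge0// le_min ler01 sqr_ge0.
  - apply/measurable_EFinP; apply: measurable_funM; last exact: measurable_kern.
    apply: measurable_minr => //; apply: measurable_funX; exact: measurable_normV.
  - exact: emeasurable_funD.
  move=> z _; rewrite -EFinD lee_fin.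
  have [->|z0] := eqVneq z 0.
    by rewrite kern0 ?gt_eqF// mulr0 addr_ge0// mulr_ge0 ?powR_ge0.
  have z1 : 0 < `|z| by rewrite normr_gt0.
  rewrite !indicE; have [zl|zg] := ltP `|z| 1.
    rewrite (_ : (z \in [set v | 0 < _ < _]) = true); last first.
      by apply: mem_set; rewrite /= z1 zl.
    rewrite (_ : (z \in [set v | 1 <= _]) = false); last first.
      by apply: memNset; rewrite /= leNgt zl.
    rewrite mulr1 mulr0 addr0.
    rewrite minEle ifF; last first.
      by apply/negP/negP; rewrite -ltNge expr_lt1.
    have -> : `|z| `^ (- (s - 2)) = `|z| ^+ 2 * `|z| `^ (- s).
      rewrite -powR_mulrn// -powRD; last by rewrite (gt_eqF z1) implybT.
      by congr (_ `^ _); ring.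
    by rewrite ler_wpM2l ?sqr_ge0// kern_le.
  rewrite (_ : (z \in [set v | 0 < _ < _]) = false); last first.
    by apply: memNset; rewrite /= z1 ltNge zg.
  rewrite (_ : (z \in [set v | 1 <= _]) = true); last exact: mem_set.
  rewrite mulr1 mulr0 add0r.
  by rewrite minEle ifT ?mul1r ?kern_le// exprn_ege1.
rewrite ge0_integralD//.
rewrite lte_add_pinfty//; first by apply: int_powR_near; rewrite ltrBlDr.
exact: int_powR_far.
Qed.

End kernel_integrability.

(** * Positivity of the constant of the form *)

Section gamma.
Context {R : realType}.
Local Notation lam := (@lebesgue_measure R).

Lemma ge0_integral_gt0 d (T : measurableType d)
    (mu : {measure set T -> \bar R}) (D : set T) (f : T -> \bar R) :
  measurable D -> measurable_fun D f -> (forall x, D x -> 0 < f x)%E ->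
  (0 < mu D)%E -> (0 < \int[mu]_(x in D) f x)%E.
Proof.
move=> mD mf f0 D0; rewrite lt0e integral_ge0 ?andbT//; last first.
  by move=> x Dx; exact/ltW/f0.
apply/eqP => I0; have : ae_eq mu D f (cst 0%E).
  apply/(ae_eq_integral_abs mu mD mf); rewrite -[RHS]I0.
  by apply: eq_integral => x /set_mem Dx; rewrite gee0_abs// ltW// f0.
move=> [N [mN N0 h]]; move: D0; rewrite lt0e => /andP[/eqP + _]; apply.
apply: (subset_measure0 mD mN _ N0) => x Dx; apply: h => /= /(_ Dx) e.
by have := f0 x Dx; rewrite e ltxx.
Qed.

Lemma integral_1d (f : R -> R) : measurable_fun setT f -> (forall x, 0 <= f x) ->
  (\int[lam]_t (f t)%:E = \int[leb 1]_v (f (v 0 0))%:E)%E.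
Proof.
move=> mf f0; rewrite ge0_integral_cons//; last first.
- by move=> v; rewrite lee_fin.
- apply/measurable_EFinP; apply: (measurableT_comp mf).
  by apply: continuous_measurable_rV; exact: coord_continuous.
apply: eq_integral => t _ /=; under eq_integral do rewrite mxE unlift_none/=.
by rewrite integral_dirac// diracT mul1e.
Qed.

Lemma eq_indic T1 T2 (A : set T1) (B : set T2) x y : (A x <-> B y) ->
  \1_A x = \1_B y :> R.
Proof.
move=> AB; rewrite !indicE; congr (_%:R).
have [/set_mem/AB/mem_set->//|xA] := boolP (x \in A).
by rewrite memNset// => /AB/mem_set; rewrite (negbTE xA).
Qed.

Lemma normrV1 (v : 'rV[R]_1) : `|v| = `|v 0 0|.
Proof.
apply/eqP; rewrite eq_le coord_le_normrV andbT; apply/normrV_le => // i.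
by rewrite (ord1 i).
Qed.

(** From (t / m) <= exp (t / m) raised to the power m; this makes the integrand of
    the Gamma function decrease like t^-2 at infinity. *)
Lemma expR_ge_pow m (t : R) : 0 <= t -> t ^+ m <= (m%:R) ^+ m * expR t.
Proof.
case: m => [|m] t0; first by rewrite !expr0 mul1r -expR0 ler_expR.
have -> : expR t = expR (t / m.+1%:R) ^+ m.+1.
  by rewrite -expRM_natl mulrC divfK// pnatr_eq0.
rewrite -exprMn lerXn2r ?nnegrE ?mulr_ge0 ?expR_ge0//.
rewrite -ler_pdivrMl// mulrC (le_trans _ (expR_ge1Dx _))//.
by rewrite lerDr.
Qed.

Definition gam (x t : R) := t `^ (x - 1) * expR (- t).

Lemma measurable_gam x : measurable_fun setT (gam x).
Proof.
apply: measurable_funM; first exact: measurable_powR.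
by apply: measurableT_comp => //; exact: measurableT_comp.
Qed.

(** Gamma is defined by an integral that is 0 when it diverges, so its positivity
    needs finiteness as well as a positive integrand. *)
Lemma gam_integrable (x : R) : 0 < x ->
  (\int[lam]_(t in `]0%R, +oo[) (gam x t)%:E < +oo)%E.
Proof.
move=> x0; pose m := (Num.truncn (x + 1)).+1.
have xm : x + 1 <= m%:R by rewrite ltW// truncnS_gt.
pose g (t : R) := `|t| `^ (- (1 - x)) * \1_[set t : R | (0 < `|t|) && (`|t| < 1)] t
  + m%:R ^+ m * (`|t| `^ (- 2) * \1_[set t : R | 1 <= `|t|] t).
have m1 : measurable [set t : R | (0 < `|t|) && (`|t| < 1)].
  rewrite (_ : [set _ | _] = ~` [set t : R | `|t| <= 0] `&` [set t : R | `|t| < 1]).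
    apply: measurableI; last by apply: measurable_set_lt.
    by apply: measurableC; apply: measurable_set_le.
  apply/seteqP; split => v /=; first by move=> /andP[v0 ->]; rewrite leNgt v0.
  by move=> [/negP]; rewrite -ltNge => -> ->.
have m2 : measurable [set t : R | 1 <= `|t|].
  rewrite (_ : [set _ | _] = ~` [set t : R | `|t| < 1]).
    by apply: measurableC; exact: measurable_set_lt.
  by apply/seteqP; split => v /=; rewrite leNgt => /negP.
have mp (a : R) : measurable_fun setT (fun t : R => `|t| `^ a).
  by apply: (measurableT_comp (measurable_powR a)).
have mg1 : measurable_fun setT (fun t : R => `|t| `^ (- (1 - x)) *
    \1_[set t : R | (0 < `|t|) && (`|t| < 1)] t).
  by apply: measurable_funM => //; exact: measurable_indic.
have mg2 : measurable_fun setT (fun t : R => m%:R ^+ m * (`|t| `^ (- 2) *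
    \1_[set t : R | 1 <= `|t|] t)).
  by do 2 apply: measurable_funM => //; exact: measurable_indic.
have g10 (t : R) : 0 <= `|t| `^ (- (1 - x)) *
    \1_[set t : R | (0 < `|t|) && (`|t| < 1)] t by rewrite mulr_ge0 ?powR_ge0.
have g20 (t : R) : 0 <= m%:R ^+ m * (`|t| `^ (- 2) *
    \1_[set t : R | 1 <= `|t|] t) by rewrite !mulr_ge0 ?powR_ge0 ?exprn_ge0.
apply: (@le_lt_trans _ _ (\int[lam]_(t in `]0%R, +oo[) (g t)%:E)%E).
  apply: ge0_le_integral => //.
  - by move=> t _; rewrite lee_fin mulr_ge0 ?powR_ge0 ?expR_ge0.
  - by apply/measurable_EFinP; apply: measurable_funTS; exact: measurable_gam.
  - by apply/measurable_EFinP; apply: measurable_funTS; exact: measurable_funD.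
  move=> t /=; rewrite in_itv/= andbT => t0; rewrite lee_fin /g/= !indicE.
  rewrite gtr0_norm//; have [t1|t1] := ltP t 1.
    rewrite (_ : (t \in [set t | 0 < _ < _]) = true); last first.
      by apply: mem_set; rewrite /= gtr0_norm// t0 t1.
    rewrite (_ : (t \in [set t | 1 <= _]) = false); last first.
      by apply: memNset; rewrite /= gtr0_norm// leNgt t1.
    rewrite mulr1 mulr0 mulr0 addr0 opprB /gam ler_piMr ?powR_ge0//.
    by rewrite -expR0 ler_expR oppr_le0 ltW.
  rewrite (_ : (t \in [set t | 0 < _ < _]) = false); last first.
    by apply: memNset; rewrite /= gtr0_norm// t0 ltNge t1.
  rewrite (_ : (t \in [set t | 1 <= _]) = true); last first.
    by apply: mem_set; rewrite /= gtr0_norm.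
  rewrite mulr0 add0r mulr1 /gam expRN ler_pdivrMr ?expR_gt0//.
  have -> : x - 1 = - 2 + (x + 1) by ring.
  rewrite powRD; last by rewrite (gt_eqF t0) implybT.
  rewrite mulrAC mulrC ler_wpM2r ?powR_ge0//.
  apply: le_trans (expR_ge_pow m (ltW t0)).
  by rewrite -powR_mulrn ?(ltW t0)// ler_powR.
apply: (@le_lt_trans _ _ (\int[lam]_t (g t)%:E)%E).
  apply: ge0_subset_integral => //.
    by apply/measurable_EFinP; exact: measurable_funD.
  by move=> t _; rewrite lee_fin addr_ge0.
rewrite /g; under eq_integral do rewrite EFinD.
rewrite ge0_integralD//; [|exact/measurable_EFinP..].
rewrite lte_add_pinfty//.
  rewrite (integral_1d mg1)//.
  rewrite [ltLHS](_ : _ = \int[leb 1]_v (`|v| `^ (- (1 - x)) *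
     \1_[set v : 'rV[R]_1 | (0 < `|v|) && (`|v| < 1)] v)%:E)%E.
    by apply: int_powR_near; rewrite ltrBlDr ltrDl.
  apply: eq_integral => v _; rewrite normrV1; congr (_ * _)%:E.
  by apply: eq_indic; rewrite /= normrV1.
under eq_integral do rewrite EFinM.
rewrite ge0_integralZl_EFin//; last first.
  by apply/measurable_EFinP; apply: measurable_funM; [exact: mp|exact: measurable_indic].
rewrite lte_mul_pinfty// integral_1d//; last first.
  by apply: measurable_funM => //; exact: measurable_indic.
rewrite [ltLHS](_ : _ = \int[leb 1]_v (`|v| `^ (- 2) *
   \1_[set v : 'rV[R]_1 | 1 <= `|v|] v)%:E)%E.
  by apply: int_powR_far; rewrite ltr1n.
apply: eq_integral => v _; rewrite normrV1; congr (_ * _)%:E.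
by apply: eq_indic; rewrite /= normrV1.
Qed.

Lemma Gamma_gt0 (x : R) : 0 < x -> 0 < Gamma x.
Proof.
move=> x0; apply: fine_gt0; rewrite (gam_integrable x0) andbT.
apply: ge0_integral_gt0 => //.
- by apply/measurable_EFinP; apply: measurable_funTS; exact: measurable_gam.
- move=> t /=; rewrite in_itv/= andbT => t0.
  by rewrite lte_fin mulr_gt0 ?powR_gt0 ?expR_gt0.
by rewrite /= lebesgue_measure_itv/= ltry oppr0 adde0 ltry.
Qed.

Lemma calA_gt0 d (alpha : R) : 0 < alpha < 2 -> 0 < calA d alpha.
Proof.
move=> /andP[a0 a2]; apply: divr_gt0.
  by rewrite mulr_gt0// Gamma_gt0// divr_gt0// ltr_wpDl.
by rewrite !mulr_gt0 ?powR_gt0 ?pi_gt0// Gamma_gt0// subr_gt0 ltr_pdivrMr// mul1r.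
Qed.

End gamma.

Notation rintegrable mu f := (mu.-integrable setT (EFin \o f)).

(** * Integrals of real functions and of their slices *)

Section real_integrals.
Context {R : realType} d (T : measurableType d) (mu : {measure set T -> \bar R}).
Implicit Types f g : T -> R.

Lemma rintegrable_le f g : measurable_fun setT f -> (forall x, `|f x| <= g x) ->
  rintegrable mu g -> rintegrable mu f.
Proof.
move=> mf fg; apply: le_integrable => //; first exact/measurable_EFinP.
by move=> x _ /=; rewrite lee_fin (le_trans (fg x))// ler_norm.
Qed.

Lemma rintegrable_ge0 f : measurable_fun setT f -> (forall x, 0 <= f x) ->
  (\int[mu]_x (f x)%:E < +oo)%E -> rintegrable mu f.
Proof.
move=> mf f0 foo; apply/integrableP; split; first exact/measurable_EFinP.
by under eq_integral do rewrite gee0_abs ?lee_fin//.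
Qed.

Lemma rintegrable_lty f : (forall x, 0 <= f x) -> rintegrable mu f ->
  (\int[mu]_x (f x)%:E < +oo)%E.
Proof. by move=> f0; exact: integrable_lty. Qed.

Lemma rintegrable_measurable f : rintegrable mu f -> measurable_fun setT f.
Proof. by move=> /measurable_int /measurable_EFinP. Qed.

Lemma rintegrableD f g : rintegrable mu f -> rintegrable mu g ->
  rintegrable mu (fun x => f x + g x).
Proof.
by move=> fi gi; apply: eq_integrable (integrableD _ fi gi).
Qed.

Lemma rintegrableB f g : rintegrable mu f -> rintegrable mu g ->
  rintegrable mu (fun x => f x - g x).
Proof.
by move=> fi gi; apply: eq_integrable (integrableB _ fi gi).
Qed.

Lemma rintegrableZ f (c : R) : rintegrable mu f -> rintegrable mu (fun x => c * f x).
Proof. by move=> fi; apply: eq_integrable (integrableZl measurableT c fi). Qed.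

Lemma rintegrable_norm f : rintegrable mu f -> rintegrable mu (fun x => `|f x|).
Proof. exact: integrable_norm. Qed.

Lemma rintegrableM_bounded f g (B : R) : measurable_fun setT g ->
  (forall x, `|g x| <= B) -> rintegrable mu f -> rintegrable mu (fun x => g x * f x).
Proof.
move=> mg gB fi; apply: (@rintegrable_le _ (fun x => B * `|f x|)).
- by apply: measurable_funM => //; exact: rintegrable_measurable.
- by move=> x; rewrite normrM ler_wpM2r.
- by apply: rintegrableZ; exact: rintegrable_norm.
Qed.

Lemma EFin_Rintegral f : rintegrable mu f ->
  (\int[mu]_x f x)%:E = (\int[mu]_x (f x)%:E)%E.
Proof. by move=> fi; rewrite fineK//; exact: integrable_fin_num. Qed.

Lemma Rintegral_eq f g : (forall x, f x = g x) -> \int[mu]_x f x = \int[mu]_x g x.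
Proof. by move=> fg; congr Rintegral; exact/funext. Qed.

Lemma Rintegral_ae_eq f g : measurable_fun setT f -> measurable_fun setT g ->
  {ae mu, forall x, f x = g x} -> \int[mu]_x f x = \int[mu]_x g x.
Proof.
move=> mf mg fg; congr fine; apply: ae_eq_integral => //.
- exact/measurable_EFinP.
- exact/measurable_EFinP.
- by apply: filterS fg => x /= ->.
Qed.

Lemma Rintegral_le f g : rintegrable mu f -> rintegrable mu g ->
  (forall x, f x <= g x) -> \int[mu]_x f x <= \int[mu]_x g x.
Proof. by move=> fi gi fg; apply: le_Rintegral. Qed.

Lemma Rintegral_norm_le f g : rintegrable mu f -> rintegrable mu g ->
  (forall x, `|f x| <= g x) -> `|\int[mu]_x f x| <= \int[mu]_x g x.
Proof.
move=> fi gi fg; apply: le_trans (le_normr_Rintegral _ fi) _ => //.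
by apply: Rintegral_le => //; exact: rintegrable_norm.
Qed.

Lemma Rintegral_dominated (F : nat -> T -> R) f g :
  (forall n, measurable_fun setT (F n)) -> measurable_fun setT f ->
  rintegrable mu g -> (forall n x, `|F n x| <= g x) ->
  (forall x, F n x @[n --> \oo] --> f x) ->
  \int[mu]_x F n x @[n --> \oo] --> \int[mu]_x f x.
Proof.
move=> mF mf gi Fg Ff.
have fg x : `|f x| <= g x.
  have h : `|F n x| @[n --> \oo] --> `|f x| by apply: cvg_norm; exact: Ff.
  rewrite -(cvg_lim _ h)//; apply: limr_le; first by apply/cvg_ex; exists `|f x|.
  exact: nearW.
have fi : rintegrable mu f by apply: rintegrable_le gi.
have Fi n : rintegrable mu (F n) by apply: rintegrable_le gi.
have /(_ _)[] := @dominated_convergence _ _ _ mu setT measurableT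
  (fun n => EFin \o F n) (EFin \o f) (EFin \o g).
- by move=> n; exact/measurable_EFinP.
- exact/measurable_EFinP.
- by apply: aeW => x _; apply: cvg_EFin; [exact: nearW|exact: Ff].
- exact: gi.
- by apply: aeW => x n _ /=; rewrite lee_fin.
move=> _ _ h; apply: fine_cvg; rewrite EFin_Rintegral//.
Qed.

End real_integrals.

Section real_fubini.
Context {R : realType} d1 d2 (T1 : measurableType d1) (T2 : measurableType d2).
Variables (m1 : {sigma_finite_measure set T1 -> \bar R})
  (m2 : {sigma_finite_measure set T2 -> \bar R}).
Implicit Types f : T1 * T2 -> R.

Lemma measurable_Rintegral2 (f : T1 -> T2 -> R) :
  measurable_fun setT (fun z : T1 * T2 => f z.1 z.2) ->
  measurable_fun setT (fun x => \int[m2]_y f x y).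
Proof.
move=> mf.
rewrite (_ : (fun x => _) = fun x => fine (\int[m2]_y (f x y)%:E)%E)//.
apply: (measurableT_comp (f := fine)); first exact: fine_measurable.
under eq_fun do rewrite integralE.
apply: emeasurable_funB.
  rewrite [X in measurable_fun _ X](_ : _ = fubini_F m2
      (EFin \o (fun z : T1 * T2 => f z.1 z.2))^\+%E); last first.
    by apply/funext => x; apply: eq_integral => y _; rewrite !unlock.
  apply: measurable_fun_fubini_tonelli_F => //.
  by apply: measurable_funepos; exact/measurable_EFinP.
rewrite [X in measurable_fun _ X](_ : _ = fubini_F m2
      (EFin \o (fun z : T1 * T2 => f z.1 z.2))^\-%E); last first.
    by apply/funext => x; apply: eq_integral => y _; rewrite !unlock.
  apply: measurable_fun_fubini_tonelli_F => //.
by apply: measurable_funeneg; exact/measurable_EFinP.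
Qed.

Lemma rintegrable_prod (f : T1 -> T2 -> R) :
  measurable_fun setT (fun z : T1 * T2 => f z.1 z.2) ->
  (\int[m1]_x \int[m2]_y `|f x y|%:E < +oo)%E ->
  rintegrable (m1 \x m2)%E (fun z : T1 * T2 => f z.1 z.2).
Proof.
move=> mf foo; apply/integrable12ltyP => //; exact/measurable_EFinP.
Qed.

(** Integrability on the product from a bound on the slices alone; this is how
    convolutions and truncated double integrals are seen to converge. *)
Lemma rintegrable_prod_bound (f : T1 -> T2 -> R) (g : T1 -> R) (B : R) :
  measurable_fun setT (fun z : T1 * T2 => f z.1 z.2) ->
  rintegrable m1 g -> (forall x, 0 <= g x) -> 0 <= B ->
  (forall x, \int[m2]_y `|f x y|%:E <= (g x * B)%:E)%E ->
  rintegrable (m1 \x m2)%E (fun z : T1 * T2 => f z.1 z.2).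
Proof.
move=> mf gi g0 B0 fb; apply: rintegrable_prod => //.
apply: (@le_lt_trans _ _ (\int[m1]_x (B * g x)%:E)%E).
  apply: ge0_le_integral => //.
  - by move=> x _; apply: integral_ge0.
  - apply: (measurable_fun_fubini_tonelli_F (fun z : T1 * T2 => `|f z.1 z.2|%:E)%E) => //.
    by apply/measurable_EFinP; exact: measurableT_comp.
  - apply/measurable_EFinP; apply: measurable_funM => //.
    exact: rintegrable_measurable gi.
  - by move=> x _; rewrite mulrC; exact: fb.
apply: rintegrable_lty; first by move=> x; rewrite mulr_ge0.
exact: rintegrableZ.
Qed.

Section fub.
Variable f : T1 -> T2 -> R.
Hypothesis fi : rintegrable (m1 \x m2)%E (fun z : T1 * T2 => f z.1 z.2).

Lemma rintegrable_swap : rintegrable (m2 \x m1)%E (fun z : T2 * T1 => f z.2 z.1).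
Proof.
have mf := rintegrable_measurable fi.
have mf' : measurable_fun setT (fun z : T2 * T1 => f z.2 z.1).
  rewrite (_ : (fun z => _) = (fun z : T1 * T2 => f z.1 z.2) \o (fun z => (z.2, z.1)))//.
  by apply: measurableT_comp => //; exact: measurable_swap.
apply/integrable12ltyP; first exact/measurable_EFinP.
by have /integrable21ltyP := fi; apply; exact/measurable_EFinP.
Qed.

Lemma Rintegral_prod1 :
  \int[m1]_x \int[m2]_y f x y = \int[(m1 \x m2)%E]_z f z.1 z.2.
Proof.
rewrite /Rintegral; congr fine.
rewrite -(integral12_prod_meas1 fi).
have mf := rintegrable_measurable fi.
apply: ae_eq_integral => //.
- by apply/measurable_EFinP; apply: (@measurable_Rintegral2 f).
- exact: (measurable_fubini_F fi).
have := ae_integrable1 fi; apply: filterS => x fx _ /=.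
by rewrite fineK//; apply: integrable_fin_num.
Qed.

Lemma rintegrable_prod1 : rintegrable m1 (fun x => \int[m2]_y f x y).
Proof.
have mf := rintegrable_measurable fi.
have : m1.-integrable setT (fun x => \int[m2]_y (f x y)%:E)%E.
  exact: integrable_fubini_F fi.
apply: le_integrable => //.
  by apply/measurable_EFinP; exact: (@measurable_Rintegral2 f).
by move=> x _ /=; rewrite /Rintegral/=; case: (integral _ _ _) => //= *; rewrite ?normr0 ?leey.
Qed.

Lemma ae_rintegrable1 : {ae m1, forall x, rintegrable m2 (f x)}.
Proof. exact: ae_integrable1 fi. Qed.

End fub.

End real_fubini.

Lemma Rintegral_swap {R : realType} d1 d2 (T1 : measurableType d1)
    (T2 : measurableType d2) (m1 : {sigma_finite_measure set T1 -> \bar R})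
    (m2 : {sigma_finite_measure set T2 -> \bar R}) (f : T1 -> T2 -> R) :
  rintegrable (m1 \x m2)%E (fun z : T1 * T2 => f z.1 z.2) ->
  \int[m1]_x \int[m2]_y f x y = \int[m2]_y \int[m1]_x f x y.
Proof.
move=> fi; have mf := rintegrable_measurable fi.
have fi' := rintegrable_swap fi.
rewrite (Rintegral_prod1 fi) (Rintegral_prod1 (f := fun y x => f x y) fi').
rewrite /Rintegral; congr fine.
rewrite -(integral21_prod_meas1 fi) -(integral12_prod_meas1 fi').
by apply: eq_integral.
Qed.

Section leb_invariance.
Context {R : realType} (n : nat).
Local Notation mu := (leb n : measure _ R).
Implicit Types (f : 'rV[R]_n -> R) (v : 'rV[R]_n).

Lemma integral_shift v f : measurable_fun setT f ->
  (\int[leb n]_x (f (x + v))%:E = \int[leb n]_x (f x)%:E)%E.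
Proof.
move=> mf; rewrite integralE [RHS]integralE; congr (_ - _)%E.
  transitivity (\int[leb n]_x ((EFin \o f)^\+ (x + v)%R))%E.
    by apply: eq_integral => x _; rewrite !unlock.
  apply: (leb_shift v) => //.
  by apply: measurable_funepos; exact/measurable_EFinP.
transitivity (\int[leb n]_x ((EFin \o f)^\- (x + v)%R))%E.
    by apply: eq_integral => x _; rewrite !unlock.
  apply: (leb_shift v) => //.
by apply: measurable_funeneg; exact/measurable_EFinP.
Qed.

Lemma integral_oppV f : measurable_fun setT f ->
  (\int[leb n]_x (f (- x))%:E = \int[leb n]_x (f x)%:E)%E.
Proof.
move=> mf; rewrite integralE [RHS]integralE; congr (_ - _)%E.
  transitivity (\int[leb n]_x ((EFin \o f)^\+ (- x)%R))%E.
    by apply: eq_integral => x _; rewrite !unlock.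
  apply: leb_opp => //.
  by apply: measurable_funepos; exact/measurable_EFinP.
transitivity (\int[leb n]_x ((EFin \o f)^\- (- x)%R))%E.
    by apply: eq_integral => x _; rewrite !unlock.
  apply: leb_opp => //.
by apply: measurable_funeneg; exact/measurable_EFinP.
Qed.

Lemma measurable_subV v : measurable_fun setT (fun x : 'rV[R]_n => v - x).
Proof.
apply: measurable_fun_rVP => i.
rewrite [X in measurable_fun _ X](_ : _ = (fun x : 'rV[R]_n => v 0 i - x 0 i)).
  apply: measurable_funB => //.
  by apply: continuous_measurable_rV; exact: coord_continuous.
by apply/funext => x; rewrite !mxE.
Qed.

Lemma Rintegral_shift v f : measurable_fun setT f ->
  \int[leb n]_x f (x + v) = \int[leb n]_x f x.
Proof. by move=> mf; congr fine; exact: integral_shift. Qed.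

Lemma integral_subV v f : measurable_fun setT f ->
  (\int[leb n]_x (f (v - x))%:E = \int[leb n]_x (f x)%:E)%E.
Proof.
move=> mf; rewrite -(integral_oppV mf).
rewrite -(@integral_shift (- v) (fun x => f (- x))); last first.
  by apply: (measurableT_comp mf); exact: measurable_oppV.
by apply: eq_integral => x _; rewrite opprD opprK addrC.
Qed.

Lemma Rintegral_subV v f : measurable_fun setT f ->
  \int[leb n]_x f (v - x) = \int[leb n]_x f x.
Proof. by move=> mf; congr fine; exact: integral_subV. Qed.

Lemma rintegrable_shift v f : rintegrable (leb n) f ->
  rintegrable (leb n) (fun x => f (x + v)).
Proof.
move=> fi; have mf := rintegrable_measurable fi.
apply/integrableP; split.
  apply/measurable_EFinP; apply: (measurableT_comp mf); exact: measurable_shift.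
rewrite (integral_shift v (f := fun x => `|f x|)); last exact: measurableT_comp.
by have /integrableP[] := fi.
Qed.

Lemma rintegrable_subV v f : rintegrable (leb n) f ->
  rintegrable (leb n) (fun x => f (v - x)).
Proof.
move=> fi; have mf := rintegrable_measurable fi.
apply/integrableP; split.
  apply/measurable_EFinP; apply: (measurableT_comp mf); exact: measurable_subV.
rewrite (integral_subV v (f := fun x => `|f x|)); last exact: measurableT_comp.
by have /integrableP[] := fi.
Qed.

End leb_invariance.

(** * A mollifier with bounded second differences *)

Section bump.
Context {R : realType}.

(** The square of the positive part is C^{1,1}, with derivative 2 max(0, a).  This
    is all the regularity that the operator, of order less than 2, asks of the
    test functions, and it can be checked by elementary algebra. *)
Definition possq (a : R) : R := (Num.max 0 a) ^+ 2.

(** Taylor expansion to first order at a, the second derivative being between 0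
    and 2. *)
Lemma possq_taylor (a b : R) :
  0 <= possq b - possq a - 2 * Num.max 0 a * (b - a) <= (b - a) ^+ 2.
Proof.
rewrite /possq; set p := Num.max 0 a; set q := Num.max 0 b.
have h (x : R) : [/\ 0 <= Num.max 0 x, 0 <= Num.max 0 x - x &
    Num.max 0 x * (Num.max 0 x - x) = 0].
  by case: (lerP 0 x) => x0; split => //; rewrite ?subrr ?mulr0 ?mul0r// sub0r
    oppr_ge0 ltW.
have [p0 pa pa0] := h a; have [q0 qb qb0] := h b; rewrite -/p -/q in p0 pa pa0 q0 qb qb0.
have h1 : 0 <= p * (q - b) by rewrite mulr_ge0.
have h2 := sqr_ge0 (q - p).
have h3 : 0 <= q * (p - a) by rewrite mulr_ge0.
have h4 := sqr_ge0 ((q - b) - (p - a)).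
apply/andP; split.
  rewrite (_ : _ - _ = (q - p) ^+ 2 + 2 * (p * (q - b)) - 2 * (p * (p - a)));
    last by ring.
  by rewrite pa0; lra.
rewrite -subr_ge0 (_ : _ - _ = ((q - b) - (p - a)) ^+ 2 + 2 * (q * (p - a))
  - 2 * (q * (q - b)) + 0 * (p * (p - a))); last by ring.
by rewrite qb0; lra.
Qed.

Lemma possq_lip (a b M : R) : 0 <= M -> a <= M -> b <= M ->
  `|possq b - possq a| <= 2 * M * `|b - a|.
Proof.
move=> M0 aM bM; rewrite /possq subr_sqr normrM mulrC.
have h : `|Num.max 0 b - Num.max 0 a| <= `|b - a|.
  case: (lerP 0 a) => a0; case: (lerP 0 b) => b0.
  - by [].
  - by rewrite sub0r normrN ger0_norm// ler0_norm; lra.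
  - by rewrite subr0 ger0_norm// ger0_norm; lra.
  - by rewrite subrr normr0.
apply: ler_pM => //; rewrite ger0_norm; last first.
  by rewrite addr_ge0 ?le_max ?lexx.
have hb : Num.max 0 b <= M by rewrite ge_max M0.
have ha : Num.max 0 a <= M by rewrite ge_max M0.
lra.
Qed.

Context (n : nat).
Implicit Types y z w : 'rV[R]_n.

Lemma dotpDD y z : dotp (y + z) (y + z) = dotp y y + 2 * dotp y z + dotp z z.
Proof.
rewrite /dotp mulr_sumr -!big_split/=; apply: eq_bigr => i _; rewrite !mxE; ring.
Qed.

Lemma dotpNr y z : dotp y (- z) = - dotp y z.
Proof. by rewrite /dotp -sumrN; apply: eq_bigr => i _; rewrite mxE mulrN. Qed.

Lemma dotpNN z : dotp (- z) (- z) = dotp z z.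
Proof. by rewrite /dotp; apply: eq_bigr => i _; rewrite mxE mulrNN. Qed.

Lemma sqr_norm_le_dotp z : `|z| ^+ 2 <= dotp z z.
Proof.
rewrite -[leRHS]sqr_sqrtr ?dotp_ge0// lerXn2r ?nnegrE// ?sqrtr_ge0//.
exact: normr_le_enorm.
Qed.

Lemma dotp_le_sqr z : dotp z z <= n%:R * `|z| ^+ 2.
Proof. by apply: le_trans (ler_norm _) _; rewrite expr2 dotp_le. Qed.

Definition bump (e : R) z : R := possq (e ^+ 2 - dotp z z).

Lemma bump_ge0 e z : 0 <= bump e z. Proof. exact: sqr_ge0. Qed.

Lemma bumpN e z : bump e (- z) = bump e z.
Proof. by rewrite /bump dotpNN. Qed.

Lemma bump_le e z : bump e z <= (e ^+ 2) ^+ 2.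
Proof.
rewrite lerXn2r ?nnegrE ?le_max ?lexx ?sqr_ge0// ge_max sqr_ge0/=.
by rewrite gerBl dotp_ge0.
Qed.

Lemma bump_out e z : 0 <= e -> e <= `|z| -> bump e z = 0.
Proof.
move=> e0 ez; rewrite /bump /possq (max_idPl _) ?expr0n// subr_le0.
apply: le_trans (sqr_norm_le_dotp z); rewrite lerXn2r ?nnegrE//.
Qed.

Lemma bump_gt0 e z : n%:R * `|z| ^+ 2 < e ^+ 2 -> 0 < bump e z.
Proof.
move=> h; rewrite exprn_gt0// lt_max ltxx/= subr_gt0.
exact: le_lt_trans (dotp_le_sqr z) h.
Qed.

Lemma dotp_continuous : continuous (fun z : 'rV[R]_n => dotp z z).
Proof.
have h (s : seq 'I_n) : continuous (fun z : 'rV[R]_n => \sum_(i <- s) z 0 i * z 0 i).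
  elim: s => [|i s IH] z.
    rewrite [X in continuous_at _ X](_ : _ = cst 0); first exact: cst_continuous.
    by apply/funext => w; rewrite big_nil.
  rewrite [X in continuous_at _ X](_ : _ = (fun z : 'rV[R]_n =>
      z 0 i * z 0 i + \sum_(j <- s) z 0 j * z 0 j)); last first.
    by apply/funext => w; rewrite big_cons.
  have c : {for z, continuous (fun z : 'rV[R]_n => z 0 i)}.
    exact: coord_continuous.
  exact: (continuousD (continuousM c c) (IH z)).
exact: h.
Qed.

Lemma bump_continuous e : continuous (bump e).
Proof.
move=> z; rewrite /bump /possq.
have h : {for z, continuous (fun z => Num.max 0 (e ^+ 2 - dotp z z))}.
  apply: (continuous_max (f := fun=> 0) (g := fun z => e ^+ 2 - dotp z z)).
    exact: cst_continuous.
  by apply: continuousB; [exact: cst_continuous|exact: dotp_continuous].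
exact: (continuousM h h).
Qed.

Lemma bump_diff (e : R) y z : 0 < e -> `|z| <= 1 -> `|y| <= e + 1 ->
  `|(e ^+ 2 - dotp (y + z) (y + z)) - (e ^+ 2 - dotp y y)| <=
  n%:R * (2 * (e + 1) + 1) * `|z|.
Proof.
move=> e0 z1 ye; rewrite dotpDD.
rewrite [X in `|X|](_ : _ = - (2 * dotp y z + dotp z z)); last by ring.
rewrite normrN; apply: le_trans (ler_normD _ _) _.
rewrite normrM ger0_norm//.
have h1 := dotp_le y z; have h2 := dotp_le z z.
have n0 : 0 <= n%:R :> R by [].
have z0 := normr_ge0 z; have y0 := normr_ge0 y.
have h3 : n%:R * (`|y| * `|z|) <= n%:R * ((e + 1) * `|z|).
  by rewrite ler_wpM2l// ler_wpM2r.
have h4 : n%:R * (`|z| * `|z|) <= n%:R * `|z|.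
  by rewrite ler_wpM2l// ler_piMr.
apply: le_trans (lerD (ler_wpM2l _ h1) h2) _ => //.
apply: le_trans (lerD (ler_wpM2l _ h3) h4) _ => //.
by rewrite le_eqVlt; apply/orP; left; apply/eqP; ring.
Qed.

(** The opposite of the symmetric second difference.  Written with it the singular
    integral converges absolutely for every order less than 2 and no principal
    value is needed. *)
Definition sdiff (f : 'rV[R]_n -> R) y z := 2 * f y - f (y + z) - f (y - z).

(** For |z| <= 1 near the ball, the two Taylor remainders are quadratic and the
    first-order terms cancel up to the second difference of the quadratic form,
    itself quadratic; elsewhere boundedness of the bump suffices. *)
Lemma bump_sdiff (e : R) : 0 < e -> exists2 C : R, 0 <= C &
  forall y z, `|sdiff (bump e) y z| <= C * Num.min 1 (`|z| ^+ 2).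
Proof.
move=> e0; pose D : R := n%:R * (2 * (e + 1) + 1).
pose C : R := 4 * (e ^+ 2) ^+ 2 + 4 * e ^+ 2 * n%:R + 2 * D ^+ 2.
have D0 : 0 <= D by rewrite mulr_ge0// addr_ge0// mulr_ge0// addr_ge0// ltW.
have C1 : 0 <= 4 * e ^+ 2 * n%:R by rewrite mulr_ge0// mulr_ge0// sqr_ge0.
have C2 : 0 <= 2 * D ^+ 2 by rewrite mulr_ge0// sqr_ge0.
have C3 : 0 <= 4 * (e ^+ 2) ^+ 2 by rewrite mulr_ge0// sqr_ge0.
exists C; first by rewrite /C; lra.
move=> y z; rewrite minEle; case: ifPn => [z1|].
  rewrite mulr1 /sdiff.
  have := bump_le e y; have := bump_le e (y + z); have := bump_le e (y - z).
  have := bump_ge0 e y; have := bump_ge0 e (y + z); have := bump_ge0 e (y - z).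
  move=> a1 a2 a3 b1 b2 b3; rewrite ler_norml /C; apply/andP; split; lra.
rewrite -ltNge => z1.
have {}z1 : `|z| <= 1.
  rewrite leNgt; apply/negP => /ltW h; move: z1; rewrite ltNge.
  by rewrite exprn_ege1.
have [ye|ye] := leP (e + 1) `|y|.
  have e1 : e <= `|y| by rewrite (le_trans _ ye)// lerDl.
  have h w : `|w| <= 1 -> e <= `|y + w|.
    by move=> w1; have := lerB_normD y w; lra.
  rewrite /sdiff !bump_out ?(ltW e0)//; [|by apply: h; rewrite normrN|exact: h].
  by rewrite mulr0 !subr0 normr0 mulr_ge0// ?sqr_ge0// /C; lra.
have k1 := bump_diff e0 z1 (ltW ye).
have k2 : `|e ^+ 2 - dotp (y - z) (y - z) - (e ^+ 2 - dotp y y)| <= D * `|z|.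
  by rewrite -[X in _ <= _ * X]normrN; apply: bump_diff => //; rewrite ?normrN// ltW.
rewrite -/D in k1; rewrite /sdiff /bump.
set a := e ^+ 2 - dotp y y in k1 k2 *.
set b := e ^+ 2 - dotp (y + z) _ in k1 *; set c := e ^+ 2 - dotp (y - z) _ in k2 *.
have bc : b + c = 2 * a - 2 * dotp z z.
  by rewrite /a /b /c !dotpDD dotpNr dotpNN; ring.
have zz := dotp_le_sqr z; have zz0 := dotp_ge0 z.
have /andP[t1 t2] := possq_taylor a b; have /andP[t3 t4] := possq_taylor a c.
have sq (x M : R) : `|x| <= M -> x ^+ 2 <= M ^+ 2.
  by move=> h; rewrite -real_normK ?num_real// lerXn2r ?nnegrE// (le_trans _ h).
have u1 := sq _ _ k1; have u2 := sq _ _ k2.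
set m := Num.max 0 a in t1 t2 t3 t4.
have m0 : 0 <= m by rewrite le_max lexx.
have me : m <= e ^+ 2 by rewrite ge_max sqr_ge0/= gerBl dotp_ge0.
have mz : m * dotp z z <= e ^+ 2 * (n%:R * `|z| ^+ 2) by rewrite ler_pM.
have mz0 : 0 <= m * dotp z z by rewrite mulr_ge0.
have zs : 0 <= `|z| ^+ 2 by rewrite sqr_ge0.
have E : 2 * m * (b - a) + 2 * m * (c - a) = - 4 * (m * dotp z z).
  rewrite (_ : c = 2 * a - 2 * dotp z z - b); first by ring.
  by rewrite -bc; ring.
have zD : (D * `|z|) ^+ 2 = D ^+ 2 * `|z| ^+ 2 by rewrite exprMn.
have C3' : 0 <= 4 * (e ^+ 2) ^+ 2 * `|z| ^+ 2 by rewrite mulr_ge0.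
have C2' : 0 <= D ^+ 2 * `|z| ^+ 2 by rewrite mulr_ge0// sqr_ge0.
have -> : C * `|z| ^+ 2 = 4 * (e ^+ 2) ^+ 2 * `|z| ^+ 2 +
    4 * (e ^+ 2 * (n%:R * `|z| ^+ 2)) + 2 * (D ^+ 2 * `|z| ^+ 2).
  by rewrite /C; ring.
rewrite zD in u1 u2; rewrite ler_norml; apply/andP; split; lra.
Qed.

Lemma bump_lip (e : R) : 0 < e -> exists2 C : R, 0 <= C &
  forall y z, (bump e (y + z) - bump e y) ^+ 2 <= C * Num.min 1 (`|z| ^+ 2).
Proof.
move=> e0; pose D : R := n%:R * (2 * (e + 1) + 1).
pose L : R := 2 * e ^+ 2 * D.
pose C : R := ((e ^+ 2) ^+ 2) ^+ 2 + L ^+ 2.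
exists C; first by rewrite /C addr_ge0 ?sqr_ge0.
move=> y z; rewrite minEle; case: ifPn => [z1|].
  rewrite mulr1; have := bump_le e y; have := bump_le e (y + z).
  have := bump_ge0 e y; have := bump_ge0 e (y + z).
  set M := (e ^+ 2) ^+ 2; move=> a1 a2 b1 b2.
  rewrite /C (@le_trans _ _ (M ^+ 2))// ?lerDl ?sqr_ge0//.
  rewrite -real_normK ?num_real// lerXn2r ?nnegrE//.
    by rewrite sqr_ge0.
  by rewrite ler_norml; apply/andP; split; lra.
rewrite -ltNge => z1.
have {}z1 : `|z| <= 1.
  rewrite leNgt; apply/negP => /ltW h; move: z1; rewrite ltNge.
  by rewrite exprn_ege1.
have [ye|ye] := leP (e + 1) `|y|.
  have e1 : e <= `|y| by rewrite (le_trans _ ye)// lerDl.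
  have h : e <= `|y + z| by have := lerB_normD y z; lra.
  rewrite !bump_out ?(ltW e0)// subrr expr0n mulr_ge0// ?sqr_ge0//.
  by rewrite /C addr_ge0 ?sqr_ge0.
have k1 := bump_diff e0 z1 (ltW ye).
apply: (@le_trans _ _ ((L * `|z|) ^+ 2)).
  rewrite -real_normK ?num_real// lerXn2r ?nnegrE//.
    by rewrite /L !mulr_ge0 ?sqr_ge0//; lra.
  rewrite /bump; apply: le_trans (possq_lip (sqr_ge0 e) _ _) _.
  - by rewrite gerBl dotp_ge0.
  - by rewrite gerBl dotp_ge0.
  rewrite /L -[leRHS]mulrA; apply: ler_wpM2l => //.
  by rewrite mulr_ge0// sqr_ge0.
by rewrite exprMn ler_wpM2r ?sqr_ge0// /C lerDr sqr_ge0.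
Qed.

End bump.

#[local] Opaque leb.

Section mollifier.
Context {R : realType} (n : nat).
Implicit Types (f : 'rV[R]_n -> R) (x y z v : 'rV[R]_n) (e r : R).

Lemma rintegrable_bounded_supp f (B r : R) : measurable_fun setT f ->
  (forall z, `|f z| <= B) -> 0 < r -> (forall z, r <= `|z| -> f z = 0) ->
  rintegrable (leb n) f.
Proof.
move=> mf fB r0 f0; have B0 : 0 <= B by exact: le_trans (fB 0).
have mb := @measurable_ballV R n r.
apply: (@rintegrable_le _ _ _ _ _
  (fun z => B * \1_[set v : 'rV[R]_n | `|v| < r] z)) => //.
  move=> z; rewrite indicE; have [zr|zr] := ltP `|z| r.
    by rewrite mem_set// mulr1.
  by rewrite f0// normr0 mulr_ge0.
apply: rintegrableZ; apply: rintegrable_ge0 => //.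
by rewrite integral_indic// setIT [ltLHS](leb_ball n r0) ltry.
Qed.

Lemma measurable_bump e : measurable_fun setT (@bump R n e).
Proof. by apply: continuous_measurable_rV; exact: bump_continuous. Qed.

Lemma rintegrable_bump e : 0 < e -> rintegrable (leb n) (@bump R n e).
Proof.
move=> e0; apply: (@rintegrable_bounded_supp _ ((e ^+ 2) ^+ 2) e) => //.
- exact: measurable_bump.
- by move=> z; rewrite ger0_norm ?bump_ge0// bump_le.
- by move=> z; apply: bump_out; exact: ltW.
Qed.

Lemma Rintegral_bump_gt0 e : 0 < e -> 0 < \int[leb n]_z (@bump R n e z).
Proof.
move=> e0; pose r := e / n.+1%:R.
have r0 : 0 < r by rewrite divr_gt0.
have mb := @measurable_ballV R n r.
apply: fine_gt0; rewrite integrable_lty ?rintegrable_bump// andbT.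
apply: (@lt_le_trans _ _ (\int[leb n]_(z in [set v : 'rV[R]_n | (`|v| < r)%R])
   (@bump R n e z)%:E)%E); last first.
  apply: ge0_subset_integral => //.
    by apply/measurable_EFinP; exact: measurable_bump.
  by move=> z _; rewrite lee_fin bump_ge0.
apply: ge0_integral_gt0 => //.
- by apply/measurable_EFinP; apply: measurable_funTS; exact: measurable_bump.
- move=> z /= zr; rewrite lte_fin bump_gt0//.
  apply: (@le_lt_trans _ _ (n%:R * r ^+ 2)).
    by rewrite ler_wpM2l// lerXn2r ?nnegrE ?(ltW r0)// ltW.
  rewrite /r expr_div_n mulrA mulrAC -[ltRHS]mul1r ltr_pM2r ?exprn_gt0//.
  rewrite ltr_pdivrMr ?exprn_gt0// mul1r -natrX ltr_nat.
  by rewrite expnS expn1 leq_pmulr.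
by rewrite [ltRHS](leb_ball n r0) lte_fin exprn_gt0// mulr_gt0.
Qed.

Definition moll e z : R := (\int[leb n]_z (@bump R n e z))^-1 * bump e z.

Section fixed.
Variable e : R.
Hypothesis e0 : 0 < e.
Let Z0 := Rintegral_bump_gt0 e0.

Lemma moll_ge0 z : 0 <= moll e z.
Proof. by rewrite mulr_ge0 ?bump_ge0// invr_ge0 ltW. Qed.

Lemma moll_out z : e <= `|z| -> moll e z = 0.
Proof. by move=> ez; rewrite /moll bump_out ?mulr0// ltW. Qed.

Lemma moll_gt0 z : n%:R * `|z| ^+ 2 < e ^+ 2 -> 0 < moll e z.
Proof. by move=> h; rewrite mulr_gt0 ?invr_gt0// bump_gt0. Qed.

Lemma moll_bounded : exists B : R, forall z, `|moll e z| <= B.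
Proof.
exists ((\int[leb n]_z (@bump R n e z))^-1 * (e ^+ 2) ^+ 2) => z.
by rewrite ger0_norm ?moll_ge0// ler_wpM2l ?bump_le// invr_ge0 ltW.
Qed.

Lemma moll_continuous : continuous (moll e).
Proof.
move=> z; have h : {for z, continuous (fun z : 'rV[R]_n =>
  (\int[leb n]_z (@bump R n e z))^-1)} by exact: cst_continuous.
exact: (continuousM h (@bump_continuous R n e z)).
Qed.

Lemma measurable_moll : measurable_fun setT (moll e).
Proof. by apply: continuous_measurable_rV; exact: moll_continuous. Qed.

Lemma rintegrable_moll : rintegrable (leb n) (moll e).
Proof. by apply: rintegrableZ; exact: rintegrable_bump. Qed.

Lemma Rintegral_moll : \int[leb n]_z moll e z = 1.
Proof.
rewrite RintegralZl//; last exact: rintegrable_bump.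
by rewrite mulVf// gt_eqF.
Qed.

Lemma moll_sdiff : exists2 C : R, 0 <= C &
  forall y z, `|sdiff (moll e) y z| <= C * Num.min 1 (`|z| ^+ 2).
Proof.
have [C C0 h] := @bump_sdiff R n e e0.
set Z := (\int[leb n]_z (@bump R n e z))^-1.
have Z0' : 0 <= Z by rewrite invr_ge0 ltW.
exists (Z * C); first by rewrite mulr_ge0.
move=> y z; rewrite (_ : sdiff _ _ _ = Z * sdiff (bump e) y z).
  by rewrite normrM ger0_norm// -mulrA ler_wpM2l.
by rewrite /sdiff /moll -/Z; ring.
Qed.

Lemma moll_lip : exists2 C : R, 0 <= C &
  forall y z, (moll e (y + z) - moll e y) ^+ 2 <= C * Num.min 1 (`|z| ^+ 2).
Proof.
have [C C0 h] := @bump_lip R n e e0.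
set Z := (\int[leb n]_z (@bump R n e z))^-1.
exists (Z ^+ 2 * C); first by rewrite mulr_ge0// sqr_ge0.
move=> y z; rewrite /moll -/Z -mulrBr exprMn -[leRHS]mulrA.
by apply: ler_wpM2l => //; exact: sqr_ge0.
Qed.

End fixed.
End mollifier.

(** * The singular operator and its truncations *)

Section operator.
Context {R : realType} (n : nat) (s : R).
Hypothesis s0 : 0 < s.
Hypothesis sn : n%:R < s < n%:R + 2.
Implicit Types (f u k : 'rV[R]_n -> R) (x y z v : 'rV[R]_n).
Local Notation K := (@kern R n s).

(** The kernel capped at height N is integrable, so that the second difference may
    be split and variables exchanged; every identity is first proved for it. *)
Definition ktr (N : nat) z : R := Num.min (kern s z) N%:R.

Lemma ktr_ge0 N z : 0 <= ktr N z.
Proof. by rewrite le_min kern_ge0 ler0n. Qed.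

Lemma ktr_le N z : ktr N z <= kern s z.
Proof. by rewrite ge_min lexx. Qed.

Lemma ktrN N z : ktr N (- z) = ktr N z.
Proof. by rewrite /ktr kernN. Qed.

Lemma measurable_ktr N : measurable_fun setT (ktr N).
Proof. by apply: measurable_minr => //; exact: measurable_kern. Qed.

Lemma ktr_cvg z : ktr N z @[N --> \oo] --> kern s z.
Proof.
apply: cvg_near_cst; exists (Num.truncn (kern s z)).+1 => // N /= hN.
apply/min_idPl/ltW; apply: lt_le_trans (truncnS_gt _) _.
by rewrite ler_nat.
Qed.

Definition m2 z : R := Num.min 1 (`|z| ^+ 2).

Lemma m2_ge0 z : 0 <= m2 z.
Proof. by rewrite le_min ler01 sqr_ge0. Qed.

Lemma measurable_m2 : measurable_fun setT m2.
Proof. by apply: measurable_minr => //; apply: measurable_funX; exact: measurable_normV. Qed.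

Lemma rintegrable_m2kern : rintegrable (leb n) (fun z => m2 z * kern s z).
Proof.
apply: rintegrable_ge0.
- by apply: measurable_funM; [exact: measurable_m2|exact: measurable_kern].
- by move=> z; rewrite mulr_ge0 ?m2_ge0 ?kern_ge0.
- exact: kern_integrable.
Qed.

Lemma rintegrable_ktr N : rintegrable (leb n) (ktr N).
Proof.
have mb := @measurable_ballV R n 1.
apply: (@rintegrable_le _ _ _ _ _ (fun z => N%:R *
   \1_[set v : 'rV[R]_n | `|v| < 1] z + m2 z * kern s z)).
- exact: measurable_ktr.
- move=> z; rewrite ger0_norm ?ktr_ge0// indicE; have [z1|z1] := ltP `|z| 1.
    rewrite mem_set// mulr1; apply: (@le_trans _ _ N%:R).
      by rewrite ge_min lexx orbT.
    by rewrite lerDl mulr_ge0 ?m2_ge0 ?kern_ge0.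
  rewrite memNset ?mulr0 ?add0r/=; last by rewrite ltNge z1.
  by rewrite /m2 minEle exprn_ege1// mul1r ktr_le.
apply: rintegrableD; last exact: rintegrable_m2kern.
apply: rintegrableZ; apply: rintegrable_ge0 => //.
by rewrite integral_indic// setIT [ltLHS](leb_ball n ltr01) ltry.
Qed.

(** The error made by capping the kernel, on functions whose second differences
    are of size min(1, |z|^2); it tends to 0 by dominated convergence. *)
Definition kerr N : R := \int[leb n]_z (m2 z * (kern s z - ktr N z)).

Lemma rintegrable_kerr N : rintegrable (leb n) (fun z => m2 z * (kern s z - ktr N z)).
Proof.
apply: rintegrable_le rintegrable_m2kern.
  apply: measurable_funM; first exact: measurable_m2.
  by apply: measurable_funB; [exact: measurable_kern|exact: measurable_ktr].
move=> z; rewrite normrM ger0_norm ?m2_ge0// ler_wpM2l ?m2_ge0//.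
by rewrite ger0_norm ?subr_ge0 ?ktr_le// gerBl ktr_ge0.
Qed.

Lemma kerr_cvg0 : kerr N @[N --> \oo] --> 0.
Proof.
have -> : (0 : R) = \int[leb n]_z (0 : R).
  by rewrite Rintegral_cst// mul0r.
apply: (@Rintegral_dominated _ _ _ _ (fun N z => m2 z * (kern s z - ktr N z))
   (fun=> 0) (fun z => m2 z * kern s z)).
- by move=> N; exact: rintegrable_measurable (rintegrable_kerr N).
- by [].
- exact: rintegrable_m2kern.
- move=> N z; rewrite normrM ger0_norm ?m2_ge0// ler_wpM2l ?m2_ge0//.
  by rewrite ger0_norm ?subr_ge0 ?ktr_le// gerBl ktr_ge0.
move=> z; rewrite -[X in _ --> X](mulr0 (m2 z)) -[X in _ * X](subrr (kern s z)).
by apply: cvgM; [exact: cvg_cst|apply: cvgB; [exact: cvg_cst|exact: ktr_cvg]].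
Qed.

(** The operator L0 without its constant calA / 2. *)
Definition nlop k f y : R := \int[leb n]_z (sdiff f y z * k z).

Lemma measurable_add2 d (T : measurableType d) (g h : T -> 'rV[R]_n) :
  measurable_fun setT g -> measurable_fun setT h ->
  measurable_fun setT (fun t => g t + h t).
Proof.
move=> mg mh; apply: measurable_fun_rVP => i; under eq_fun do rewrite mxE.
apply: measurable_funD.
  apply: (@measurableT_comp _ _ _ _ _ _ (fun v : 'rV[R]_n => v 0 i)) => //.
  by apply: continuous_measurable_rV; exact: coord_continuous.
apply: (@measurableT_comp _ _ _ _ _ _ (fun v : 'rV[R]_n => v 0 i)) => //.
by apply: continuous_measurable_rV; exact: coord_continuous.
Qed.

Lemma measurable_sub2 d (T : measurableType d) (g h : T -> 'rV[R]_n) :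
  measurable_fun setT g -> measurable_fun setT h ->
  measurable_fun setT (fun t => g t - h t).
Proof.
move=> mg mh; apply: measurable_add2 => //.
by apply: (measurableT_comp (@measurable_oppV R n)).
Qed.

Lemma measurable_sdiff2 f : measurable_fun setT f ->
  measurable_fun setT (fun p : 'rV[R]_n * 'rV[R]_n => sdiff f p.1 p.2).
Proof.
move=> mf; apply: measurable_funB; first apply: measurable_funB.
- by apply: measurable_funM => //; exact: measurableT_comp.
- by apply: (measurableT_comp mf); exact: measurable_add2.
- by apply: (measurableT_comp mf); exact: measurable_sub2.
Qed.

Lemma measurable_sdiff f y : measurable_fun setT f -> measurable_fun setT (sdiff f y).
Proof.
move=> mf; apply: (measurableT_comp (measurable_sdiff2 mf)
  (f := fun p : 'rV[R]_n * 'rV[R]_n => sdiff f p.1 p.2) (g := pair y)).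
exact: measurable_pair1.
Qed.

Lemma measurable_nlop k f : measurable_fun setT k -> measurable_fun setT f ->
  measurable_fun setT (nlop k f).
Proof.
move=> mk mf; apply: (@measurable_Rintegral2 _ _ _ _ _ (leb n)
  (fun y z => sdiff f y z * k z)).
apply: measurable_funM; first exact: measurable_sdiff2.
exact: measurableT_comp.
Qed.

Section sd.
Variables (f : 'rV[R]_n -> R) (C : R).
Hypothesis mf : measurable_fun setT f.
Hypothesis fC : forall y z, `|sdiff f y z| <= C * m2 z.

Lemma rintegrable_nlop y : rintegrable (leb n) (fun z => sdiff f y z * K z).
Proof.
apply: (@rintegrable_le _ _ _ _ _ (fun z => C * (m2 z * K z))).
- apply: measurable_funM; first exact: measurable_sdiff.
  exact: measurable_kern.
- by move=> z; rewrite normrM (ger0_norm (kern_ge0 _ _)) mulrA ler_wpM2r ?kern_ge0.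
- by apply: rintegrableZ; exact: rintegrable_m2kern.
Qed.

Lemma nlop_bounded y : `|nlop K f y| <= C * \int[leb n]_z (m2 z * K z).
Proof.
rewrite -RintegralZl//; last exact: rintegrable_m2kern.
apply: Rintegral_norm_le.
- exact: rintegrable_nlop.
- by apply: rintegrableZ; exact: rintegrable_m2kern.
- by move=> z; rewrite normrM (ger0_norm (kern_ge0 _ _)) mulrA ler_wpM2r ?kern_ge0.
Qed.

Lemma rintegrable_nlop_ktr N y : rintegrable (leb n) (fun z => sdiff f y z * ktr N z).
Proof.
apply: rintegrable_le (rintegrable_norm (rintegrable_nlop y)).
  by apply: measurable_funM; [exact: measurable_sdiff|exact: measurable_ktr].
move=> z; rewrite !normrM ler_wpM2l// !ger0_norm ?ktr_ge0 ?kern_ge0//.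
exact: ktr_le.
Qed.

Lemma nlop_err N y : `|nlop K f y - nlop (ktr N) f y| <= C * kerr N.
Proof.
rewrite -RintegralB//; [|exact: rintegrable_nlop|exact: rintegrable_nlop_ktr].
rewrite -RintegralZl//; last exact: rintegrable_kerr.
apply: Rintegral_norm_le.
- apply: rintegrableB; [exact: rintegrable_nlop|exact: rintegrable_nlop_ktr].
- by apply: rintegrableZ; exact: rintegrable_kerr.
- move=> z; rewrite -mulrBr normrM mulrA (ger0_norm (x := K z - ktr N z)).
    by rewrite ler_wpM2r// subr_ge0 ktr_le.
  by rewrite subr_ge0 ktr_le.
Qed.

Section bd.
Variable B : R.
Hypothesis fB : forall x, `|f x| <= B.

Lemma rintegrable_fktr N (g : 'rV[R]_n -> R) (B' : R) : measurable_fun setT g ->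
  (forall z, `|g z| <= B') -> rintegrable (leb n) (fun z => g z * ktr N z).
Proof. by move=> mg gB; apply: rintegrableM_bounded (rintegrable_ktr N). Qed.

(** With an integrable even kernel the two halves of the second difference
    contribute equally. *)
Lemma nlop_ktrE N y :
  nlop (ktr N) f y = 2 * \int[leb n]_z ((f y - f (y + z)) * ktr N z).
Proof.
have mp : measurable_fun setT (fun z => f (y + z)).
  by apply: (measurableT_comp mf); apply: measurable_add2.
have mm : measurable_fun setT (fun z => f (y - z)).
  by apply: (measurableT_comp mf); exact: measurable_subV.
have ip : rintegrable (leb n) (fun z => (f y - f (y + z)) * ktr N z).
  apply: (@rintegrable_fktr _ _ (B + B)); first exact: measurable_funB.
  by move=> z; rewrite (le_trans (ler_normB _ _))// lerD.
have im : rintegrable (leb n) (fun z => (f y - f (y - z)) * ktr N z).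
  apply: (@rintegrable_fktr _ _ (B + B)); first exact: measurable_funB.
  by move=> z; rewrite (le_trans (ler_normB _ _))// lerD.
rewrite /nlop (Rintegral_eq _ (g := fun z => (f y - f (y + z)) * ktr N z +
  (f y - f (y - z)) * ktr N z)); last by move=> z; rewrite /sdiff; ring.
rewrite RintegralD// mulr2n mulrDl mul1r; congr (_ + _).
have := Rintegral_subV 0 (rintegrable_measurable ip).
move=> <-; apply: Rintegral_eq => z.
by rewrite sub0r ktrN.
Qed.

Lemma nlop_ktrE' N y :
  nlop (ktr N) f y = 2 * \int[leb n]_w ((f y - f w) * ktr N (w - y)).
Proof.
rewrite nlop_ktrE; apply: (f_equal (fun t => 2 * t)).
have mF : measurable_fun setT (fun w => (f y - f w) * ktr N (w - y)).
  apply: measurable_funM; first exact: measurable_funB.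
  by apply: (measurableT_comp (measurable_ktr N)); exact: measurable_sub2.
apply: etrans (Rintegral_shift y mF).
by apply: Rintegral_eq => z; rewrite addrK [z + y]addrC.
Qed.

End bd.
End sd.

Definition conv u f x : R := \int[leb n]_y (u y * f (x - y)).

Section convolution.
Variables (u f : 'rV[R]_n -> R) (B : R).
Hypothesis ui : rintegrable (leb n) u.
Hypothesis mf : measurable_fun setT f.
Hypothesis fB : forall x, `|f x| <= B.

Let B0 : 0 <= B. Proof. exact: le_trans (fB 0). Qed.

Lemma rintegrable_conv x : rintegrable (leb n) (fun y => u y * f (x - y)).
Proof.
under eq_fun do rewrite mulrC; apply: (rintegrableM_bounded (B := B)) ui => //.
by apply: (measurableT_comp mf); exact: measurable_subV.
Qed.

Lemma conv_bounded x : `|conv u f x| <= B * \int[leb n]_y `|u y|.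
Proof.
rewrite -RintegralZl//; last exact: rintegrable_norm.
apply: Rintegral_norm_le; first exact: rintegrable_conv.
  by apply: rintegrableZ; exact: rintegrable_norm.
by move=> y; rewrite normrM mulrC ler_wpM2r.
Qed.

Lemma measurable_conv : measurable_fun setT (conv u f).
Proof.
apply: (@measurable_Rintegral2 _ _ _ _ _ (leb n) (fun x y => u y * f (x - y))).
apply: measurable_funM.
  by apply: measurableT_comp => //; exact: rintegrable_measurable ui.
by apply: (measurableT_comp mf); exact: measurable_sub2.
Qed.

(** The operator commutes with convolution: this turns the drift of the mollified
    equation, which carries the operator on the mollifier, into the operator on
    the mollified solution.  For the capped kernel it is Fubini. *)
Lemma conv_nlop_ktr N x :
  conv u (nlop (ktr N) f) x =
  2 * \int[leb n]_z ((conv u f x - conv u f (x + z)) * ktr N z).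
Proof.
pose F y z := u y * ((f (x - y) - f (x - y + z)) * ktr N z).
have Fi : rintegrable (leb n \x leb n)%E (fun p : 'rV[R]_n * 'rV[R]_n => F p.1 p.2).
  apply: (@rintegrable_prod_bound _ _ _ _ _ (leb n) (leb n) F (fun y => `|u y|)
    (2 * B * \int[leb n]_z ktr N z)).
  - apply: measurable_funM.
      by apply: measurableT_comp => //; exact: rintegrable_measurable ui.
    apply: measurable_funM.
      apply: measurable_funB; apply: (measurableT_comp mf).
        by apply: measurable_sub2.
      by apply: measurable_add2 => //; exact: measurable_sub2.
    by apply: measurableT_comp => //; exact: measurable_ktr.
  - exact: rintegrable_norm.
  - by [].
  - by rewrite !mulr_ge0// Rintegral_ge0// => z _; exact: ktr_ge0.
  move=> y; rewrite -RintegralZl//; last exact: rintegrable_ktr.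
  rewrite -RintegralZl//; last by apply: rintegrableZ; exact: rintegrable_ktr.
  rewrite EFin_Rintegral; last by do 2 apply: rintegrableZ; exact: rintegrable_ktr.
  apply: ge0_le_integral => //.
  - apply/measurable_EFinP; apply: measurableT_comp => //.
    apply: measurable_funM => //; apply: measurable_funM; last exact: measurable_ktr.
    apply: measurable_funB => //; apply: (measurableT_comp mf).
    exact: measurable_add2.
  - apply/measurable_EFinP; do 2 apply: measurable_funM => //; exact: measurable_ktr.
  move=> z _; rewrite lee_fin !normrM ler_wpM2l// (ger0_norm (ktr_ge0 _ _)).
  rewrite ler_wpM2r ?ktr_ge0// (le_trans (ler_normB _ _))//.
  by rewrite mulr_natl mulr2n lerD.
transitivity (2 * \int[leb n]_y \int[leb n]_z F y z).
  apply: etrans (RintegralZl _ measurableT (rintegrable_prod1 Fi)).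
  apply: Rintegral_eq => y; rewrite (nlop_ktrE mf fB) RintegralZl//; first by ring.
  apply: (@rintegrable_fktr _ _ (B + B)).
    apply: measurable_funB => //; apply: (measurableT_comp mf).
    exact: measurable_add2.
  by move=> z; rewrite (le_trans (ler_normB _ _))// lerD.
rewrite (Rintegral_swap Fi); apply: (f_equal (fun t => 2 * t)).
apply: Rintegral_eq => z.
rewrite /conv -RintegralB//; [|exact: rintegrable_conv..].
rewrite -RintegralZr//; last first.
  by apply: rintegrableB; exact: rintegrable_conv.
apply: Rintegral_eq => y; rewrite /F (_ : x + z - y = x - y + z).
  by ring.
by rewrite addrAC.
Qed.

End convolution.
End operator.

(** * The energy form and the domain of the operator *)

Section energy.
Context {R : realType} (d : nat) (alpha : R).
Hypothesis halpha : 0 < alpha < 2.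
Local Notation s := (d%:R + alpha).
Local Notation K := (@kern R d s).
Local Notation X := ('rV[R]_d).
Implicit Types (f g h : X -> R) (x y z : X) (Omega U A : set X).

Let s0 : 0 < s. Proof. by case/andP: halpha => a0 _; rewrite ltr_wpDl. Qed.
Let sn : d%:R < s < d%:R + 2.
Proof. by case/andP: halpha => a0 a2; rewrite ltrDl a0 ltrD2l. Qed.
Let cA0 : 0 < calA d alpha. Proof. exact: calA_gt0. Qed.

Definition energy_density f g (p : X * X) : R :=
  (f p.1 - f p.2) * (g p.1 - g p.2) * K (p.1 - p.2).

Lemma EformE f g : (Eform alpha f g = (calA d alpha / 2)%:E *
  \int[(leb d \x leb d)%E]_p (energy_density f g p)%:E)%E.
Proof.
rewrite /Eform; apply: (f_equal (fun t => ((calA d alpha / 2)%:E * t)%E)).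
by apply: eq_integral => p _; rewrite /energy_density /kern powRN.
Qed.

Lemma measurable_diff2 (f : X -> R) : measurable_fun setT f ->
  measurable_fun setT (fun p : X * X => f p.1 - f p.2).
Proof.
by move=> mf; apply: measurable_funB; apply: (measurableT_comp mf).
Qed.

Lemma measurable_kern_diff : measurable_fun setT (fun p : X * X => K (p.1 - p.2)).
Proof.
by apply: (measurableT_comp (@measurable_kern R d s)); apply: measurable_sub2.
Qed.

Lemma measurable_energy_density f g : measurable_fun setT f -> measurable_fun setT g ->
  measurable_fun setT (energy_density f g).
Proof.
move=> mf mg; apply: measurable_funM; last exact: measurable_kern_diff.
by apply: measurable_funM; exact: measurable_diff2.
Qed.

Lemma energy_density_ge0 f p : 0 <= energy_density f f p.
Proof. by rewrite mulr_ge0 ?kern_ge0// -expr2 sqr_ge0. Qed.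

Lemma Eform_ge0 f : (0 <= Eform alpha f f)%E.
Proof.
rewrite EformE mule_ge0//; first by rewrite lee_fin divr_ge0// ltW.
by apply: integral_ge0 => p _; rewrite lee_fin energy_density_ge0.
Qed.

Lemma Eform_lty f : measurable_fun setT f -> (Eform alpha f f < +oo)%E ->
  rintegrable (leb d \x leb d)%E (energy_density f f).
Proof.
move=> mf; rewrite EformE => foo; apply: rintegrable_ge0.
- exact: measurable_energy_density.
- exact: energy_density_ge0.
rewrite ltey; apply/eqP => h; move: foo.
by rewrite h gt0_muley ?ltxx// lte_fin divr_gt0.
Qed.

(** A class of functions on which the operator is an absolutely convergent
    integral and the energy is finite: boundedness, second differences and squared
    first differences of size min(1, |z|^2), and a carrier of finite measure. *)
Definition tame f := [/\ measurable_fun setT f, (exists B : R, forall x, `|f x| <= B),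
  (exists C : R, forall y z, `|sdiff f y z| <= C * m2 z),
  (exists2 C : R, 0 <= C & forall y z, (f (y + z) - f y) ^+ 2 <= C * m2 z) &
  exists D : set X, [/\ measurable D, (leb d D < +oo)%E & forall x, ~ D x -> f x = 0]].

Lemma rintegrable_tame f : tame f -> rintegrable (leb d) f.
Proof.
move=> [mf [B fB] _ _ [D [mD Doo f0]]].
apply: (@rintegrable_le _ _ _ _ _ (fun z => B * \1_D z)) => //.
  move=> z; rewrite indicE; have [/set_mem zD|/negP zD] := boolP (z \in D).
    by rewrite mulr1.
  by rewrite f0 ?normr0 ?mulr0// => /mem_set.
apply: rintegrableZ; apply: rintegrable_ge0 => //.
by rewrite integral_indic// setIT.
Qed.

Lemma tame_sqr f : tame f -> rintegrable (leb d) (fun x => f x ^+ 2).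
Proof.
move=> tf; have [mf [B fB] _ _ _] := tf.
by apply: (rintegrableM_bounded mf fB); exact: rintegrable_tame.
Qed.

(** The difference f(x) - f(y) vanishes unless x or y lies in the carrier D, and
    for x in D the integral in y is at most a constant times that of
    min(1, |z|^2) kern(z). *)
Lemma tame_energy f : tame f ->
  (\int[(leb d \x leb d)%E]_p (energy_density f f p)%:E < +oo)%E.
Proof.
move=> [mf _ _ [C C0 fC] [D [mD Doo f0]]].
have mI : measurable_fun setT (\1_D : X -> R) by exact: measurable_indic.
pose G x y := C * (\1_D x * (m2 (y - x) * K (y - x))).
have mG : measurable_fun setT (fun p : X * X => G p.1 p.2).
  apply: measurable_funM => //; apply: measurable_funM.
    exact: (measurableT_comp mI).
  have mm : measurable_fun setT (fun z : X => m2 z * K z).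
    by apply: measurable_funM; [exact: measurable_m2|exact: measurable_kern].
  by apply: (measurableT_comp mm); exact: measurable_sub2.
have Gi : rintegrable (leb d \x leb d)%E (fun p : X * X => G p.1 p.2).
  apply: (@rintegrable_prod_bound _ _ _ _ _ (leb d) (leb d) G (fun x => C * \1_D x)
    (\int[leb d]_z (m2 z * K z))) => //.
  - apply: rintegrableZ; apply: rintegrable_ge0 => //.
    by rewrite integral_indic// setIT.
  - by move=> x; rewrite mulr_ge0.
  - by apply: Rintegral_ge0 => z _; rewrite mulr_ge0 ?m2_ge0 ?kern_ge0.
  move=> x; have mi := rintegrable_m2kern s0 sn.
  rewrite -RintegralZl// EFin_Rintegral; last exact: rintegrableZ.
  rewrite -(@integral_shift _ _ (- x) (fun z => C * \1_D x * (m2 z * K z)));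
    last by apply: measurable_funM => //; exact: rintegrable_measurable mi.
  rewrite le_eqVlt; apply/orP; left; apply/eqP; apply: eq_integral => y _.
  rewrite /G ger0_norm ?mulrA// -!mulrA.
  by rewrite !mulr_ge0 ?m2_ge0 ?kern_ge0.
have Gi' := rintegrable_swap Gi.
apply: rintegrable_lty; first exact: energy_density_ge0.
apply: rintegrable_le (rintegrableD Gi Gi').
  exact: measurable_energy_density.
move=> [x y] /=; rewrite ger0_norm ?energy_density_ge0// /energy_density/= /G.
have -> : K (x - y) = K (y - x) by rewrite -[x - y]opprB kernN.
have -> : m2 (x - y) = m2 (y - x) by rewrite /m2 distrC.
have h : (f y - f x) ^+ 2 <= C * m2 (y - x) by have := fC x (y - x); rewrite subrKC.
have k0 := kern_ge0 s (y - x); have m0 := m2_ge0 (y - x).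
have M0 : 0 <= C * (m2 (y - x) * K (y - x)) by rewrite !mulr_ge0.
have h' : (f x - f y) * (f x - f y) * K (y - x) <= C * (m2 (y - x) * K (y - x)).
  by rewrite -expr2 -sqrrN opprB mulrA ler_wpM2r.
rewrite !indicE; have [xD|/negP xD] := boolP (x \in D).
  rewrite mul1r (le_trans h')// lerDl !mulr_ge0//.
have [yD|/negP yD] := boolP (y \in D).
  rewrite mul1r (le_trans h')// lerDr !mulr_ge0//.
rewrite !f0; [|by move=> /mem_set..].
by rewrite subrr !mul0r mulr0 addr0.
Qed.

Lemma tame_sobolev f : tame f -> sobolev alpha f.
Proof.
move=> tf; have [mf _ _ _ _] := tf; split.
  split => //; apply: rintegrable_lty; last exact: tame_sqr.
  by move=> x; exact: sqr_ge0.
have c0 : 0 <= calA d alpha / 2 by apply: divr_ge0 => //; exact: ltW.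
by rewrite EformE lte_mul_pinfty ?lee_fin//; exact: tame_energy.
Qed.

Section bilinear.
Variables (f g : X -> R).
Hypothesis tf : tame f.
Hypothesis mg : measurable_fun setT g.
Hypothesis gE : (Eform alpha g g < +oo)%E.
Hypothesis gi : rintegrable (leb d) g.

Let mf : measurable_fun setT f. Proof. by case: tf. Qed.

Let fi : rintegrable (leb d \x leb d)%E (energy_density f f).
Proof. by apply: Eform_lty => //; case: (tame_sobolev tf). Qed.

Let dens N (p : X * X) : R :=
  (f p.1 - f p.2) * (g p.1 - g p.2) * ktr s N (p.1 - p.2).

Let mktr N : measurable_fun setT (fun p : X * X => ktr s N (p.1 - p.2)).
Proof.
apply: (measurableT_comp (@measurable_ktr R d s N)); exact: measurable_sub2.
Qed.

Let mdens N : measurable_fun setT (dens N).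
Proof.
apply: measurable_funM => //.
by apply: measurable_funM; exact: measurable_diff2.
Qed.

Let amgm (a b : R) : `|a * b| <= a * a + b * b.
Proof.
rewrite ler_norml; apply/andP; split.
  by have := sqr_ge0 (a + b); have := sqr_ge0 a; have := sqr_ge0 b; nra.
by have := sqr_ge0 (a - b); have := sqr_ge0 a; have := sqr_ge0 b; nra.
Qed.

Let dom : rintegrable (leb d \x leb d)%E
  (fun p => energy_density f f p + energy_density g g p).
Proof. by apply: rintegrableD => //; exact: Eform_lty. Qed.

Let dens_cvg : \int[(leb d \x leb d)%E]_p dens N p @[N --> \oo] -->
  \int[(leb d \x leb d)%E]_p energy_density f g p.
Proof.
apply: Rintegral_dominated dom _ _ => //.
- exact: measurable_energy_density.
- move=> N p; rewrite /dens /energy_density -mulrDl normrM.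
  rewrite (ger0_norm (ktr_ge0 _ _ _)); apply: ler_pM => //; first exact: ktr_ge0.
  exact: ktr_le.
- by move=> p; apply: cvgM; [exact: cvg_cst|exact: ktr_cvg].
Qed.

Let densE N : \int[(leb d \x leb d)%E]_p dens N p =
  \int[leb d]_x (g x * nlop (ktr s N) f x).
Proof.
have [_ [B fB] _ _ _] := tf.
have B0 : 0 <= B by exact: le_trans (fB 0).
pose F x y := g x * ((f x - f y) * ktr s N (y - x)).
have Fi : rintegrable (leb d \x leb d)%E (fun p : X * X => F p.1 p.2).
  apply: (@rintegrable_prod_bound _ _ _ _ _ (leb d) (leb d) F (fun x => `|g x|)
    (2 * B * \int[leb d]_z ktr s N z)) => //.
  - apply: measurable_funM; first exact: measurableT_comp.
    apply: measurable_funM; first exact: measurable_diff2.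
    by apply: (measurableT_comp (@measurable_ktr R d s N)); exact: measurable_sub2.
  - exact: rintegrable_norm.
  - by rewrite !mulr_ge0// Rintegral_ge0// => z _; exact: ktr_ge0.
  move=> x; have ki := rintegrable_ktr s0 sn N.
  have ki2 := rintegrableZ `|g x| (rintegrableZ (2 * B) ki).
  rewrite -RintegralZl// -RintegralZl//; last exact: rintegrableZ.
  rewrite EFin_Rintegral//.
  rewrite -(@integral_shift _ _ (- x) (fun z => `|g x| * (2 * B * ktr s N z)));
    last exact: rintegrable_measurable ki2.
  apply: ge0_le_integral => //.
  - apply/measurable_EFinP; apply: measurableT_comp => //.
    apply: measurable_funM => //; apply: measurable_funM.
      exact: measurable_funB.
    by apply: (measurableT_comp (@measurable_ktr R d s N)); exact: measurable_sub2.
  - apply/measurable_EFinP; do 2 apply: measurable_funM => //.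
    by apply: (measurableT_comp (@measurable_ktr R d s N)); exact: measurable_sub2.
  move=> y _; rewrite lee_fin !normrM ler_wpM2l// (ger0_norm (ktr_ge0 _ _ _)).
  rewrite ler_wpM2r ?ktr_ge0// (le_trans (ler_normB _ _))//.
  by rewrite mulr_natl mulr2n lerD.
have Fi' := rintegrable_swap Fi.
rewrite (Rintegral_eq _ (g := fun p => F p.1 p.2 + F p.2 p.1)); last first.
  move=> [x y]; rewrite /dens /F/=.
  have -> : ktr s N (x - y) = ktr s N (y - x) by rewrite -[x - y]opprB ktrN.
  ring.
have ri (x : X) : rintegrable (leb d) (fun w => (f x - f w) * ktr s N (w - x)).
  have mfx : measurable_fun setT (fun w => f x - f w) by exact: measurable_funB.
  have bfx z : `|f x - f z| <= B + B.
    by rewrite (le_trans (ler_normB _ _))// lerD.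
  have kx := rintegrable_shift (- x) (rintegrable_ktr s0 sn N).
  exact: (rintegrableM_bounded mfx bfx kx).
have E1 := Rintegral_prod1 Fi.
have E2 := @Rintegral_prod1 _ _ _ _ _ _ _ (fun x y => F y x) Fi'.
have E3 := Rintegral_swap Fi.
apply: (etrans (RintegralD measurableT Fi Fi')).
apply: (etrans (f_equal2 +%R (esym E1) (etrans (esym E2) (esym E3)))).
apply: (etrans (esym (RintegralD measurableT (rintegrable_prod1 Fi)
  (rintegrable_prod1 Fi)))).
apply: Rintegral_eq => x; rewrite (nlop_ktrE' s0 sn mf fB).
by rewrite /F (RintegralZl _ measurableT (ri x)); ring.
Qed.

(** Integration by parts for the form.  For a capped kernel the factor g(x) - g(y)
    is split and the two halves agree by symmetry; the energy densities of f and g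
    dominate the passage to the limit. *)
Lemma energy_bilinear : (Eform alpha f g =
  (\int[leb d]_x (calA d alpha / 2 * nlop K f x * g x))%:E)%E.
Proof.
have [_ [B fB] [C fC] _ _] := tf.
have gn : rintegrable (leb d) (fun x => g x * nlop K f x).
  under eq_fun do rewrite mulrC.
  apply: (rintegrableM_bounded (B := C * \int[leb d]_z (m2 z * K z))) => //.
    by apply: measurable_nlop => //; exact: measurable_kern.
  exact: nlop_bounded.
have gnN N : rintegrable (leb d) (fun x => g x * nlop (ktr s N) f x).
  under eq_fun do rewrite mulrC.
  apply: (rintegrableM_bounded (B := C * \int[leb d]_z (m2 z * K z) + C * kerr d s N)) => //.
    by apply: measurable_nlop => //; exact: measurable_ktr.
  move=> x; have := nlop_err s0 sn mf fC N x.
  have := nlop_bounded s0 sn mf fC x => h1 h2.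
  rewrite -[X in `|X|](subrK (nlop K f x)) (le_trans (ler_normD _ _))// addrC.
  by rewrite lerD// distrC.
have lim2 : \int[leb d]_x (g x * nlop (ktr s N) f x) @[N --> \oo] -->
    \int[leb d]_x (g x * nlop K f x).
  apply/cvgrPdist_le => eps eps0.
  have k0 : C * kerr d s N * \int[leb d]_x `|g x| @[N --> \oo] --> (0 : R).
    rewrite -[X in _ --> X](mul0r (\int[leb d]_x `|g x|)).
    apply: cvgM; last exact: cvg_cst.
    rewrite -[X in _ --> X](mulr0 C); apply: cvgM; first exact: cvg_cst.
    exact: kerr_cvg0.
  move/cvgrPdist_le : k0 => /(_ _ eps0); apply: filterS => N.
  rewrite sub0r normrN => h; apply: le_trans h.
  rewrite -RintegralB// (le_trans _ (ler_norm _))// -RintegralZl//;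
    last exact: rintegrable_norm.
  apply: Rintegral_norm_le; first exact: rintegrableB.
    by apply: rintegrableZ; exact: rintegrable_norm.
  move=> x; rewrite -mulrBr normrM mulrC ler_wpM2r//.
  exact: nlop_err.
have E : \int[(leb d \x leb d)%E]_p energy_density f g p =
    \int[leb d]_x (g x * nlop K f x).
  apply: (cvg_unique _ dens_cvg) => //=.
  by under eq_fun do rewrite densE.
have fgi : rintegrable (leb d \x leb d)%E (energy_density f g).
  apply: rintegrable_le dom; first exact: measurable_energy_density.
  move=> p; rewrite /energy_density -mulrDl normrM.
  by rewrite (ger0_norm (kern_ge0 _ _)) ler_wpM2r ?kern_ge0.
rewrite EformE -EFin_Rintegral// E -EFinM -RintegralZl//.
by apply: (f_equal EFin); apply: Rintegral_eq => x; ring.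
Qed.

End bilinear.

Lemma cap_open_ge0 U : (0 <= cap_open alpha U)%E.
Proof.
apply: le_ereal_inf_tmp => _ [f _ <-]; rewrite adde_ge0 ?Eform_ge0//.
by apply: integral_ge0 => x _; rewrite lee_fin sqr_ge0.
Qed.

Lemma cap_ge0 A : (0 <= cap alpha A)%E.
Proof.
by apply: le_ereal_inf_tmp => _ [U _ <-]; exact: cap_open_ge0.
Qed.

Lemma tame0 : tame (fun=> 0).
Proof.
split => //.
- by exists 0 => x; rewrite normr0.
- by exists 0 => y z; rewrite /sdiff mulr0 !subr0 normr0 mul0r.
- by exists 0 => // y z; rewrite subrr expr0n mul0r.
- by exists set0; split => //; rewrite measure0.
Qed.

Lemma cap_set0 : cap alpha (set0 : set X) = 0%E.
Proof.
apply/eqP; rewrite eq_le cap_ge0 andbT; apply: ereal_inf_lbound.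
exists set0; first by split => //; exact: open0.
apply/eqP; rewrite eq_le cap_open_ge0 andbT; apply: ereal_inf_lbound.
exists (fun=> 0); first by split; [exact: tame_sobolev tame0|exact: aeW].
rewrite EformE.
rewrite (eq_integral (cst 0%E)); last first.
  by move=> p _; rewrite /energy_density subrr !mul0r.
rewrite integral0 mule0 add0e (eq_integral (cst 0%E)) ?integral0//.
by move=> x _; rewrite expr0n.
Qed.

(** A competitor for the capacity of an open set is at least 1 on it, so the
    capacity dominates the measure.  This is the only link between quasi-everywhere
    and almost-everywhere statements that the proof needs. *)
Lemma cap0_negligible A : cap alpha A = 0%E -> (leb d).-negligible A.
Proof.
move=> A0.
have h k : exists U : set X, [/\ open U, A `<=` U & (leb d U <= (k.+1%:R^-1)%:E)%E].
  have : (cap alpha A < (k.+1%:R^-1)%:E)%E by rewrite A0 lte_fin invr_gt0.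
  move/ereal_inf_lt => [_ [U [oU AU] <-]].
  move/ereal_inf_lt => [_ [f [[[mf _] _] f1] <-] lt].
  exists U; split => //.
  have mU : measurable U by exact: open_measurable_rV.
  have sq0 x : (0 <= (f x ^+ 2)%:E)%E by rewrite lee_fin sqr_ge0.
  have mf2 : measurable_fun setT (fun x => (f x ^+ 2)%:E).
    by apply/measurable_EFinP; exact: measurable_funX.
  have le1 : (leb d U <= \int[leb d]_(x in U) (f x ^+ 2)%:E)%E.
    rewrite -[leLHS]mul1e -integral_cst//.
    apply: ae_ge0_le_integral => //.
      exact: measurable_funTS.
    apply: filterS f1 => x /= h Ux; rewrite lee_fin.
    by rewrite exprn_ege1// h.
  have le2 : (\int[leb d]_(x in U) (f x ^+ 2)%:E <= \int[leb d]_x (f x ^+ 2)%:E)%E.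
    by apply: ge0_subset_integral.
  apply: le_trans le1 (le_trans le2 _); apply: le_trans (ltW lt).
  by rewrite leeDr// Eform_ge0.
have {h}[U hU] := choice h.
exists (\bigcap_k U k); split.
- by apply: bigcapT_measurable => k; apply: open_measurable_rV; case: (hU k).
- apply/eqP; rewrite eq_le measure_ge0 andbT; apply/lee_addgt0Pr => eps eps0.
  rewrite add0e.
  have [k kh] : exists k, k.+1%:R^-1 <= eps.
    exists (Num.truncn eps^-1); rewrite -[leRHS]invrK lef_pV2 ?posrE ?invr_gt0//.
    by rewrite ltW// truncnS_gt.
  have [oU _ Uk] := hU k.
  apply: (@le_trans _ _ (leb d (U k))).
    apply: le_measure; rewrite ?inE.
    - by apply: bigcapT_measurable => j; apply: open_measurable_rV; case: (hU j).
    - exact: open_measurable_rV.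
    - by move=> x; apply.
  by rewrite (le_trans Uk)// lee_fin.
- by move=> x Ax k _; have [_ AU _] := hU k; exact: AU.
Qed.

Lemma sobolev0_out Omega g : sobolev0 alpha Omega g ->
  {ae leb d, forall x, ~ Omega x -> g x = 0}.
Proof.
move=> [_ [g' [_ gg' /cap0_negligible[N [mN N0 hN]]]]].
have : {ae leb d, forall x, ~ Omega x -> g' x = 0}.
  exists N; split => // x /= h; apply: hN => /=; apply: contra_notP h.
  move=> h Ox; apply: contra_notP h => gx; split => //; exact/eqP.
by apply: filterS2 gg' => x -> h; exact: h.
Qed.

Lemma sobolev0_integrable Omega g : measurable Omega -> bounded_set Omega ->
  sobolev0 alpha Omega g -> rintegrable (leb d) g.
Proof.
move=> mO [M [_ bO]] sg; have := sobolev0_out sg; have [[[mg g2] _] _] := sg.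
pose r := Num.max M 0 + 1.
have r0 : 0 < r by rewrite ltr_wpDl// le_max lexx orbT.
have Or x : Omega x -> `|x| < r + 1.
  move=> Ox; rewrite (@le_lt_trans _ _ r) ?ltrDl//; apply: bO => //.
  by rewrite /r ltr_pwDr// le_max lexx.
have r1 : 0 < r + 1 by rewrite addr_gt0.
have mb := @measurable_ballV R d (r + 1).
move=> out; apply/integrableP; split; first exact/measurable_EFinP.
have mg2 : measurable_fun setT (fun x => (g x ^+ 2)%:E).
  by apply/measurable_EFinP; exact: measurable_funX.
have mI : measurable_fun setT (fun x : X => (\1_[set v : X | `|v| < r + 1] x : R)%:E).
  by apply/measurable_EFinP; exact: measurable_indic.
apply: (@le_lt_trans _ _ (\int[leb d]_x ((g x ^+ 2)%:E +
   (\1_[set v : X | `|v| < r + 1] x : R)%:E))%E).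
  apply: ae_ge0_le_integral => //.
  - by apply: measurableT_comp => //; exact/measurable_EFinP.
  - by move=> x _; rewrite adde_ge0// lee_fin ?sqr_ge0.
  - exact: emeasurable_funD.
  apply: filterS out => x gx _; rewrite /= -EFinD lee_fin indicE.
  have [xO|xO] := pselect (Omega x).
    rewrite mem_set; last exact: Or.
    rewrite -(real_normK (num_real (g x))) (_ : true%:R = 1 :> R)//.
    by set t := `|g x|; have := sqr_ge0 (t - 2^-1); nra.
  by rewrite gx// normr0 expr0n add0r.
rewrite ge0_integralD//; last by move=> x _; rewrite lee_fin sqr_ge0.
rewrite lte_add_pinfty// integral_indic// setIT.
by rewrite [ltLHS](leb_ball d r1) ltry.
Qed.

Definition L0 f x := calA d alpha / 2 * nlop K f x.

Lemma measurable_L0 f : measurable_fun setT f -> measurable_fun setT (L0 f).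
Proof.
move=> mf; apply: measurable_funM => //; apply: measurable_nlop => //.
exact: measurable_kern.
Qed.

Lemma L0_bounded f : tame f -> exists B : R, forall x, `|L0 f x| <= B.
Proof.
move=> [mf _ [C fC] _ _].
exists (calA d alpha / 2 * (C * \int[leb d]_z (m2 z * K z))) => x.
have c0 : 0 <= calA d alpha / 2 by apply: divr_ge0 => //; exact: ltW.
rewrite normrM (ger0_norm c0); apply: ler_wpM2l => //.
exact: nlop_bounded.
Qed.

(** A continuous function carried by Omega is its own quasi-continuous version and
    has an empty exceptional set, so it belongs to the form domain; the
    representation of the form is then [energy_bilinear]. *)
Lemma is_L0_tame Omega f : measurable Omega -> bounded_set Omega -> tame f ->
  continuous f -> (forall x, f x != 0 -> Omega x) -> is_L0 alpha Omega f (L0 f).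
Proof.
move=> mO bO tf cf fO; have [mf _ _ _ _] := tf; split.
- split; first exact: tame_sobolev.
  exists f; split; last first.
  + rewrite (_ : [set x | _] = set0) ?cap_set0//.
    by apply/seteqP; split => // x [nO /eqP/fO].
  + exact: aeW.
  + move=> eps eps0; exists set0; split; first exact: open0.
      by rewrite cap_set0 lte_fin.
    exact: continuous_subspaceT.
- split; first by apply: measurable_funTS; exact: measurable_L0.
  have [B hB] := L0_bounded tf.
  have [M [_ bM]] := bO.
  pose r := Num.max M 0 + 1.
  have r0 : 0 < r by rewrite ltr_wpDl// le_max lexx orbT.
  have Or x : Omega x -> `|x| < r + 1.
    move=> Ox; rewrite (@le_lt_trans _ _ r) ?ltrDl//; apply: bM => //.
    by rewrite /r ltr_pwDr// le_max lexx.
  have r1 : 0 < r + 1 by rewrite addr_gt0.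
  apply: (@le_lt_trans _ _ (\int[leb d]_(x in Omega) (cst (B ^+ 2)%:E x))%E).
    apply: ge0_le_integral => //.
    + by move=> x _; rewrite lee_fin sqr_ge0.
    + apply/measurable_EFinP; apply: measurable_funX; apply: measurable_funTS.
      exact: measurable_L0.
    move=> x _; rewrite lee_fin -real_normK ?num_real// lerXn2r ?nnegrE//.
    by rewrite (le_trans _ (hB x)).
  rewrite integral_cst// lte_mul_pinfty ?lee_fin ?sqr_ge0//.
  apply: (@le_lt_trans _ _ (leb d [set v : X | `|v| < r + 1])).
    by apply: le_measure; rewrite ?inE//; exact: measurable_ballV.
  by rewrite [ltLHS](leb_ball d r1) ltry.
move=> g sg; have [[[mg _] gE] _] := sg.
have gi := sobolev0_integrable mO bO sg.
rewrite (energy_bilinear tf mg gE gi) EFin_Rintegral; last first.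
  have [B hB] := L0_bounded tf.
  by apply: (rintegrableM_bounded (B := B)) gi => //; exact: measurable_L0.
rewrite [RHS]integral_mkcond; apply: ae_eq_integral => //.
- apply/measurable_EFinP; apply: measurable_funM => //; exact: measurable_L0.
- apply/(measurable_restrictT _ _).1 => //; apply: measurable_funTS.
  apply/measurable_EFinP; apply: measurable_funM => //; exact: measurable_L0.
apply: filterS (sobolev0_out sg) => x gx _; rewrite patchE.
by case: ifPn => // /negP xO; rewrite gx ?mulr0// => /mem_set.
Qed.

End energy.

(** * Admissible test functions *)

Section time_cutoff.
Context {R : realType}.

Lemma is_derive_quadratic (f : R -> R) (a l : R) :
  (forall b, `|f b - f a - l * (b - a)| <= (b - a) ^+ 2) -> is_derive a 1 f l.
Proof.
move=> h.
have c : h^-1 *: ((f \o shift a) (h *: (1 : R)) - f a) @[h --> 0^'] --> l.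
  apply/cvgrPdist_le => eps eps0; near=> k.
  have k0 : k != 0 by near: k; exact: nbhs_dnbhs_neq.
  have ke : `|k| <= eps.
    near: k; apply/dnbhs0_le => //.
  have := h (k + a); rewrite addrK => hk.
  rewrite distrC (_ : _ - l = k^-1 * (f (k + a) - f a - l * k)); last first.
    by rewrite /= /GRing.scale/= mulr1; field.
  rewrite normrM normrV ?unitfE// ler_pdivrMl ?normr_gt0//.
  apply: le_trans hk _; rewrite -real_normK ?num_real// expr2 ler_wpM2l//.
have dl : derivable f a 1 by apply/cvg_ex; exists l.
split => //; exact: cvg_lim c.
Unshelve. all: by end_near. Qed.

Lemma is_derive_possq (a : R) : is_derive a 1 (@possq R) (2 * Num.max 0 a).
Proof.
apply: is_derive_quadratic => b; have /andP[h1 h2] := possq_taylor a b.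
by rewrite ger0_norm.
Qed.

(** A C^1 cutoff equal to 1 up to time t and to 0 after t + 1.  The weak identity
    at time t only sees s <= t, where theta is constant; the decay makes the test
    function square integrable when the time interval is unbounded. *)
Definition theta (t s : R) : R := possq (1 - possq (s - t)).

Definition dtheta (t s : R) : R :=
  - (2 * Num.max 0 (s - t)) * (2 * Num.max 0 (1 - possq (s - t))).

Lemma is_derive_theta (t s : R) : is_derive s 1 (theta t) (dtheta t s).
Proof.
have h1 : is_derive s 1 (fun s : R => s - t) 1.
  by apply: is_derive_eq; rewrite subr0.
have h2 : is_derive s 1 (fun s : R => possq (s - t)) (2 * Num.max 0 (s - t)).
  apply: is_derive_eq.
    exact: (is_derive1_comp (f := @possq R) (g := fun s : R => s - t)
      (is_derive_possq _) h1).
  by rewrite mulr1.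
pose g : R -> R := fun s => possq (s - t).
have h3 : is_derive s 1 (cst (1 : R) - g) (0 - 2 * Num.max 0 (s - t)).
  exact: is_deriveB.
apply: is_derive_eq.
  exact: (is_derive1_comp (f := @possq R) (g := cst (1 : R) - g)
    (is_derive_possq (1 - possq (s - t))) h3).
by rewrite /dtheta mulrC sub0r.
Qed.

Lemma possq_le0 (a : R) : a <= 0 -> possq a = 0.
Proof. by move=> a0; rewrite /possq (max_idPl _)// expr0n. Qed.

Lemma possq_ge1 (a : R) : 1 <= a -> 1 <= possq a.
Proof.
by move=> a1; rewrite /possq exprn_ege1// le_max a1 orbT.
Qed.

Lemma possq_ge0 (a : R) : 0 <= possq a. Proof. exact: sqr_ge0. Qed.

Lemma theta_le (t s : R) : s <= t -> theta t s = 1.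
Proof.
move=> st; rewrite /theta (@possq_le0 (s - t)) ?subr_le0//.
by rewrite subr0 /possq (max_idPr _)// expr1n.
Qed.

Lemma theta_ge (t s : R) : t + 1 <= s -> theta t s = 0.
Proof.
move=> ts; rewrite /theta possq_le0// subr_le0 possq_ge1//.
by rewrite lerBrDl.
Qed.

Lemma theta_bound (t s : R) : `|theta t s| <= 1.
Proof.
rewrite ger0_norm ?possq_ge0// /theta /possq exprn_ile1 ?le_max ?lexx//.
by rewrite ge_max ler01/= gerBl sqr_ge0.
Qed.

Lemma dtheta_le (t s : R) : s <= t -> dtheta t s = 0.
Proof.
by move=> st; rewrite /dtheta (max_idPl _) ?subr_le0// mulr0 oppr0 mul0r.
Qed.

Lemma dtheta_ge (t s : R) : t + 1 <= s -> dtheta t s = 0.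
Proof.
move=> ts; rewrite /dtheta (_ : Num.max 0 (1 - _) = 0) ?mulr0//.
by apply/max_idPl; rewrite subr_le0 possq_ge1// lerBrDl.
Qed.

Lemma dtheta_bound (t s : R) : `|dtheta t s| <= 4.
Proof.
have [ts|ts] := leP (t + 1) s; first by rewrite dtheta_ge// normr0.
rewrite /dtheta mulNr normrN.
have h1 : 0 <= Num.max 0 (s - t) <= 1.
  by rewrite le_max lexx/= ge_max ler01/= lerBlDl ltW.
have h2 : 0 <= Num.max 0 (1 - possq (s - t)) <= 1.
  by rewrite le_max lexx/= ge_max ler01/= gerBl possq_ge0.
by rewrite ger0_norm; nra.
Qed.

Lemma measurable_possq : measurable_fun setT (@possq R).
Proof. by apply: measurable_funX; exact: measurable_maxr. Qed.

Lemma measurable_theta t : measurable_fun setT (theta t).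
Proof.
apply: (measurableT_comp measurable_possq); apply: measurable_funB => //.
by apply: (measurableT_comp measurable_possq); exact: measurable_funB.
Qed.

Lemma measurable_dtheta t : measurable_fun setT (dtheta t).
Proof.
apply: measurable_funM.
  apply: measurable_funN; apply: measurable_funM => //.
  by apply: measurable_maxr => //; exact: measurable_funB.
apply: measurable_funM => //; apply: measurable_maxr => //.
apply: measurable_funB => //.
by apply: (measurableT_comp measurable_possq); exact: measurable_funB.
Qed.

End time_cutoff.

Section test_functions.
Context {R : realType} (d : nat) (alpha : R).
Hypothesis halpha : 0 < alpha < 2.
Local Notation s := (d%:R + alpha).
Local Notation K := (@kern R d s).
Local Notation X := ('rV[R]_d).
Implicit Types (x y z : X) (e c : R).

Let s0 : 0 < s. Proof. by case/andP: halpha => a0 _; rewrite ltr_wpDl. Qed.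
Let sn : d%:R < s < d%:R + 2.
Proof. by case/andP: halpha => a0 a2; rewrite ltrDl a0 ltrD2l. Qed.
Let cA0 : 0 < calA d alpha. Proof. exact: calA_gt0. Qed.

Definition atest c e x y : R := c * moll e (x - y).

Lemma atest_continuous c e x : continuous (atest c e x).
Proof.
move=> y; have h1 : {for y, continuous (fun y => x - y)}.
  by apply: continuousB; [exact: cst_continuous|exact: cvg_id].
have h2 : {for y, continuous (fun y => moll e (x - y))}.
  exact: (continuous_comp h1 (@moll_continuous R d e (x - y))).
exact: (continuousM (@cst_continuous _ _ c y) h2).
Qed.

Lemma sdiff_atest c e x y z :
  sdiff (atest c e x) y z = c * sdiff (moll e) (x - y) z.
Proof.
by rewrite /sdiff /atest opprD opprB !addrA (addrAC x z) ; ring.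
Qed.

Lemma nlop_atest c e x y : 0 < e ->
  nlop K (atest c e x) y = c * nlop K (moll e) (x - y).
Proof.
move=> e0; have [C C0 hC] := @moll_sdiff R d e e0.
apply: etrans (RintegralZl c measurableT
  (rintegrable_nlop s0 sn (@measurable_moll R d e) hC (x - y))).
by apply: Rintegral_eq => z; rewrite sdiff_atest mulrA.
Qed.

Lemma leb_ball_center x (e : R) : 0 < e ->
  leb d [set y : X | `|x - y| < e] = ((2 * e) ^+ d)%:E.
Proof.
move=> e0; have mb := @measurable_ballV R d e.
have mI : measurable_fun setT (\1_[set v : X | `|v| < e] : X -> R).
  exact: measurable_indic.
have mA : measurable [set y : X | `|x - y| < e].
  apply: measurable_set_lt; apply: (measurableT_comp (@measurable_normV R d)).
  exact: measurable_subV.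
transitivity (\int[leb d]_y (\1_[set v : X | (`|v| < e)%R] (x - y)%R : R)%:E)%E.
  rewrite (eq_integral (fun y => (\1_[set y : X | (`|x - y| < e)%R] y)%:E)).
    by rewrite integral_indic// setIT.
  by move=> y _; apply: (f_equal EFin); apply: eq_indic.
rewrite (integral_subV x mI) integral_indic// setIT.
exact: leb_ball.
Qed.

Lemma tame_atest c e x : 0 < e -> tame (atest c e x).
Proof.
move=> e0; split.
- by apply: continuous_measurable_rV; exact: atest_continuous.
- have [B hB] := @moll_bounded R d e e0; exists (`|c| * B) => y.
  by rewrite normrM ler_wpM2l.
- have [C C0 hC] := @moll_sdiff R d e e0; exists (`|c| * C) => y z.
  by rewrite sdiff_atest normrM -mulrA ler_wpM2l.
- have [C C0 hC] := @moll_lip R d e e0; exists (c ^+ 2 * C).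
    by rewrite mulr_ge0// sqr_ge0.
  move=> y z; have := hC (x - y) (- z); rewrite normrN => h.
  by rewrite /atest -mulrBr exprMn -mulrA opprD addrA ler_wpM2l// sqr_ge0.
exists [set y | `|x - y| < e]; split.
- apply: measurable_set_lt; apply: (measurableT_comp (@measurable_normV R d)).
  exact: measurable_subV.
- by rewrite leb_ball_center// ltry.
- by move=> y /negP; rewrite -leNgt => h; rewrite /atest moll_out ?mulr0.
Qed.

Lemma L0_atest c e x y : 0 < e -> L0 alpha (atest c e x) y = c * L0 alpha (moll e) (x - y).
Proof. by move=> e0; rewrite /L0 nlop_atest//; ring. Qed.

(** Lower bound responsible for the instantaneous propagation of positivity. *)
Lemma kern_ge M : 0 <= M ->
  exists2 k0 : R, 0 < k0 & forall w : X, w != 0 -> `|w| <= M -> k0 <= K w.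
Proof.
move=> M0; exists ((Num.sqrt d%:R * M + 1) `^ (- s)).
  by rewrite powR_gt0// ltr_wpDl// mulr_ge0// sqrtr_ge0.
move=> w w0 wM; have w1 : 0 < enorm w.
  by rewrite (lt_le_trans _ (normr_le_enorm w))// normr_gt0.
rewrite /kern !powRN lef_pV2 ?posrE ?powR_gt0//; last first.
  by rewrite ltr_wpDl// mulr_ge0// sqrtr_ge0.
rewrite ge0_ler_powR ?nnegrE ?(ltW w1) ?(ltW s0)//.
  by rewrite addr_ge0// mulr_ge0// sqrtr_ge0.
apply: le_trans (enorm_le w) _; rewrite (@le_trans _ _ (Num.sqrt d%:R * M))//.
  by rewrite ler_wpM2l// sqrtr_ge0.
by rewrite lerDl.
Qed.

(** Outside the support of the mollifier the second difference is
    - rho(z + w) - rho(z - w), and the kernel is bounded below at the relevant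
    distances while each mollifier has integral 1. *)
Lemma L0_moll_neg e M : 0 < e -> 0 <= M -> exists2 c : R, 0 < c &
  forall z : X, e <= `|z| -> `|z| <= M -> L0 alpha (moll e) z <= - c.
Proof.
move=> e0 M0; have Me : 0 <= M + e by rewrite addr_ge0// ltW.
have [k0 k00 hk] := kern_ge Me.
exists (calA d alpha * k0); first by rewrite mulr_gt0.
move=> z ez zM; have [C C0 hC] := @moll_sdiff R d e e0.
have mi := @rintegrable_moll R d e e0.
have i1 : rintegrable (leb d) (fun w => moll e (z - w)).
  exact: (rintegrable_subV z mi).
have i2 : rintegrable (leb d) (fun w => moll e (w + z)).
  exact: (rintegrable_shift z mi).
have mm := rintegrable_measurable mi.
have v1 : \int[leb d]_w moll e (z - w) = 1.
  by apply: etrans (Rintegral_subV z mm) _; exact: Rintegral_moll.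
have v2 : \int[leb d]_w moll e (w + z) = 1.
  by apply: etrans (Rintegral_shift z mm) _; exact: Rintegral_moll.
have v : \int[leb d]_w (- k0 * (moll e (w + z) + moll e (z - w))) = - k0 * 2.
  rewrite RintegralZl//; last exact: rintegrableD.
  by rewrite RintegralD// v1 v2.
have le1 : nlop K (moll e) z <= - k0 * 2.
  rewrite -v; apply: Rintegral_le.
  - exact: (rintegrable_nlop s0 sn mm hC z).
  - by apply: rintegrableZ; exact: rintegrableD.
  move=> w; rewrite /sdiff (moll_out e0 ez) mulr0 sub0r [w + z]addrC.
  have [w0|w0] := eqVneq w 0.
    have -> : z + w = z by rewrite w0 addr0.
    have -> : z - w = z by rewrite w0 subr0.
    by rewrite (moll_out e0 ez) oppr0 addr0 mul0r mulr0.
  have g1 := @moll_ge0 R d e e0 (z + w); have g2 := @moll_ge0 R d e e0 (z - w).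
  have [wM|wM] := leP `|w| (M + e).
    have := hk w w0 wM; set t := K w => kt; nra.
  have h1 : e <= `|z + w|.
    by have := lerB_normD w z; rewrite [z + w]addrC; lra.
  have h2 : e <= `|z - w|.
    by have := lerB_normD w (- z); rewrite normrN distrC; lra.
  by rewrite !(moll_out e0)// oppr0 addr0 mul0r mulr0.
rewrite /L0; have := cA0; move: le1; set t := nlop _ _ _; nra.
Qed.

Lemma L0_moll_le0 e z : 0 < e -> e <= `|z| -> L0 alpha (moll e) z <= 0.
Proof.
move=> e0 ez; have [c c0 h] := @L0_moll_neg e `|z| e0 (normr_ge0 z).
by apply: le_trans (h z ez (lexx _)) _; rewrite oppr_le0 ltW.
Qed.

End test_functions.

(** * Continuity of translations in L1 *)

Section translation_continuity.
Context {R : realType} (n : nat).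
Local Notation X := ('rV[R]_n).
Implicit Types (f g : X -> R) (v x y : X) (A B W : set X) (eps tau : R).

(** Continuity of translations at 0, bundled with integrability: the class of these
    functions is stable under the operations of the density argument, from open
    sets to measurable sets, simple functions and integrable functions. *)
Definition tcont f := rintegrable (leb n) f /\
  forall eps, 0 < eps -> exists2 tau, 0 < tau &
    forall v, `|v| < tau -> \int[leb n]_x `|f (x + v) - f x| <= eps.

Lemma rintegrable_tdiff f v : rintegrable (leb n) f ->
  rintegrable (leb n) (fun x => `|f (x + v) - f x|).
Proof.
move=> fi; apply: rintegrable_norm; apply: rintegrableB => //.
exact: (rintegrable_shift v fi).
Qed.

Lemma Rintegral_norm_shift f v : rintegrable (leb n) f ->
  \int[leb n]_x `|f (x + v)| = \int[leb n]_x `|f x|.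
Proof.
move=> fi.
exact: (Rintegral_shift v (rintegrable_measurable (rintegrable_norm fi))).
Qed.

(** Stability under L1 limits: a translation moves f - g by no more than twice its
    norm. *)
Lemma tcont_lim f : rintegrable (leb n) f ->
  (forall eps, 0 < eps -> exists2 g : X -> R, tcont g & \int[leb n]_x `|f x - g x| <= eps) ->
  tcont f.
Proof.
move=> fi h; split => // eps eps0.
have e3 : 0 < eps / 3 by rewrite divr_gt0.
have [g [gi gc] fg] := h _ e3; have [tau tau0 ht] := gc _ e3.
exists tau => // v vt; have fgi := rintegrableB fi gi.
have i1 := rintegrable_shift v (rintegrable_norm fgi).
have i2 := rintegrable_tdiff v gi.
have i3 := rintegrable_norm fgi.
apply: (@le_trans _ _ (\int[leb n]_x ((`|f (x + v) - g (x + v)| +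
    `|g (x + v) - g x|) + `|f x - g x|))).
  apply: Rintegral_le; first exact: rintegrable_tdiff.
    by apply: rintegrableD => //; exact: rintegrableD.
  move=> x; rewrite (distrC (f x) (g x)).
  rewrite [X in `|X| <= _](_ : _ = (f (x + v) - g (x + v)) + (g (x + v) - g x) +
    (g x - f x)); last by ring.
  by rewrite (le_trans (ler_normD _ _))// lerD2r ler_normD.
apply: le_trans (_ : eps / 3 + eps / 3 + eps / 3 <= eps); last by lra.
have E1 := RintegralD measurableT (rintegrableD i1 i2) i3.
have E2 := RintegralD measurableT i1 i2.
apply: le_trans (_ : (\int[leb n]_x `|f (x + v) - g (x + v)| +
  \int[leb n]_x `|g (x + v) - g x|) + \int[leb n]_x `|f x - g x| <= _).
  by rewrite -E2 -E1.
rewrite !lerD//; last exact: ht.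
by have := Rintegral_norm_shift v fgi => /= ->.
Qed.

Lemma tcontB f g : tcont f -> tcont g -> tcont (fun x => f x - g x).
Proof.
move=> [fi fc] [gi gc]; split; first exact: rintegrableB.
move=> eps eps0; have e2 : 0 < eps / 2 by rewrite divr_gt0.
have [t1 t10 h1] := fc _ e2; have [t2 t20 h2] := gc _ e2.
exists (Num.min t1 t2); first by rewrite lt_min t10.
move=> v; rewrite lt_min => /andP[v1 v2].
apply: (@le_trans _ _ (\int[leb n]_x (`|f (x + v) - f x| + `|g (x + v) - g x|))).
  apply: Rintegral_le.
  - by apply: (@rintegrable_tdiff (fun x => f x - g x)); exact: rintegrableB.
  - by apply: rintegrableD; exact: rintegrable_tdiff.
  move=> x; rewrite [X in `|X|](_ : _ = (f (x + v) - f x) - (g (x + v) - g x));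
    last by ring.
  exact: ler_normB.
have E := RintegralD measurableT (rintegrable_tdiff v fi) (rintegrable_tdiff v gi).
apply: le_trans (_ : \int[leb n]_x `|f (x + v) - f x| +
  \int[leb n]_x `|g (x + v) - g x| <= _); first by rewrite -E.
by have := h1 _ v1; have := h2 _ v2; lra.
Qed.

Lemma tcontZ f (c : R) : tcont f -> tcont (fun x => c * f x).
Proof.
move=> [fi fc]; split; first exact: rintegrableZ.
move=> eps eps0; have e2 : 0 < eps / (`|c| + 1) by rewrite divr_gt0// ltr_wpDl.
have [t t0 h] := fc _ e2; exists t => // v vt.
have E := RintegralZl `|c| measurableT (rintegrable_tdiff v fi).
apply: (@le_trans _ _ (`|c| * \int[leb n]_x `|f (x + v) - f x|)).
  rewrite -E; apply: Rintegral_le.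
  - by apply: (@rintegrable_tdiff (fun x => c * f x)); exact: rintegrableZ.
  - by apply: rintegrableZ; exact: rintegrable_tdiff.
  by move=> x; rewrite -mulrBr normrM.
apply: le_trans (ler_wpM2l (normr_ge0 c) (h _ vt)) _.
rewrite mulrA ler_pdivrMr ?ltr_wpDl// mulrC ler_pM2l//.
by rewrite lerDl.
Qed.

Lemma tcont_eq f g : (forall x, f x = g x) -> tcont f -> tcont g.
Proof. by move=> /funext ->. Qed.

Lemma tcont0 : tcont (fun=> 0).
Proof.
split.
  apply: rintegrable_ge0 => //.
  by rewrite (eq_integral (cst 0%E)) ?integral0.
move=> eps eps0; exists 1 => // v _.
rewrite (Rintegral_eq _ (g := fun=> 0)); last by move=> x; rewrite subrr normr0.
by rewrite Rintegral_cst// mul0r ltW.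
Qed.

Lemma tcont_sum (I : Type) (r : seq I) (F : I -> X -> R) :
  (forall i, tcont (F i)) -> tcont (fun x => \sum_(i <- r) F i x).
Proof.
move=> tF; elim: r => [|i r IH].
  by apply: tcont_eq tcont0 => x; rewrite big_nil.
apply: tcont_eq (tcontB (tF i) (tcontZ (-1) IH)) => x.
by rewrite big_cons mulN1r opprK.
Qed.

Lemma rintegrable_indic A : measurable A -> (leb n A < +oo)%E ->
  rintegrable (leb n) (\1_A : X -> R).
Proof.
move=> mA Aoo; apply: rintegrable_ge0 => //.
by rewrite integral_indic// setIT.
Qed.

(** Where the indicators of W at x and x + v differ, one of the two points lies in
    W within distance |v| of the complement; these collars of W decrease to the
    empty set. *)
Lemma tcont_open W : open W -> (leb n W < +oo)%E -> tcont (\1_W : X -> R).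
Proof.
move=> oW Woo; have mW : measurable W by exact: open_measurable_rV.
split; first exact: rintegrable_indic.
move=> eps eps0.
pose F k : set X := W `\` ~` (\bigcup_(y in ~` W) ball y (k.+1%:R^-1 : R)).
have oB k : open (\bigcup_(y in ~` W) ball y (k.+1%:R^-1 : R)).
  by apply: bigcup_open => y _; exact: ball_open.
have mF k : measurable (F k).
  by apply: measurableD => //; apply: measurableC; exact: open_measurable_rV.
have FE k : F k = W `&` \bigcup_(y in ~` W) ball y (k.+1%:R^-1 : R).
  by rewrite /F setDE setCK.
have capF : \bigcap_k F k = set0.
  apply/seteqP; split => // x h.
  have Wx : W x by have := h 0%N I; rewrite FE => -[].
  have /nbhs_ballP[e /= e0 eW] := open_nbhs_nbhs (conj oW Wx).
  pose k := Num.truncn (e^-1).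
  have ke : k.+1%:R^-1 < e.
    by rewrite -[ltRHS]invrK ltf_pV2 ?posrE ?invr_gt0// truncnS_gt.
  have := h k I; rewrite FE => -[_ [y nWy bxy]].
  apply: nWy; apply: eW; apply: le_ball (ltW ke) _ _.
  exact: ball_sym.
have niF : nonincreasing_seq F.
  move=> i j ij; apply/subsetPset; rewrite !FE => x [Wx [y Wy bxy]]; split => //.
  exists y => //; apply: le_ball bxy.
  by rewrite lef_pV2 ?posrE// ler_nat.
have cvF : leb n (F k) @[k --> \oo] --> 0%E.
  rewrite -(measure0 (leb n)) -capF; apply: nonincreasing_cvg_mu => //.
    by apply: le_lt_trans Woo; apply: le_measure; rewrite ?inE// FE; exact: subIsetl.
  by rewrite capF.
have [k hk] : exists k, (leb n (F k) < (eps / 2)%:E)%E.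
  have : \forall k \near \oo, (leb n (F k) < (eps / 2)%:E)%E.
    apply: (cvF [set y | (y < (eps / 2)%:E)%E]); apply: open_ereal_lt'.
    by rewrite lte_fin divr_gt0.
  by move=> [k _ hk]; exists k; exact: hk k (leqnn k).
exists (k.+1%:R^-1) => // v vk.
have Foo : (leb n (F k) < +oo)%E by rewrite (lt_trans hk)// ltry.
have iF := rintegrable_indic (mF k) Foo.
have iW := rintegrable_indic mW Woo.
have Feps : \int[leb n]_x (\1_(F k) x : R) <= eps / 2.
  rewrite -lee_fin EFin_Rintegral// integral_indic// setIT; exact: ltW.
apply: (@le_trans _ _ (\int[leb n]_x (\1_(F k) x + \1_(F k) (x + v)))).
  apply: Rintegral_le; first exact: rintegrable_tdiff.
    by apply: rintegrableD => //; exact: (rintegrable_shift v iF).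
  move=> x; have [Wx|Wx] := pselect (W x); have [Wxv|Wxv] := pselect (W (x + v)).
  - by rewrite !indicE !(mem_set Wx) !(mem_set Wxv) subrr normr0 addr_ge0.
  - rewrite [\1_W _]indicE (memNset Wxv) [\1_W x]indicE (mem_set Wx).
    rewrite sub0r normrN normr1 [\1_(F k) x]indicE mem_set ?lerDl//.
    rewrite FE; split => //; exists (x + v) => //.
    rewrite -ball_normE/= addrAC subrr add0r//.
  - rewrite [\1_W _]indicE (mem_set Wxv) [\1_W x]indicE (memNset Wx).
    rewrite subr0 normr1 [\1_(F k) (x + v)]indicE mem_set ?lerDr//.
    rewrite FE; split => //; exists x => //.
    by rewrite -ball_normE/= opprD addrA subrr add0r normrN.
  - by rewrite !indicE (memNset Wx) (memNset Wxv) subrr normr0 addr_ge0.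
have E := RintegralD measurableT iF (rintegrable_shift v iF).
have E2 := Rintegral_shift v (rintegrable_measurable iF).
apply: le_trans (_ : \int[leb n]_x \1_(F k) x + \int[leb n]_x \1_(F k) (x + v) <= _).
  by rewrite -E.
by rewrite E2; lra.
Qed.

Section boxed.
Variable r : R.
Hypothesis r0 : 0 < r.
Let Q := [set v : X | `|v| < r].

Let oQ : open Q.
Proof.
rewrite (_ : Q = ball 0 r); first exact: ball_open.
by apply/seteqP; split => x /=; rewrite /Q/= -ball_normE/= ?sub0r ?normrN.
Qed.

Let mQ : measurable Q. Proof. exact: open_measurable_rV. Qed.

Let Qoo A : measurable A -> (leb n (A `&` Q) < +oo)%E.
Proof.
move=> mA; apply: (@le_lt_trans _ _ (leb n Q)).
  by apply: le_measure; rewrite ?inE//; exact: measurableI.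
by rewrite [ltLHS](leb_ball n r0) ltry.
Qed.

(** Dynkin argument: the open sets are stable under intersection, and
    the property passes to differences and increasing unions.  Cutting by the cube
    keeps all measures finite. *)
Lemma tcont_measurable A : measurable A -> tcont (\1_(A `&` Q) : X -> R).
Proof.
pose H := [set A : set X | measurable A /\ tcont (\1_(A `&` Q) : X -> R)].
suff sH : <<s @open X >> `<=` H by move=> /sH[].
apply: (@lambda_system_subset X (@open X) _ setT H) => //.
- by move=> A1 B1; exact: openI.
- split => //.
  + split => //; rewrite setTI; apply: tcont_open => //.
    by have := Qoo measurableT; rewrite setTI.
  + move=> A1 B1 BA [mA tA] [mB tB]; split; first exact: measurableD.
    apply: tcont_eq (tcontB tA tB) => x; rewrite !indicE.
    have [Qx|Qx] := pselect (Q x); last first.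
      by rewrite !memNset ?subr0//; move=> [].
    have [Bx|Bx] := pselect (B1 x).
      rewrite (@mem_set _ (A1 `&` Q))//; last by split => //; exact: BA.
      rewrite (@mem_set _ (B1 `&` Q))// subrr memNset// => -[[]]//.
    rewrite (@memNset _ (B1 `&` Q)) ?subr0; last by move=> [].
    have [Ax|Ax] := pselect (A1 x).
      by rewrite !mem_set.
    by rewrite !memNset//; [move=> [[]]|move=> []].
  + move=> F ndF HF; have mF k : measurable (F k) by have [] := HF k.
    have mU : measurable (\bigcup_k F k) by exact: bigcupT_measurable.
    split => //; have iU := rintegrable_indic (measurableI _ _ mU mQ) (Qoo mU).
    apply: tcont_lim => // eps eps0.
    have c0 : \int[leb n]_x `|\1_((\bigcup_k F k) `&` Q) x - \1_(F k `&` Q) x : R|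
        @[k --> \oo] --> \int[leb n]_x (0 : R).
      apply: (@Rintegral_dominated _ _ _ (leb n) (fun k x =>
        `|\1_((\bigcup_k F k) `&` Q) x - \1_(F k `&` Q) x|) (fun=> 0)
        (\1_((\bigcup_k F k) `&` Q))) => //.
      * move=> k; apply: measurableT_comp => //; apply: measurable_funB;
          by apply: measurable_indic; exact: measurableI.
      * move=> k x; rewrite normr_id !indicE.
        have [h|h] := pselect ((F k `&` Q) x).
          by rewrite !mem_set ?subrr ?normr0//; case: h => Fx Qx; split => //; exists k.
        by rewrite (memNset h) subr0 ger0_norm.
      move=> x; have [[[k _ Fk] Qx]|h] := pselect ((\bigcup_k F k `&` Q) x).
        apply: cvg_near_cst; exists k => // j /= kj; rewrite !indicE !mem_set ?subrr ?normr0//.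
          by split => //; move: Fk; apply/subsetPset/ndF.
        by split => //; exists k.
      apply: cvg_near_cst; apply: nearW => k; rewrite !indicE !memNset ?subrr ?normr0//.
      by move=> [Fk Qx]; apply: h; split => //; exists k.
    rewrite Rintegral_cst// mul0r in c0.
    move/cvgrPdist_le : c0 => /(_ _ eps0)[k _ /(_ k (leqnn k))].
    rewrite sub0r normrN => hk; exists (\1_(F k `&` Q)); first by have [] := HF k.
    exact: le_trans (ler_norm _) hk.
- by move=> A1 oA; split; [exact: open_measurable_rV|];
    apply: tcont_open; [exact: openI|apply: Qoo; exact: open_measurable_rV].
Qed.

Lemma tcont_bounded f : rintegrable (leb n) f -> (forall x, r <= `|x| -> f x = 0) ->
  tcont f.
Proof.
move=> fi f0; apply: tcont_lim => // eps eps0.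
have [g [gi _ gc]] := approximation_sfun_integrable measurableT fi.
have [k hk] : exists k, (\int[leb n]_x `|(f x)%:E - (g k x)%:E| < eps%:E)%E.
  have : \forall k \near \oo, (\int[leb n]_x `|(f x)%:E - (g k x)%:E| < eps%:E)%E.
    apply: (gc [set y | (y < eps%:E)%E]); apply: open_ereal_lt'.
    by rewrite lte_fin.
  by move=> [k _ hk]; exists k; exact: hk k (leqnn k).
pose gQ x := g k x * \1_Q x.
exists gQ.
  have gE x : gQ x = \sum_(i <- finmap.enum_fset (fset_set (range (g k)))) i * \1_((g k @^-1` [set i]) `&` Q) x.
    rewrite /gQ fimfunE fsbig_finite//= mulr_suml; apply: eq_bigr => i _.
    by rewrite indicI/= mulrA.
  apply: tcont_eq (fun x => esym (gE x)) _; apply: tcont_sum => i.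
  by apply: tcontZ; apply: tcont_measurable.
have gQi : rintegrable (leb n) gQ.
  rewrite /gQ; under eq_fun do rewrite mulrC.
  apply: (rintegrableM_bounded (B := 1)) (gi k); first exact: measurable_indic.
  by move=> x; rewrite indicE; case: (_ \in _); rewrite ?normr1 ?normr0.
rewrite -lee_fin EFin_Rintegral; last first.
  by apply: rintegrable_norm; exact: rintegrableB.
apply: le_trans (ltW hk); apply: ge0_le_integral => //.
- apply/measurable_EFinP; apply: measurableT_comp => //.
  by have := rintegrable_measurable (rintegrableB fi gQi).
- apply: measurableT_comp => //; apply: emeasurable_funB.
    exact: measurable_int fi.
  exact: measurable_int (gi k).
move=> x _; rewrite -EFinB lee_fin /gQ indicE.
have [xQ|xQ] := pselect (Q x); first by rewrite mem_set// mulr1.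
rewrite memNset// mulr0 f0 ?subrr ?normr0//.
by rewrite leNgt; apply/negP.
Qed.

End boxed.

(** The error is an average, with weight the mollifier, of translations of f by
    vectors of its support. *)
Lemma conv_moll_cvg f : tcont f -> forall eps, 0 < eps ->
  exists2 tau, 0 < tau & forall e : R, 0 < e < tau ->
    \int[leb n]_x `|conv f (moll e) x - f x| <= eps.
Proof.
move=> [fi fc] eps eps0; have [tau tau0 ht] := fc _ eps0.
exists tau => // e /andP[e0 et].
have mf := rintegrable_measurable fi.
have mm := @measurable_moll R n e.
have mi := @rintegrable_moll R n e e0.
have m0 := @moll_ge0 R n e e0.
have [B hB] := @moll_bounded R n e e0.
pose F (z x : X) : R := moll e z * `|f (x - z) - f x|.
have mF : measurable_fun setT (fun p : X * X => F p.1 p.2).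
  apply: measurable_funM; first exact: measurableT_comp.
  apply: measurableT_comp => //; apply: measurable_funB.
    by apply: (measurableT_comp mf); exact: measurable_sub2.
  exact: measurableT_comp.
have iT z : rintegrable (leb n) (fun x => `|f (x - z) - f x|).
  exact: (rintegrable_tdiff (- z) fi).
have Tle z : \int[leb n]_x `|f (x - z) - f x| <= 2 * \int[leb n]_x `|f x|.
  have i1 := rintegrable_shift (- z) (rintegrable_norm fi).
  have i2 := rintegrable_norm fi.
  have E := RintegralD measurableT i1 i2.
  have E2 := Rintegral_norm_shift (- z) fi.
  apply: (@le_trans _ _ (\int[leb n]_x (`|f (x - z)| + `|f x|))).
    apply: Rintegral_le => //; first exact: rintegrableD.
    by move=> x; exact: ler_normB.
  by rewrite E E2 mulr_natl mulr2n.
have Fi : rintegrable (leb n \x leb n)%E (fun p : X * X => F p.1 p.2).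
  apply: (@rintegrable_prod_bound _ _ _ _ _ (leb n) (leb n) F (moll e)
    (2 * \int[leb n]_x `|f x|)) => //.
    by rewrite mulr_ge0// Rintegral_ge0.
  move=> z; rewrite (eq_integral (fun x => ((moll e z)%:E * `|f (x - z) - f x|%:E)%E)).
    rewrite ge0_integralZl_EFin//; last first.
      by apply/measurable_EFinP; exact: rintegrable_measurable (iT z).
    rewrite (EFinM (moll e z)); apply: lee_pmul; rewrite ?lee_fin//.
      by apply: integral_ge0 => x _; rewrite lee_fin.
    by rewrite -EFin_Rintegral// lee_fin.
  by move=> x _; rewrite -EFinM /F ger0_norm// mulr_ge0.
have Fi' := rintegrable_swap Fi.
have i1 x : rintegrable (leb n) (fun z => moll e z * f (x - z)).
  exact: (rintegrableM_bounded mm hB (rintegrable_subV x fi)).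
have i2 x : rintegrable (leb n) (fun z => moll e z * f x).
  by under eq_fun do rewrite mulrC; exact: rintegrableZ.
have iD x : rintegrable (leb n) (fun z => moll e z * (f (x - z) - f x)).
  by under eq_fun do rewrite mulrBr; exact: rintegrableB.
have cE x : conv f (moll e) x - f x = \int[leb n]_z (moll e z * (f (x - z) - f x)).
  have E : \int[leb n]_z (moll e z * f x) = f x.
    apply: (etrans (y := \int[leb n]_z (f x * moll e z))).
      by apply: Rintegral_eq => z; rewrite mulrC.
    have E0 := RintegralZl (f x) measurableT mi.
    by apply: etrans E0 _; rewrite Rintegral_moll ?mulr1.
  have E1 := RintegralB measurableT (i1 x) (i2 x).
  apply: (etrans (y := \int[leb n]_z (moll e z * f (x - z)) -
      \int[leb n]_z (moll e z * f x))).
    rewrite E; apply: (f_equal (fun t => t - f x)).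
    rewrite /conv; have mfm : measurable_fun setT (fun z => moll e z * f (x - z)).
      exact: rintegrable_measurable (i1 x).
    apply: etrans (Rintegral_subV x mfm); apply: Rintegral_eq => z.
    by rewrite subKr mulrC.
  rewrite -E1; apply: Rintegral_eq => z; by rewrite mulrBr.
have cF x : `|conv f (moll e) x - f x| <= \int[leb n]_z F z x.
  have FE z : `|moll e z * (f (x - z) - f x)| = F z x.
    by rewrite normrM ger0_norm.
  rewrite cE; apply: (Rintegral_norm_le (iD x)); last by move=> z; rewrite FE.
  have := rintegrable_norm (iD x); apply: eq_integrable => // z _ /=.
  by rewrite FE.
apply: (@le_trans _ _ (\int[leb n]_x \int[leb n]_z F z x)).
  apply: Rintegral_le.
  - apply: rintegrable_le (rintegrable_prod1 Fi').
      apply: measurableT_comp => //; apply: measurable_funB => //.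
      exact: (measurable_conv fi mm).
    by move=> x; rewrite normr_id; exact: cF.
  - exact: (rintegrable_prod1 Fi').
  exact: cF.
rewrite -(Rintegral_swap Fi).
apply: (@le_trans _ _ (\int[leb n]_z (eps * moll e z))).
  apply: Rintegral_le; [exact: (rintegrable_prod1 Fi)|exact: rintegrableZ|].
  move=> z; rewrite /F.
  have -> : \int[leb n]_x (moll e z * `|f (x - z) - f x|) =
    moll e z * \int[leb n]_x `|f (x - z) - f x|.
    exact: RintegralZl.
  have [ez|ez] := leP e `|z|; first by rewrite moll_out// mul0r mulr0.
  by rewrite mulrC ler_wpM2r// ht// normrN (lt_trans ez).
by rewrite RintegralZl// Rintegral_moll// mulr1.
Qed.

End translation_continuity.

(** * The logarithmic chain rule *)

Section logarithmic_growth.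
Context {R : realType}.
Local Notation lam := (@lebesgue_measure R).
Implicit Types (a b p q r eta : R).

(** Indicator of a half-open interval, so that consecutive intervals add up. *)
Definition co p q : R -> R := \1_(`[p, q[%classic).

Lemma measurable_inv : measurable_fun setT (fun x : R => x^-1).
Proof.
have oD : open [set x : R | x != 0].
  rewrite (_ : [set _ | _] = ~` [set 0]); first rewrite openC.
    exact/accessible_closed_set1/hausdorff_accessible/Rhausdorff.
  by apply/seteqP; split => x /= /eqP.
have mD : measurable [set x : R | x != 0] by exact: open_measurable.
rewrite (_ : (fun x => _) = (fun x : R => x^-1) \_ [set x | x != 0]); last first.
  apply/funext => x; rewrite patchE; case: ifPn => // /negP h.
  have [->|x0] := eqVneq x 0; first by rewrite invr0.
  by case: h; apply/mem_set.
apply/(measurable_restrictT _ mD); apply: open_continuous_measurable_fun => //.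
by move=> x; rewrite inE => x0; exact: inv_continuous.
Qed.

Lemma measurable_funV d (T : measurableType d) (f : T -> R) :
  measurable_fun setT f -> measurable_fun setT (fun x => (f x)^-1).
Proof. by move=> mf; apply: measurableT_comp mf; exact: measurable_inv. Qed.

Lemma coE p q r : co p q r = ((p <= r < q)%R)%:R.
Proof.
rewrite /co indicE; have [|] := boolP (p <= r < q) => h.
  by rewrite mem_set//= in_itv.
by rewrite memNset//= in_itv; exact/negP.
Qed.

Lemma co_ge0 p q r : 0 <= co p q r.
Proof. by rewrite coE. Qed.

Lemma co_le1 p q r : co p q r <= 1.
Proof. by rewrite coE; case: (_ && _). Qed.

Lemma co_split p q m r : p <= m <= q -> co p q r = co p m r + co m q r.
Proof.
move=> /andP[pm mq]; rewrite !coE.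
have [rm|mr] := ltP r m; last by rewrite (le_trans pm mr) add0r.
by rewrite (lt_le_trans rm mq) andbT addr0.
Qed.

Lemma measurable_co p q : measurable_fun setT (co p q).
Proof. exact: measurable_indic. Qed.

Lemma rintegrable_co p q (g : R -> R) : rintegrable lam g ->
  rintegrable lam (fun r => co p q r * g r).
Proof.
move=> gi; apply: (rintegrableM_bounded (B := 1)) gi; first exact: measurable_co.
by move=> r; rewrite ger0_norm ?co_ge0// co_le1.
Qed.

Lemma Rintegral_co_split p q m (g : R -> R) : rintegrable lam g -> p <= m <= q ->
  \int[lam]_r (co p q r * g r) =
  \int[lam]_r (co p m r * g r) + \int[lam]_r (co m q r * g r).
Proof.
move=> gi pmq.
have E := RintegralD measurableT (rintegrable_co p m gi) (rintegrable_co m q gi).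
apply: etrans E; apply: Rintegral_eq => r; by rewrite (co_split _ pmq) mulrDl.
Qed.

(** Concavity of the logarithm, at the later point: the inequality has the
    direction of the claim whatever the sign of z - y. *)
Lemma ln_sub_ge (y z : R) : 0 < y -> 0 < z -> (z - y) / z <= ln z - ln y.
Proof.
move=> y0 z0; rewrite -[leRHS]opprK opprB -ln_div ?posrE//.
rewrite lerNr; apply: le_trans (_ : y / z - 1 <= _); last first.
  by rewrite mulrBl divff ?gt_eqF// opprB.
rewrite -[X in ln X](subrK 1) addrC le_ln1Dx//.
by rewrite ltrBrDr addNr divr_gt0.
Qed.

Variables (g F : R -> R) (a b d0 : R).
Hypotheses (gi : rintegrable lam g) (ab : a <= b) (d00 : 0 < d0).
Hypothesis mF : measurable_fun setT F.
Hypothesis FE : forall p q, a <= p -> p <= q -> q <= b ->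
  F q - F p = \int[lam]_r (co p q r * g r).
Hypothesis F0 : forall r, a <= r <= b -> d0 <= F r.

Let G r := co a b r * (g r / F r).

Lemma rintegrable_growth : rintegrable lam (fun r => co a b r * (g r / F r)).
Proof.
apply: rintegrable_le (rintegrableZ d0^-1 (rintegrable_norm gi)).
- apply: measurable_funM; first exact: measurable_co.
  apply: measurable_funM; first exact: rintegrable_measurable gi.
  exact: measurable_funV mF.
- move=> r; rewrite normrM coE; have [/andP[ar rb]|_] := boolP (a <= r < b); last first.
    by rewrite normr0 mul0r mulr_ge0// invr_ge0 ltW.
  rewrite normr1 mul1r normrM mulrC ler_wpM2r//.
  have h : d0 <= F r by rewrite F0// ar ltW.
  rewrite ger0_norm ?invr_ge0 ?(le_trans (ltW d00))//.
  by rewrite lef_pV2// posrE// (lt_le_trans d00).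
Qed.

Let Gi : rintegrable lam G. Proof. exact: rintegrable_growth. Qed.

Let step eta : 0 < eta -> exists2 rho, 0 < rho & forall p q, a <= p -> p <= q -> q <= b ->
  q - p < rho ->
  \int[lam]_r (co p q r * G r) - eta * \int[lam]_r (co p q r * `|g r|) <= ln (F q) - ln (F p).
Proof.
move=> eta0; have e0 : 0 < eta * d0 ^+ 2 by rewrite mulr_gt0// exprn_gt0.
have [rho [rho0 hrho]] := integral_normr_continuous gi e0.
exists rho => // p q ap pq qb qp.
(* on a short step F varies by at most eta d0^2, by absolute continuity *)
have osc r : p <= r <= q -> `|F q - F r| <= eta * d0 ^+ 2.
  move=> /andP[pr rq]; rewrite FE//; last exact: le_trans pr.
  have ico := rintegrable_co r q gi.
  have icn := rintegrable_co r q (rintegrable_norm gi).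
  apply: le_trans (Rintegral_norm_le ico icn _) _.
    by move=> s; rewrite normrM (ger0_norm (co_ge0 _ _ _)).
  have mI : measurable (`[r, q[%classic : set R) by [].
  have muI : (lam `[r, q[%classic < rho%:E)%E.
    rewrite /= lebesgue_measure_itv/= lte_fin; case: ifPn => _; last by rewrite lte_fin.
    by rewrite -EFinB lte_fin; apply: le_lt_trans qp; rewrite lerB.
  apply: le_trans (ltW (hrho _ mI muI)).
  rewrite le_eqVlt; apply/orP; left; apply/eqP.
  rewrite [RHS]Rintegral_mkcond; apply: Rintegral_eq => s.
  by rewrite patchE /co indicE; case: (_ \in _); rewrite ?mul1r ?mul0r.
have Fp : d0 <= F p by rewrite F0// ap (le_trans pq).
have Fq : d0 <= F q by rewrite F0// (le_trans ap)//.
apply: le_trans (ln_sub_ge (lt_le_trans d00 Fp) (lt_le_trans d00 Fq)).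
rewrite FE// [leRHS]mulrC.
have ico := rintegrable_co p q gi.
have icn := rintegrable_co p q (rintegrable_norm gi).
have icG := rintegrable_co p q Gi.
have E1 := RintegralZl (F q)^-1 measurableT ico.
have E2 := RintegralZl eta measurableT icn.
have E3 := RintegralB measurableT icG (rintegrableZ eta icn).
apply: (@le_trans _ _ (\int[lam]_r ((F q)^-1 * (co p q r * g r)))); last by rewrite E1.
apply: (@le_trans _ _ (\int[lam]_r (co p q r * G r - eta * (co p q r * `|g r|)))).
  by rewrite E3 E2.
apply: Rintegral_le.
- exact: rintegrableB icG (rintegrableZ eta icn).
- exact: rintegrableZ.
move=> r; rewrite coE; have [/andP[pr rq]|_] := boolP (p <= r < q); last first.
  by rewrite !mul0r !mulr0 subr0.
rewrite !mul1r /G coE (le_trans ap pr) (lt_le_trans rq qb) mul1r.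
have Fr : d0 <= F r by rewrite F0// (le_trans ap pr) (le_trans (ltW rq) qb).
have Fr0 := lt_le_trans d00 Fr; have Fq0 := lt_le_trans d00 Fq.
have h := osc r; rewrite pr (ltW rq) in h; have {}h := h isT.
rewrite lerBlDl -lerBlDr.
apply: le_trans (ler_norm _) _.
(* g / F(r) - g / F(q), with a denominator at least d0^2 *)
rewrite (_ : _ - _ = (F q - F r) / (F r * F q) * g r); last first.
  by field; rewrite !gt_eqF.
rewrite normrM ler_wpM2r// normrM normfV (ger0_norm (mulr_ge0 (ltW Fr0) (ltW Fq0))).
rewrite ler_pdivrMr ?mulr_gt0//; apply: le_trans h _.
by rewrite ler_pM2l// expr2 ler_pM// ltW.
Qed.

(** Half of the identity (ln F)' = g / F for an absolutely continuous F >= d0.  The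
    interval is cut into steps so short that F oscillates little on each of them
    (absolute continuity of the integral of g); on a step ln F increases by at least
    (F(q) - F(p)) / F(q), and replacing F(q) by F(r) under the integral costs eta
    times the integral of |g|. *)
Lemma ln_growth :
  \int[lam]_r (co a b r * (g r / F r)) <= ln (F b) - ln (F a).
Proof.
pose J := \int[lam]_r (co a b r * `|g r|).
have J0 : 0 <= J by apply: Rintegral_ge0 => r _; rewrite mulr_ge0// co_ge0.
have main eta : 0 < eta -> \int[lam]_r (co a b r * G r) - eta * J <= ln (F b) - ln (F a).
  move=> eta0; have [rho rho0 hrho] := step eta0.
  have r2 : 0 < rho / 2 by rewrite divr_gt0.
  have ind k : forall p q, a <= p -> p <= q -> q <= b -> q - p <= k%:R * (rho / 2) ->
      \int[lam]_r (co p q r * G r) - eta * \int[lam]_r (co p q r * `|g r|)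
        <= ln (F q) - ln (F p).
    elim: k => [|k IH] p q ap pq qb qp.
      by apply: hrho => //; rewrite (le_lt_trans qp)// mul0r.
    have [h|h] := leP (q - rho / 2) p.
      by apply: hrho => //; move: h r2; lra.
    have pm : p <= q - rho / 2 <= q by rewrite (ltW h) gerBl ltW.
    have /andP[pm1 pm2] := pm.
    rewrite (Rintegral_co_split Gi pm) (Rintegral_co_split (rintegrable_norm gi) pm).
    have h1 := IH _ _ ap pm1 (le_trans pm2 qb).
    have h2 := hrho _ _ (le_trans ap pm1) pm2 qb.
    have h3 : q - rho / 2 - p <= k%:R * (rho / 2).
      by move: qp; rewrite -natr1 mulrDl; lra.
    have h4 : q - (q - rho / 2) < rho by lra.
    by have := h1 h3; have := h2 h4; lra.
  pose k := (Num.truncn ((b - a) / (rho / 2))).+1.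
  apply: (ind k) => //.
  by rewrite -ler_pdivrMr// ltW// truncnS_gt.
have E : \int[lam]_r (co a b r * G r) = \int[lam]_r (co a b r * (g r / F r)).
  by apply: Rintegral_eq => r; rewrite /G coE; case: (_ && _); rewrite ?mul0r ?mul1r.
rewrite -E; apply/ler_addgt0Pr => eps eps0.
have J1 : 0 < J + 1 by rewrite ltr_wpDl.
have := main (eps / (J + 1)) (divr_gt0 eps0 J1).
have : eps / (J + 1) * J <= eps.
  by rewrite mulrAC ler_pdivrMr// ler_pM2l// lerDl.
by set A := \int[lam]_r _; lra.
Qed.

End logarithmic_growth.

(** * The Picone inequality for mollified functions *)

(** The difference of the two sides is the square (a q - b p)^2 / (p q). *)
Lemma picone (R : realType) (a b p q : R) : 0 < p -> 0 < q ->
  (a ^+ 2 / p - b ^+ 2 / q) * (p - q) <= (a - b) ^+ 2.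
Proof.
move=> p0 q0; rewrite -subr_ge0.
rewrite (_ : _ - _ = (a * q - b * p) ^+ 2 / (p * q)); last by field; rewrite !gt_eqF.
by rewrite divr_ge0 ?sqr_ge0// mulr_ge0 ?ltW.
Qed.

Section symmetrization.
Context {R : realType} d (T : measurableType d).
Variables (m : {sigma_finite_measure set T -> \bar R}) (P v : T -> R) (J : T -> T -> R).
Hypothesis Jsym : forall x y, J x y = J y x.
Let S x y := P x * (v x - v y) * J x y.
Hypothesis Si : rintegrable (m \x m)%E (fun p : T * T => S p.1 p.2).

(** Exchange the variables in half of the integral. *)
Lemma Rintegral_symmetrize :
  rintegrable (m \x m)%E (fun p : T * T => (P p.1 - P p.2) * (v p.1 - v p.2) * J p.1 p.2) /\
  2 * \int[m]_x \int[m]_y S x y =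
  \int[(m \x m)%E]_p ((P p.1 - P p.2) * (v p.1 - v p.2) * J p.1 p.2).
Proof.
have Si' := rintegrable_swap Si.
have qE (p : T * T) : S p.1 p.2 + S p.2 p.1 = (P p.1 - P p.2) * (v p.1 - v p.2) * J p.1 p.2.
  by rewrite /S (Jsym p.2 p.1); ring.
have Di := rintegrableD Si Si'.
split.
  by apply: eq_integrable Di => // p _ /=; rewrite qE.
have E := RintegralD measurableT Si Si'.
have E1 := Rintegral_prod1 Si.
have E2 := @Rintegral_prod1 _ _ _ _ _ m m (fun x y => S y x) Si'.
have E3 := Rintegral_swap Si.
have E4 : \int[m]_x \int[m]_y S x y = \int[(m \x m)%E]_p S p.2 p.1.
  by rewrite -E2; exact: E3.
rewrite mulr_natl mulr2n {1}E1 E4.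
apply: etrans (esym E) _; apply: Rintegral_eq => p; exact: qE.
Qed.

End symmetrization.

Lemma Rintegral_conv (R : realType) (d : nat) (U f : 'rV[R]_d -> R) :
  rintegrable (leb d) U -> rintegrable (leb d) f ->
  rintegrable (leb d) (conv U f) /\
  \int[leb d]_x conv U f x = (\int[leb d]_y U y) * \int[leb d]_x f x.
Proof.
move=> ui fi; have mf := rintegrable_measurable fi.
have fn := rintegrable_norm fi.
pose F y (x : 'rV[R]_d) := U y * f (x - y).
have mF : measurable_fun setT (fun p : 'rV[R]_d * 'rV[R]_d => F p.1 p.2).
  apply: measurable_funM.
    by apply: measurableT_comp => //; exact: rintegrable_measurable ui.
  by apply: (measurableT_comp mf); exact: measurable_sub2.
have Ei y : \int[leb d]_x f (x - y) = \int[leb d]_x f x.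
  exact: (Rintegral_shift (- y) mf).
have En y : \int[leb d]_x `|f (x - y)| = \int[leb d]_x `|f x|.
  exact: (Rintegral_shift (- y) (rintegrable_measurable fn)).
have Fi : rintegrable (leb d \x leb d)%E (fun p : 'rV[R]_d * 'rV[R]_d => F p.1 p.2).
  apply: (@rintegrable_prod_bound _ _ _ _ _ (leb d) (leb d) F (fun y => `|U y|)
    (\int[leb d]_x `|f x|)) => //.
  - exact: rintegrable_norm.
  - by apply: Rintegral_ge0 => x _.
  move=> y; have iy : rintegrable (leb d) (fun x => `|U y| * `|f (x - y)|).
    by apply: rintegrableZ; exact: (rintegrable_shift (- y) fn).
  have E1 := RintegralZl `|U y| measurableT (rintegrable_shift (- y) fn).
  apply: (@le_trans _ _ (\int[leb d]_x (`|U y| * `|f (x - y)|))%:E); last first.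
    by rewrite E1 En.
  rewrite (EFin_Rintegral iy); apply: ge0_le_integral => //.
  - apply/measurable_EFinP; apply: measurableT_comp => //.
    exact: (measurableT_comp mF (measurable_pair1 y)).
  - by apply/measurable_EFinP; exact: rintegrable_measurable iy.
  - by move=> x _; rewrite /F normrM.
have Fi' := rintegrable_swap Fi.
split.
  exact: (@rintegrable_prod1 _ _ _ _ _ (leb d) (leb d) (fun x y => F y x) Fi').
apply: (etrans (y := \int[leb d]_y \int[leb d]_x F y x)).
  exact: esym (Rintegral_swap Fi).
have E := RintegralZr (\int[leb d]_x f x) measurableT ui.
apply: etrans E; apply: Rintegral_eq => y.
have E1 := RintegralZl (U y) measurableT (rintegrable_shift (- y) fi).
by rewrite -(Ei y); exact: E1.
Qed.

Lemma half_le (R : realFieldType) (I a1 a2 a3 : R) :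
  2 * (I - a1 + a2) <= a3 -> I <= 2^-1 * a3 + a1 - a2.
Proof. lra. Qed.

Section picone_inequality.
Context {R : realType} (d : nat) (alpha : R).
Hypothesis halpha : 0 < alpha < 2.
Local Notation s := (d%:R + alpha).
Local Notation K := (@kern R d s).
Local Notation X := ('rV[R]_d).
Implicit Types (x y z : X) (N : nat).
Variables (U f Phi : X -> R) (B C B' c0 dl : R) (D : set X).
Hypotheses (ui : rintegrable (leb d) U) (U0 : forall x, 0 <= U x).
Hypotheses (mf : measurable_fun setT f) (f0 : forall x, 0 <= f x).
Hypothesis fB : forall x, `|f x| <= B.
Hypothesis fC : forall y z, `|sdiff f y z| <= C * m2 z.
Hypotheses (mPhi : measurable_fun setT Phi) (PhiB : forall x, `|Phi x| <= B').
Hypothesis PhiE : (Eform alpha Phi Phi < +oo)%E.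
Hypotheses (mD : measurable D) (Doo : (leb d D < +oo)%E).
Hypothesis PhiD : forall x, ~ D x -> Phi x = 0.
Hypotheses (c00 : 0 <= c0) (dl0 : 0 < dl).
Hypothesis hc : forall x y, D x -> D y -> x != y -> c0 <= calA d alpha * K (x - y).

Let s0 : 0 < s. Proof. by case/andP: halpha => a0 _; rewrite ltr_wpDl. Qed.
Let sn : d%:R < s < d%:R + 2.
Proof. by case/andP: halpha => a0 a2; rewrite ltrDl a0 ltrD2l. Qed.
Let cA0 : 0 < calA d alpha. Proof. exact: calA_gt0. Qed.

Let w := conv U f.
Let v x := w x + dl.
Let P x := Phi x ^+ 2 / v x.
Let W := B * \int[leb d]_y `|U y|.
Let ID : X -> R := \1_D.

Lemma conv_ge0 x : 0 <= conv U f x.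
Proof. by apply: Rintegral_ge0 => y _; rewrite mulr_ge0. Qed.

Let mw : measurable_fun setT w. Proof. exact: measurable_conv ui mf. Qed.

Let wW x : `|w x| <= W. Proof. exact: conv_bounded. Qed.

Let W0 : 0 <= W. Proof. exact: le_trans (wW 0). Qed.

Let v0 x : 0 < v x. Proof. by rewrite ltr_wpDl// conv_ge0. Qed.

Let mv : measurable_fun setT v. Proof. exact: measurable_funD. Qed.

Let iD : rintegrable (leb d) ID. Proof. exact: rintegrable_indic. Qed.

Let ID_ge0 x : 0 <= ID x. Proof. by []. Qed.

Let ID_Phi x : ID x * Phi x = Phi x.
Proof.
rewrite /ID indicE; have [_|h] := boolP (x \in D); rewrite ?mul1r//.
by rewrite mul0r PhiD// => /mem_set; rewrite (negbTE h).
Qed.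

Let Phi2i : rintegrable (leb d) (fun x => Phi x ^+ 2).
Proof.
have h : rintegrable (leb d) (fun x => Phi x ^+ 2 * ID x).
  apply: (rintegrableM_bounded (B := B' ^+ 2) _ _ iD); first exact: measurable_funX.
  by move=> x; rewrite normrX lerXn2r ?nnegrE// (le_trans _ (PhiB x)).
apply: eq_integrable h => // x _ /=.
by rewrite expr2 -mulrA [_ * ID x]mulrC ID_Phi.
Qed.

Let mP : measurable_fun setT P.
Proof. by apply: measurable_funM; [exact: measurable_funX|exact: measurable_funV]. Qed.

Let P0 x : 0 <= P x. Proof. by rewrite divr_ge0 ?sqr_ge0// ltW. Qed.

Let P_le x : P x <= dl^-1 * Phi x ^+ 2.
Proof.
rewrite /P mulrC ler_wpM2r ?sqr_ge0// lef_pV2 ?posrE// lerDr; exact: conv_ge0.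
Qed.

Let Pi : rintegrable (leb d) P.
Proof.
apply: rintegrable_le (rintegrableZ dl^-1 Phi2i) => // x.
by rewrite ger0_norm.
Qed.

Section truncated.
Variable N : nat.
Hypothesis hN : c0 <= calA d alpha * N%:R.

Let J x y := calA d alpha * ktr s N (x - y) - c0 * (ID x * ID y).

Let J_ge0 x y : x != y -> D x -> D y -> 0 <= J x y.
Proof.
move=> xy Dx Dy; rewrite subr_ge0 /ID !indicE !mem_set// !mulr1 /ktr.
rewrite minr_pMr ?(ltW cA0)// le_min hN andbT; exact: hc.
Qed.

Let ik x : rintegrable (leb d) (fun y => ktr s N (x - y)).
Proof. exact: rintegrable_subV (rintegrable_ktr s0 sn N). Qed.

Let Ek x : \int[leb d]_y ktr s N (x - y) = \int[leb d]_y ktr s N y.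
Proof. exact: Rintegral_subV (@measurable_ktr _ _ _ N). Qed.

Let mS : measurable_fun setT (fun p : X * X => P p.1 * (v p.1 - v p.2) * J p.1 p.2).
Proof.
apply: measurable_funM.
  apply: measurable_funM; first exact: measurableT_comp.
  exact: measurable_diff2.
apply: measurable_funB; apply: measurable_funM => //.
  by apply: (measurableT_comp (@measurable_ktr _ _ _ N)); exact: measurable_sub2.
by apply: measurable_funM; apply: (@measurableT_comp _ _ _ _ _ _ ID) => //; exact: measurable_indic.
Qed.

Let Si : rintegrable (leb d \x leb d)%E
  (fun p : X * X => P p.1 * (v p.1 - v p.2) * J p.1 p.2).
Proof.
pose H x y := 2 * W * (calA d alpha * ktr s N (x - y) + c0 * ID y).
have Hi x : rintegrable (leb d) (H x).
  by apply: rintegrableZ; apply: rintegrableD; apply: rintegrableZ.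
pose BB := 2 * W * (calA d alpha * \int[leb d]_y ktr s N y + c0 * \int[leb d]_y ID y).
have HE x : \int[leb d]_y H x y = BB.
  have e1 := RintegralZl (2 * W) measurableT
    (rintegrableD (rintegrableZ (calA d alpha) (ik x)) (rintegrableZ c0 iD)).
  apply: etrans e1 _; apply: (f_equal (fun t => 2 * W * t)).
  have e2 := RintegralD measurableT (rintegrableZ (calA d alpha) (ik x)) (rintegrableZ c0 iD).
  apply: etrans e2 _.
  have e3 := RintegralZl (calA d alpha) measurableT (ik x).
  have e4 := RintegralZl c0 measurableT iD.
  by rewrite e3 e4 Ek.
apply: (@rintegrable_prod_bound _ _ _ _ _ (leb d) (leb d)
  (fun x y => P x * (v x - v y) * J x y) P BB) => //.
  apply: mulr_ge0; first exact: mulr_ge0.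
  apply: addr_ge0; apply: mulr_ge0 => //; first exact: ltW.
    by apply: Rintegral_ge0 => y _; exact: ktr_ge0.
  by apply: Rintegral_ge0 => y _.
move=> x; rewrite -(HE x); have e := RintegralZl (P x) measurableT (Hi x).
have Pi' := rintegrableZ (P x) (Hi x).
apply: (@le_trans _ _ ((\int[leb d]_y (P x * H x y))%:E)%E); last by rewrite e.
rewrite (EFin_Rintegral Pi'); apply: ge0_le_integral => //.
- apply/measurable_EFinP; apply: measurableT_comp => //.
  exact: (measurableT_comp mS (measurable_pair1 x)).
- by apply/measurable_EFinP; exact: rintegrable_measurable Pi'.
move=> y _; rewrite lee_fin -mulrA normrM (ger0_norm (P0 x)) ler_wpM2l// normrM.
rewrite /H ler_pM//.
  rewrite /v opprD addrACA subrr addr0 (le_trans (ler_normB _ _))//.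
  by rewrite mulr_natl mulr2n lerD.
rewrite (le_trans (ler_normB _ _))// lerD//.
  by rewrite ger0_norm// mulr_ge0 ?ktr_ge0// ltW.
rewrite ger0_norm ?mulr_ge0// ler_wpM2l// /ID [\1_D x]indicE.
by case: (_ \in _); rewrite ?mul1r ?mul0r.
Qed.

Let inner x : \int[leb d]_y (P x * (v x - v y) * J x y) =
  P x * (calA d alpha / 2 * conv U (nlop (ktr s N) f) x) -
  c0 * (\int[leb d]_y ID y) * Phi x ^+ 2 + c0 * (\int[leb d]_y (ID y * v y)) * P x.
Proof.
have i1 : rintegrable (leb d) (fun y => (w x - w y) * ktr s N (x - y)).
  apply: (rintegrableM_bounded (B := 2 * W) _ _ (ik x)).
    exact: measurable_funB.
  by move=> y; rewrite (le_trans (ler_normB _ _))// mulr_natl mulr2n lerD.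
have i2 : rintegrable (leb d) (fun y => ID y * v y).
  rewrite [X in rintegrable _ X](_ : _ = fun y => v y * ID y); last first.
    by apply/funext => y; rewrite mulrC.
  apply: (rintegrableM_bounded (B := W + dl) mv _ iD) => y.
  by rewrite (le_trans (ler_normD _ _))// lerD// gtr0_norm.
have E1 : conv U (nlop (ktr s N) f) x =
    2 * \int[leb d]_y ((w x - w y) * ktr s N (x - y)).
  rewrite (conv_nlop_ktr s0 sn ui mf fB); apply: (f_equal (fun t => 2 * t)).
  have mF : measurable_fun setT (fun y => (w x - w y) * ktr s N (x - y)).
    exact: rintegrable_measurable i1.
  apply: etrans (Rintegral_shift x mF); apply: Rintegral_eq => z.
  by rewrite opprD addrCA subrr addr0 ktrN [z + x]addrC.
rewrite E1 (_ : P x * _ = P x * calA d alpha * \int[leb d]_y ((w x - w y) * ktr s N (x - y)));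
  last by field.
have F1 := RintegralZl (P x * calA d alpha) measurableT i1.
have F2 := RintegralZl (c0 * Phi x ^+ 2) measurableT iD.
have F3 := RintegralZl (c0 * P x) measurableT i2.
have j1 := rintegrableZ (P x * calA d alpha) i1.
have j2 := rintegrableZ (c0 * Phi x ^+ 2) iD.
have j3 := rintegrableZ (c0 * P x) i2.
have F4 := RintegralB measurableT j1 j2.
have F5 := RintegralD measurableT (rintegrableB j1 j2) j3.
apply: (etrans (y := \int[leb d]_y (P x * calA d alpha * ((w x - w y) * ktr s N (x - y)) -
   c0 * Phi x ^+ 2 * ID y + c0 * P x * (ID y * v y)))).
  apply: Rintegral_eq => y; rewrite /J.
  have PI : P x * ID x = P x.
    by rewrite /P expr2 mulrC !mulrA ID_Phi.
  have Pv : P x * v x = Phi x ^+ 2 by rewrite /P divfK// gt_eqF.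
  rewrite mulrBr (_ : _ * (c0 * _) = c0 * (P x * ID x) * v x * ID y -
    c0 * (P x * ID x) * (ID y * v y)); last by ring.
  by rewrite PI -(mulrA c0 (P x) (v x)) Pv /v; ring.
apply: etrans F5 _; rewrite F3; apply: (f_equal2 (fun t t' => t + t')); last by ring.
by apply: etrans F4 _; rewrite F1 F2; ring.
Qed.

(** The quadratic form of the capped kernel minus the constant c0 on D x D is still
    that of a nonnegative symmetric kernel J, because c0 is at most the kernel on
    D x D.  Picone is applied with J, whose energy is at most that of Phi; the part
    of the form carried by the constant c0 is computed explicitly and gives the two
    terms in c0. *)
Lemma picone_truncated :
  \int[leb d]_x (P x * (calA d alpha / 2 * conv U (nlop (ktr s N) f) x)) <=
  calA d alpha / 2 * \int[(leb d \x leb d)%E]_p (energy_density alpha Phi Phi p) +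
  c0 * (\int[leb d]_y ID y) * \int[leb d]_x Phi x ^+ 2 -
  c0 * (\int[leb d]_y (ID y * v y)) * \int[leb d]_x P x.
Proof.
have Jsym x y : J x y = J y x.
  by rewrite /J -(opprB y x) ktrN [ID x * _]mulrC.
have [Qi QE] := Rintegral_symmetrize Jsym Si.
have Ei := Eform_lty halpha mPhi PhiE.
have EE := RintegralZl (calA d alpha) measurableT Ei.
have le1 : \int[(leb d \x leb d)%E]_p
    ((P p.1 - P p.2) * (v p.1 - v p.2) * J p.1 p.2) <=
    \int[(leb d \x leb d)%E]_p (calA d alpha * energy_density alpha Phi Phi p).
  apply: Rintegral_le => //; first exact: rintegrableZ.
  move=> [x y] /=; have [->|xy] := eqVneq x y.
    by rewrite !subrr mul0r mul0r mulr_ge0 ?energy_density_ge0// ltW.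
  have q_le := picone (Phi x) (Phi y) (v0 x) (v0 y).
  rewrite -/(P x) -/(P y) in q_le.
  rewrite /energy_density/= mulrCA -expr2.
  have p0 := sqr_ge0 (Phi x - Phi y).
  have JK : J x y <= calA d alpha * K (x - y).
    rewrite lerBlDr (le_trans (_ : _ <= calA d alpha * K (x - y)))//.
      by rewrite ler_pM2l// ktr_le.
    by rewrite lerDl mulr_ge0// mulr_ge0.
  have [Jge|Jlt] := leP 0 (J x y).
    apply: (@le_trans _ _ ((Phi x - Phi y) ^+ 2 * J x y)); first exact: ler_wpM2r.
    exact: ler_wpM2l.
  have nD : ~ (D x /\ D y) by move=> [Dx Dy]; move: Jlt; rewrite ltNge J_ge0.
  suff : 0 <= J x y by rewrite leNgt Jlt.
  rewrite /J (_ : ID x * ID y = 0) ?mulr0 ?subr0.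
    by rewrite mulr_ge0 ?ktr_ge0// ltW.
  rewrite /ID !indicE; have [/set_mem Dx|_] := boolP (x \in D); last by rewrite mul0r.
  have [/set_mem Dy|_] := boolP (y \in D); last by rewrite mulr0.
  by case: nD.
have Ti := @rintegrable_prod1 _ _ _ _ _ (leb d) (leb d)
  (fun x y => P x * (v x - v y) * J x y) Si.
set I1 := \int[leb d]_x (P x * _).
have M1 : measurable_fun setT (fun x => P x * (calA d alpha / 2 * conv U (nlop (ktr s N) f) x)).
  rewrite (_ : (fun x => _) = fun x => \int[leb d]_y (P x * (v x - v y) * J x y) +
     (c0 * (\int[leb d]_y ID y) * Phi x ^+ 2 - c0 * (\int[leb d]_y (ID y * v y)) * P x)).
    apply: measurable_funD; first exact: rintegrable_measurable Ti.
    by apply: measurable_funB; apply: measurable_funM => //; exact: measurable_funX.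
  by apply/funext => x; rewrite inner; ring.
have j2 := rintegrableZ (c0 * (\int[leb d]_y ID y)) Phi2i.
have j3 := rintegrableZ (c0 * (\int[leb d]_y (ID y * v y))) Pi.
have j1 : rintegrable (leb d) (fun x => P x * (calA d alpha / 2 * conv U (nlop (ktr s N) f) x)).
  have := rintegrableB (rintegrableD Ti j2) j3; apply: eq_integrable => // x _ /=.
  by rewrite inner; apply: (f_equal EFin); ring.
have F4 := RintegralB measurableT j1 j2.
have F5 := RintegralD measurableT (rintegrableB j1 j2) j3.
have F2 := RintegralZl (c0 * (\int[leb d]_y ID y)) measurableT Phi2i.
have F3 := RintegralZl (c0 * (\int[leb d]_y (ID y * v y))) measurableT Pi.
have tot : \int[leb d]_x \int[leb d]_y (P x * (v x - v y) * J x y) =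
    I1 - c0 * (\int[leb d]_y ID y) * \int[leb d]_x Phi x ^+ 2 +
    c0 * (\int[leb d]_y (ID y * v y)) * \int[leb d]_x P x.
  rewrite -F2 -F3 -F4; apply: etrans F5; apply: Rintegral_eq => x; exact: inner.
have le2 : 2 * (I1 - c0 * (\int[leb d]_y ID y) * \int[leb d]_x Phi x ^+ 2 +
    c0 * (\int[leb d]_y (ID y * v y)) * \int[leb d]_x P x) <=
    calA d alpha * \int[(leb d \x leb d)%E]_p energy_density alpha Phi Phi p.
  by rewrite -tot QE -EE.
move: le2; rewrite -[calA d alpha / 2 * _]mulrA mulrCA.
set a1 := c0 * _ * _; set a2 := c0 * _ * _; set a3 := calA d alpha * _.
exact: half_le.
Qed.

End truncated.

Let M := \int[leb d]_y U y.

Let M0 : 0 <= M. Proof. by apply: Rintegral_ge0 => y _. Qed.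

Let mL0 : measurable_fun setT (L0 alpha f). Proof. exact: measurable_L0. Qed.

Let LB := calA d alpha / 2 * (C * \int[leb d]_z (m2 z * K z)).

Let cA2 : 0 <= calA d alpha / 2. Proof. by apply: divr_ge0 => //; exact: ltW. Qed.

Let L0B x : `|L0 alpha f x| <= LB.
Proof.
rewrite /L0 normrM (ger0_norm cA2) ler_wpM2l//.
exact: (nlop_bounded s0 sn mf fC).
Qed.

Let conv_trunc_err N x : `|conv U (L0 alpha f) x -
  calA d alpha / 2 * conv U (nlop (ktr s N) f) x| <= calA d alpha / 2 * (C * @kerr R d s N) * M.
Proof.
have h y : `|L0 alpha f y - calA d alpha / 2 * nlop (ktr s N) f y| <=
    calA d alpha / 2 * (C * @kerr R d s N).
  rewrite /L0 -mulrBr normrM (ger0_norm cA2) ler_wpM2l//; exact: (nlop_err s0 sn mf fC).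
have mN : measurable_fun setT (nlop (ktr s N) f).
  by apply: measurable_nlop => //; exact: measurable_ktr.
have i1 : rintegrable (leb d) (fun y => U y * L0 alpha f (x - y)).
  exact: (rintegrable_conv ui mL0 L0B).
have i3 : rintegrable (leb d) (fun y => U y *
    (L0 alpha f (x - y) - calA d alpha / 2 * nlop (ktr s N) f (x - y))).
  apply: (@rintegrable_conv _ _ U (fun z => L0 alpha f z - calA d alpha / 2 * nlop (ktr s N) f z)
     _ ui _ h).
  by apply: measurable_funB => //; apply: measurable_funM.
have i2 : rintegrable (leb d) (fun y => calA d alpha / 2 * (U y * nlop (ktr s N) f (x - y))).
  have := rintegrableB i1 i3; apply: eq_integrable => // y _ /=.
  by apply: (f_equal EFin); ring.
have i4 : rintegrable (leb d) (fun y => U y * nlop (ktr s N) f (x - y)).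
  have := rintegrableZ (calA d alpha / 2)^-1 i2; apply: eq_integrable => // y _ /=.
  by rewrite mulKf// gt_eqF// divr_gt0.
have E1 := RintegralZl (calA d alpha / 2) measurableT i4.
have E2 := RintegralB measurableT i1 i2.
have E3 := RintegralZl (calA d alpha / 2 * (C * @kerr R d s N)) measurableT ui.
apply: (@le_trans _ _ (`|\int[leb d]_y (U y * L0 alpha f (x - y) -
    calA d alpha / 2 * (U y * nlop (ktr s N) f (x - y)))|)).
  by rewrite E2 E1.
rewrite /M -E3; apply: Rintegral_norm_le.
- exact: rintegrableB.
- exact: rintegrableZ.
move=> y; rewrite (_ : _ - _ = U y * (L0 alpha f (x - y) -
  calA d alpha / 2 * nlop (ktr s N) f (x - y))); last by ring.
by rewrite normrM (ger0_norm (U0 y)) [leRHS]mulrC ler_wpM2l.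
Qed.

(** Uniform convergence of the capped operator on f passes to the convolution with
    the integrable U. *)
Lemma picone_conv :
  \int[leb d]_x (Phi x ^+ 2 / (conv U f x + dl) * conv U (L0 alpha f) x) <=
  calA d alpha / 2 * \int[(leb d \x leb d)%E]_p (energy_density alpha Phi Phi p) +
  c0 * (\int[leb d]_y \1_D y) * \int[leb d]_x Phi x ^+ 2 -
  c0 * (\int[leb d]_y (\1_D y * (conv U f y + dl))) *
    \int[leb d]_x (Phi x ^+ 2 / (conv U f x + dl)).
Proof.
rewrite -/(P _); set rhs := (X in _ <= X).
pose c := calA d alpha / 2 * C * M * \int[leb d]_x P x.
have cv : c * @kerr R d s N @[N --> \oo] --> 0.
  by rewrite -(mulr0 c); apply: cvgM; [exact: cvg_cst|exact: kerr_cvg0 s0 sn].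
apply/ler_addgt0Pr => eps eps0.
move/cvgrPdist_le : cv => /(_ _ eps0)[N1 _ h1].
pose N0 := (Num.truncn (c0 / calA d alpha)).+1.
pose N := maxn N1 N0.
have hN : c0 <= calA d alpha * N%:R.
  rewrite mulrC -ler_pdivrMr//; apply: ltW; apply: lt_le_trans (truncnS_gt _) _.
  by rewrite ler_nat leq_maxr.
have := picone_truncated hN; rewrite -/rhs => h2.
have := h1 N (leq_maxl _ _); rewrite sub0r normrN => /(le_trans (ler_norm _)) h3.
have mN : measurable_fun setT (nlop (ktr s N) f).
  by apply: measurable_nlop => //; exact: measurable_ktr.
have mcN : measurable_fun setT (conv U (nlop (ktr s N) f)) by exact: measurable_conv ui mN.
have mcL : measurable_fun setT (conv U (L0 alpha f)) by exact: measurable_conv ui mL0.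
have cLB x : `|conv U (L0 alpha f) x| <= LB * \int[leb d]_y `|U y|.
  exact: conv_bounded ui mL0 L0B x.
have i1 : rintegrable (leb d) (fun x => P x * conv U (L0 alpha f) x).
  rewrite [X in rintegrable _ X](_ : _ = fun x => conv U (L0 alpha f) x * P x); last first.
    by apply/funext => x; rewrite mulrC.
  exact: rintegrableM_bounded mcL cLB Pi.
have i3 : rintegrable (leb d) (fun x => P x * (conv U (L0 alpha f) x -
    calA d alpha / 2 * conv U (nlop (ktr s N) f) x)).
  rewrite [X in rintegrable _ X](_ : _ = fun x => (conv U (L0 alpha f) x -
    calA d alpha / 2 * conv U (nlop (ktr s N) f) x) * P x); last first.
    by apply/funext => x; rewrite mulrC.
  apply: rintegrableM_bounded (conv_trunc_err N) Pi.
  by apply: measurable_funB => //; exact: measurable_funM.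
have i2 : rintegrable (leb d) (fun x => P x * (calA d alpha / 2 * conv U (nlop (ktr s N) f) x)).
  have := rintegrableB i1 i3; apply: eq_integrable => // y _ /=.
  by apply: (f_equal EFin); ring.
have iE := rintegrableZ (calA d alpha / 2 * (C * @kerr R d s N) * M) Pi.
have E1 := RintegralD measurableT i2 iE.
have E2 := RintegralZl (calA d alpha / 2 * (C * @kerr R d s N) * M) measurableT Pi.
apply: (@le_trans _ _ (\int[leb d]_x (P x * (calA d alpha / 2 * conv U (nlop (ktr s N) f) x) +
   calA d alpha / 2 * (C * @kerr R d s N) * M * P x))).
  apply: Rintegral_le => //; first exact: rintegrableD.
  move=> x; rewrite -[Phi x ^+ 2 / _]/(P x) [X in _ + X](mulrC _ (P x)) -mulrDr ler_wpM2l// -lerBlDl.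
  exact: le_trans (ler_norm _) (conv_trunc_err N x).
apply: le_trans (_ : \int[leb d]_x (P x * (calA d alpha / 2 * conv U (nlop (ktr s N) f) x)) +
   calA d alpha / 2 * (C * @kerr R d s N) * M * \int[leb d]_x P x <= _).
  by rewrite -E2 -E1.
rewrite lerD//; apply: le_trans h3; rewrite /c le_eqVlt; apply/orP; left; apply/eqP.
by ring.
Qed.

End picone_inequality.

(** * Almost everywhere comparison and time intervals *)

Lemma Rintegral_le_ae {R : realType} d (T : measurableType d)
    (mu : {measure set T -> \bar R}) (f g : T -> R) :
  rintegrable mu f -> rintegrable mu g -> {ae mu, forall x, f x <= g x} ->
  \int[mu]_x f x <= \int[mu]_x g x.
Proof.
move=> fi gi fg; have mfg := rintegrable_measurable (rintegrableB gi fi).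
have E := RintegralB measurableT gi fi.
have E' : \int[mu]_x (g x - f x) = \int[mu]_x `|g x - f x|.
  apply: Rintegral_ae_eq => //; first exact: measurableT_comp.
  by apply: filterS fg => x h; rewrite ger0_norm// subr_ge0.
rewrite -subr_ge0; apply: le_trans (_ : 0 <= \int[mu]_x `|g x - f x|) _.
  by apply: Rintegral_ge0.
by rewrite -E' E.
Qed.

Section time_indicators.
Context {R : realType}.
Local Notation lam := (@lebesgue_measure R).
Implicit Types p q r : R.

Lemma oo0E p r : \1_(`]0%R, p[%classic : set R) r = ((0 < r < p)%R)%:R :> R.
Proof.
rewrite indicE; have [|] := boolP (0 < r < p) => h.
  by rewrite mem_set//= in_itv.
by rewrite memNset//= in_itv; exact/negP.
Qed.

Lemma rintegrable_co1 p q : rintegrable lam (co p q).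
Proof.
apply: rintegrable_ge0; [exact: measurable_co|by move=> r; exact: co_ge0|].
rewrite integral_indic// setIT/= lebesgue_measure_itv/= lte_fin.
by case: ifPn => // _; rewrite -EFinB ltry.
Qed.

Lemma Rintegral_co1 p q : p <= q -> \int[lam]_r co p q r = q - p.
Proof.
move=> pq; apply: EFin_inj; rewrite EFin_Rintegral; last exact: rintegrable_co1.
rewrite integral_indic// setIT/= lebesgue_measure_itv/= lte_fin.
by case: ltgtP pq => // -> _; rewrite subrr.
Qed.

End time_indicators.

Lemma cst_le (R : realFieldType) (q P E c1 m P2 kP : R) :
  P <= E + c1 - m -> kP <= m -> q - (E + c1) <= q - P - kP.
Proof. lra. Qed.

(** * Neighbourhoods of compact sets *)

Section compact_margin.
Context {R : realType} (d : nat).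
Local Notation X := ('rV[R]_d).
Implicit Types (x y : X) (K A : set X).

Lemma compact_margin K A : compact K -> open A -> K `<=` A ->
  exists2 eta : R, 0 < eta & forall x y, K x -> `|x - y| <= eta -> A y.
Proof.
move=> /compact_near_coveringP cK oA KA.
have : \forall eta \near (0 : R)^'+, K `<=` [set x | forall y, `|x - y| <= eta -> A y].
  apply: cK => x Kx; have /nbhs_ballP[r /= r0 rA] := open_nbhs_nbhs (conj oA (KA _ Kx)).
  exists (ball x (r / 2), [set eta | 0 < eta < r / 2]).
    split => /=; first by apply: nbhsx_ballx; rewrite divr_gt0.
    exists (r / 2); first by rewrite /= divr_gt0.
    by move=> eta /=; rewrite sub0r normrN => h1 h2; rewrite h2 (le_lt_trans (ler_norm _) h1).
  move=> [z eta] /= [zx /andP[eta0 etar]] y zy; apply: rA.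
  move: zx; rewrite -!ball_normE/= => zx.
  rewrite (_ : x - y = (x - z) + (z - y)); last by rewrite addrA subrK.
  by rewrite (le_lt_trans (ler_normD _ _))// [ltRHS]splitr ltrD// (le_lt_trans zy).
move=> [r /= r0 hr]; exists (r / 2); first by rewrite divr_gt0.
move=> x y Kx; apply: hr => //=.
  by rewrite sub0r normrN gtr0_norm ?divr_gt0// ltr_pdivrMr// ltr_pMr// ltr1n.
by rewrite divr_gt0.
Qed.

Lemma compact_supp_bounded (f : X -> R) : continuous f -> compact (supp f) ->
  exists B : R, forall x, `|f x| <= B.
Proof.
move=> cf cs.
have : compact [set f x | x in supp f].
  by apply: continuous_compact => //; exact: continuous_subspaceT.
move=> /compact_bounded[M [_ bM]]; exists (Num.max M 0 + 1) => x.
have [->|fx] := eqVneq (f x) 0; first by rewrite normr0 addr_ge0// le_max lexx orbT.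
apply: bM; first by rewrite ltr_pwDr// le_max lexx.
by exists x => //; exact: subset_closure.
Qed.

Definition thick K (r : R) : set X := [set y | exists2 x, K x & `|x - y| < r].

Lemma open_thick K (r : R) : open (thick K r).
Proof.
rewrite (_ : thick K r = \bigcup_(x in K) ball x r).
  by apply: bigcup_open => x _; exact: ball_open.
by apply/seteqP; split => y; [move=> [x Kx xy]; exists x => //; rewrite -ball_normE|
  move=> [x Kx]; rewrite -ball_normE => xy; exists x].
Qed.

Lemma moll_ge_near (e : R) : 0 < e ->
  exists2 c : R, 0 < c & exists2 r : R, 0 < r & forall z : X, `|z| <= r -> c <= moll e z.
Proof.
move=> e0; have h0 : 0 < moll e (0 : X).
  by apply: moll_gt0 => //; rewrite normr0 expr0n/= mulr0 exprn_gt0.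
have cm := @moll_continuous R d e 0.
exists (moll e (0 : X) / 2); first by rewrite divr_gt0.
have h2 : 0 < moll e (0 : X) / 2 by rewrite divr_gt0.
move/cvgrPdist_le : cm => /(_ _ h2)/nbhs_ballP[r /= r0 hr].
exists (r / 2); first by rewrite divr_gt0.
move=> z zr; have : ball 0 r z.
  rewrite -ball_normE/= sub0r normrN (le_lt_trans zr)//.
  by rewrite ltr_pdivrMr// ltr_pMr// ltr1n.
move=> /hr/= /(le_trans (ler_norm _)).
by rewrite lerBlDr -lerBlDl; apply: le_trans; lra.
Qed.

(** Mollification bounds from below: integrability against every mollifier centred
    in K becomes, by compactness, integrability on a neighbourhood of K. *)
Lemma thick_integrable K (e : R) : compact K -> 0 < e ->
  exists2 r : R, 0 < r & forall f : X -> R, measurable_fun setT f -> (forall y, 0 <= f y) ->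
    (forall x, K x -> rintegrable (leb d) (fun y => f y * moll e (x - y))) ->
    rintegrable (leb d) (fun y => \1_(thick K r) y * f y).
Proof.
move=> cK e0; have [c c0 [r r0 hc]] := moll_ge_near e0.
have r2 : 0 < r / 2 by rewrite divr_gt0.
exists (r / 2) => // f mf f0 fi.
rewrite compact_cover in cK.
have [] := cK X K (fun x => ball x (r / 2)).
- by move=> x _; exact: ball_open.
- by move=> x Kx; exists x => //; exact: ballxx.
move=> D DK KD.
have mT : measurable (thick K (r / 2)) by apply: open_measurable_rV; exact: open_thick.
pose g y := \sum_(x <- finmap.enum_fset D) c^-1 * (f y * moll e (x - y)).
have m0 := @moll_ge0 R d e e0.
have gi : rintegrable (leb d) g.
  rewrite /g; have : {in finmap.enum_fset D, forall x, K x}.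
    by move=> x xD; have := DK x xD; rewrite inE.
  elim: (finmap.enum_fset D) => [|x s IH] hs.
    under eq_fun do rewrite big_nil.
    apply: rintegrable_ge0 => //; by rewrite integral0.
  under eq_fun do rewrite big_cons.
  apply: rintegrableD; last by apply: IH => y ys; apply: hs; rewrite inE ys orbT.
  by apply: rintegrableZ; apply: fi; apply: hs; rewrite inE eqxx.
apply: rintegrable_le gi.
  by apply: measurable_funM => //; exact: measurable_indic.
move=> y; have t0 x : 0 <= c^-1 * (f y * moll e (x - y)).
  by apply: mulr_ge0; [rewrite invr_ge0 ltW|exact: mulr_ge0].
have g0 : 0 <= g y by exact: sumr_ge0.
rewrite indicE; have [/set_mem[x Kx xy]|_] := boolP (y \in _); last by rewrite mul0r normr0.
rewrite mul1r ger0_norm//; have [z zD zx] := KD x Kx.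
have zy : `|z - y| <= r.
  rewrite (_ : z - y = (z - x) + (x - y)); last by rewrite addrA subrK.
  rewrite (le_trans (ler_normD _ _))// [leRHS]splitr lerD//; last exact: ltW.
  by move: zx; rewrite -ball_normE => /ltW.
rewrite /g (big_rem z)//=; apply: (@le_trans _ _ (c^-1 * (f y * moll e (z - y)))).
  rewrite mulrCA ler_peMr// ler_pdivlMl// mulr1; exact: hc.
by rewrite lerDl; exact: sumr_ge0.
Qed.

End compact_margin.

(** * Removal of the mollification *)

Section mollified_limits.
Context {R : realType} (d : nat).
Local Notation X := ('rV[R]_d).
Implicit Types (x y : X) (f g h : X -> R) (n : nat).

Definition radius n : R := n.+1%:R^-1.

Lemma radius_gt0 n : 0 < radius n. Proof. by rewrite invr_gt0. Qed.

Lemma near_radius (r : R) : 0 < r -> \forall n \near \oo, radius n < r.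
Proof.
move=> r0; exists (Num.truncn (r^-1)) => // n /= hn.
rewrite /radius -[ltRHS]invrK ltf_pV2 ?posrE ?invr_gt0//.
by apply: lt_le_trans (truncnS_gt _) _; rewrite ler_nat ltnS.
Qed.

Local Notation rho n := (@moll R d (radius n)).

Definition moll_error f n : R := \int[leb d]_x `|conv f (rho n) x - f x|.

Lemma moll_error_cvg f : tcont f -> moll_error f n @[n --> \oo] --> 0.
Proof.
move=> tf; apply/cvgrPdist_le => eps eps0.
have [tau tau0 ht] := conv_moll_cvg tf eps0.
near=> n; rewrite sub0r normrN ger0_norm; last first.
  by apply: Rintegral_ge0 => x _.
apply: ht; rewrite radius_gt0/=; near: n; exact: near_radius.
Unshelve. all: by end_near. Qed.

Lemma rintegrable_moll_error f n : tcont f ->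
  rintegrable (leb d) (fun x => `|conv f (rho n) x - f x|).
Proof.
move=> [fi _]; have [ci _] := Rintegral_conv fi (rintegrable_moll d (radius_gt0 n)).
by apply: rintegrable_norm; exact: rintegrableB.
Qed.

Lemma cvg_dist_le (a j : nat -> R) (l : R) :
  (\forall n \near \oo, `|a n - l| <= j n) -> j n @[n --> \oo] --> 0 ->
  a n @[n --> \oo] --> l.
Proof.
move=> h /cvgrPdist_le jc; apply/cvgrPdist_le => eps eps0.
near=> n; rewrite distrC; apply: (@le_trans _ _ (j n)); first by near: n.
rewrite (le_trans (ler_norm _))// -normrN -sub0r.
by near: n; exact: jc.
Unshelve. all: by end_near. Qed.

Lemma ln_lip (a b c : R) : 0 < c -> c <= a -> c <= b -> `|ln a - ln b| <= c^-1 * `|a - b|.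
Proof.
move=> c0 ca cb; have a0 := lt_le_trans c0 ca; have b0 := lt_le_trans c0 cb.
have h1 := ln_sub_ge a0 b0; have h2 := ln_sub_ge b0 a0.
have ia : a^-1 <= c^-1 by rewrite lef_pV2 ?posrE.
have ib : b^-1 <= c^-1 by rewrite lef_pV2 ?posrE.
have ai : 0 <= a^-1 by rewrite invr_ge0 ltW.
have bi : 0 <= b^-1 by rewrite invr_ge0 ltW.
have k1 : - (c^-1 * `|a - b|) <= (b - a) / b.
  rewrite lerNl -mulNr opprB mulrC; apply: le_trans (_ : b^-1 * `|a - b| <= _).
    by rewrite ler_wpM2l// ler_norm.
  by rewrite ler_wpM2r.
have k2 : - (c^-1 * `|a - b|) <= (a - b) / a.
  rewrite lerNl -mulNr opprB mulrC distrC; apply: le_trans (_ : a^-1 * `|b - a| <= _).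
    by rewrite ler_wpM2l// ler_norm.
  by rewrite ler_wpM2r.
by rewrite ler_norml; apply/andP; split; move: h1 h2 k1 k2; lra.
Qed.

Lemma quotient_lip (a b v w k c : R) : 0 < c -> c <= v -> c <= w -> 0 <= a <= k ->
  `|b / w - a / v| <= c^-1 * `|b - a| + k / c ^+ 2 * `|w - v|.
Proof.
move=> c0 cv cw /andP[a0 ak]; have v0 := lt_le_trans c0 cv; have w0 := lt_le_trans c0 cw.
rewrite (_ : _ - _ = w^-1 * (b - a) + (a / (w * v)) * (v - w)); last first.
  by field; rewrite !gt_eqF.
rewrite (le_trans (ler_normD _ _))// !normrM lerD//.
  by rewrite ler_wpM2r// gtr0_norm ?invr_gt0// lef_pV2 ?posrE.
have wv : 0 < w * v by exact: mulr_gt0.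
rewrite distrC ler_wpM2r// -normrM ger0_norm; last first.
  by rewrite divr_ge0// (ltW wv).
rewrite ler_pM ?invr_ge0 ?(ltW wv)//.
by rewrite lef_pV2 ?posrE ?exprn_gt0// expr2 ler_pM// (ltW c0).
Qed.

Variables (Phi : X -> R) (B : R).
Hypotheses (mPhi : measurable_fun setT Phi) (PhiB : forall x, `|Phi x| <= B).

Let PhiB2 x : `|Phi x ^+ 2| <= B ^+ 2.
Proof. by rewrite normrX lerXn2r ?nnegrE// (le_trans _ (PhiB x)). Qed.

Lemma Rintegral_dist_le f g h : rintegrable (leb d) f -> rintegrable (leb d) g ->
  rintegrable (leb d) h -> (forall x, `|f x - g x| <= h x) ->
  `|\int[leb d]_x f x - \int[leb d]_x g x| <= \int[leb d]_x h x.
Proof.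
move=> fi gi hi fgh; have E := RintegralB measurableT fi gi.
apply: le_trans (Rintegral_norm_le (rintegrableB fi gi) hi fgh).
by rewrite E.
Qed.

(** The logarithm is Lipschitz on [c, +oo[, so L1 convergence of the mollifications
    is enough.  Only the values of g near the carrier of Phi enter, which is why g
    may be replaced by its product with the indicator of Q. *)
Lemma weighted_ln_cvg g (Q : set X) (r c : R) :
  measurable Q -> 0 < r -> 0 < c -> (forall x, 0 <= g x) ->
  (forall x, Phi x != 0 -> forall y, `|x - y| < r -> Q y) ->
  tcont (fun y => \1_Q y * g y) ->
  (forall n, radius n < r ->
    rintegrable (leb d) (fun x => Phi x ^+ 2 * ln (conv g (rho n) x + c))) ->
  rintegrable (leb d) (fun x => Phi x ^+ 2 * ln (g x + c)) ->
  \int[leb d]_x (Phi x ^+ 2 * ln (conv g (rho n) x + c)) @[n --> \oo] -->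
  \int[leb d]_x (Phi x ^+ 2 * ln (g x + c)).
Proof.
move=> mQ r0 c0 g0 PQ tg in_ ig.
apply: (@cvg_dist_le _ (fun n => B ^+ 2 / c * moll_error (fun y => \1_Q y * g y) n)); last first.
  rewrite -[X in _ --> X](mulr0 (B ^+ 2 / c)); apply: cvgM; first exact: cvg_cst.
  exact: moll_error_cvg.
near=> n; have rn : radius n < r by near: n; exact: near_radius.
have ie := rintegrable_moll_error n tg.
have E := RintegralZl (B ^+ 2 / c) measurableT ie.
rewrite /moll_error -E; apply: Rintegral_dist_le => //; [exact: in_|exact: rintegrableZ|].
move=> x; have m0 := @moll_ge0 R d _ (radius_gt0 n).
have [->|Px] := eqVneq (Phi x) 0.
  rewrite expr0n !mul0r subrr normr0; apply: mulr_ge0 => //.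
  by rewrite divr_ge0 ?sqr_ge0// (ltW c0).
have Qx y : `|x - y| < r -> \1_Q y = 1 :> R.
  by move=> xy; rewrite indicE mem_set//; exact: PQ xy.
have -> : conv (fun y => \1_Q y * g y) (rho n) x = conv g (rho n) x.
  apply: Rintegral_eq => y; have [xy|xy] := ltP `|x - y| (radius n).
    by rewrite Qx ?mul1r// (lt_trans xy).
  by rewrite moll_out ?radius_gt0// !mulr0.
rewrite Qx ?subrr ?normr0// mul1r -mulrBr normrM -mulrA ler_pM//.
have cg : 0 <= conv g (rho n) x by exact: conv_ge0.
apply: le_trans (ln_lip c0 _ _) _; rewrite ?lerDr//.
by rewrite opprD addrACA subrr addr0.
Unshelve. all: by end_near. Qed.

(** The quotient is Lipschitz in both arguments since the denominators stay above c
    and the numerators in [0, k]; L1 convergence of both mollifications is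
    enough. *)
Lemma weighted_quotient_cvg a g (k c dl : R) :
  0 < c -> c <= dl -> (forall x, 0 <= a x <= k) -> (forall x, 0 <= g x) ->
  tcont a -> tcont g ->
  (forall n, rintegrable (leb d) (fun x =>
     Phi x ^+ 2 * (conv a (rho n) x / (conv g (rho n) x + dl)))) ->
  rintegrable (leb d) (fun x => Phi x ^+ 2 * (a x / (g x + dl))) ->
  \int[leb d]_x (Phi x ^+ 2 * (conv a (rho n) x / (conv g (rho n) x + dl))) @[n --> \oo] -->
  \int[leb d]_x (Phi x ^+ 2 * (a x / (g x + dl))).
Proof.
move=> c0 cd ak g0 ta tg in_ ig.
apply: (@cvg_dist_le _ (fun n => B ^+ 2 / c * moll_error a n +
   B ^+ 2 * (k / c ^+ 2) * moll_error g n)); last first.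
  rewrite -[X in _ --> X](addr0 0) -[X in _ --> X + _](mulr0 (B ^+ 2 / c)).
  rewrite -[X in _ --> _ + X](mulr0 (B ^+ 2 * (k / c ^+ 2))).
  by apply: cvgD; apply: cvgM; [exact: cvg_cst|exact: moll_error_cvg..|exact: cvg_cst
    |exact: moll_error_cvg].
near=> n.
have ia := rintegrable_moll_error n ta; have ie := rintegrable_moll_error n tg.
have E1 := RintegralZl (B ^+ 2 / c) measurableT ia.
have E2 := RintegralZl (B ^+ 2 * (k / c ^+ 2)) measurableT ie.
have iZ1 := rintegrableZ (B ^+ 2 / c) ia.
have iZ2 := rintegrableZ (B ^+ 2 * (k / c ^+ 2)) ie.
have E := RintegralD measurableT iZ1 iZ2.
rewrite /moll_error -E1 -E2.
apply: (@le_trans _ _ (\int[leb d]_x (B ^+ 2 / c * `|conv a (rho n) x - a x| +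
   B ^+ 2 * (k / c ^+ 2) * `|conv g (rho n) x - g x|))); last by rewrite E.
apply: Rintegral_dist_le => //; first exact: rintegrableD.
move=> x; have m0 := @moll_ge0 R d _ (radius_gt0 n).
have cg : 0 <= conv g (rho n) x by exact: conv_ge0.
have ca : 0 <= conv a (rho n) x.
  by apply: conv_ge0 => // y; case/andP: (ak y).
have c1 : c <= g x + dl by rewrite (le_trans cd)// lerDr.
have c2 : c <= conv g (rho n) x + dl by rewrite (le_trans cd)// lerDr.
have := quotient_lip (conv a (rho n) x) c0 c1 c2 (ak x).
have -> : conv g (rho n) x + dl - (g x + dl) = conv g (rho n) x - g x by ring.
move=> h; rewrite -mulrBr normrM.
rewrite (_ : B ^+ 2 / c * _ + _ = B ^+ 2 * (c^-1 * `|conv a (rho n) x - a x| +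
  k / c ^+ 2 * `|conv g (rho n) x - g x|)); last by ring.
exact: ler_pM.
Unshelve. all: by end_near. Qed.

End mollified_limits.

Lemma quot_bound (R : realFieldType) (a w dl c k : R) : 0 < c -> 0 <= a <= k -> 0 <= w ->
  c <= dl -> `|a / (w + dl)| <= k / c.
Proof.
move=> c0 /andP[a0 ak] w0 cd; have v0 : c <= w + dl by rewrite (le_trans cd)// lerDr.
have v1 := lt_le_trans c0 v0.
rewrite ger0_norm ?divr_ge0 ?(ltW v1)// ler_pM ?invr_ge0 ?(ltW v1)//.
by rewrite lef_pV2 ?posrE.
Qed.

Lemma chain_le (R : realFieldType) (a1 e1 b1 b2 a2 e2 b3 b4 : R) :
  a1 - e1 <= b1 - b2 -> a2 - e2 <= b3 - b1 -> 0 <= a1 -> 0 <= a2 -> b4 <= b2 ->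
  b4 - e1 - e2 <= b3.
Proof. lra. Qed.

(** If all mollifications vanish, the function is null in a neighbourhood of each
    point of Omega, hence null, countably many rational balls covering Omega. *)
Lemma exists_positive_mollification {R : realType} (d : nat) (Omega : set 'rV[R]_d)
    (g : 'rV[R]_d -> R) :
  open Omega -> measurable_fun setT g -> (forall x, 0 <= g x) ->
  (forall x, ~ Omega x -> g x = 0) ->
  (forall x e, 0 < e -> (forall y, `|x - y| <= e -> Omega y) ->
    rintegrable (leb d) (fun y => g y * moll e (x - y))) ->
  ~ {ae leb d, forall x, g x = 0} ->
  exists x e, [/\ 0 < e, forall y, `|x - y| <= e -> Omega y & 0 < conv g (moll e) x].
Proof.
move=> oO mg g0 gO gi; apply: contra_notP => noxe.
pose N := [set y : 'rV[R]_d | 0 < g y].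
have mN : measurable N.
  rewrite (_ : N = ~` [set y | g y <= 0]); first by apply: measurableC; exact: measurable_set_le.
  by apply/seteqP; split => y /=; rewrite /N/= ltNge => /negP.
have loc y : Omega y -> exists2 O : set 'rV[R]_d, open O /\ O y & (leb d).-negligible (N `&` O).
  move=> Oy; have /nbhs_ballP[r /= r0 rO] := open_nbhs_nbhs (conj oO Oy).
  have r2 : 0 < r / 2 by rewrite divr_gt0.
  have yO z : `|y - z| <= r / 2 -> Omega z.
    move=> h; apply: rO; rewrite -ball_normE/= (le_lt_trans h)//.
    by rewrite ltr_pdivrMr// ltr_pMr// ltr1n.
  have [c c0 [q q0 hq]] := @moll_ge_near R d _ r2.
  exists (ball y q); first by split; [exact: ball_open|exact: ballxx].
  have mB : measurable (ball y q) by apply: open_measurable_rV; exact: ball_open.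
  have mNB : measurable (N `&` ball y q) by exact: measurableI.
  exists (N `&` ball y q); split => //; apply/eqP; rewrite eq_le measure_ge0 andbT leNgt.
  apply/negP => pos; apply: noxe; exists y, (r / 2); split => //.
  have gi' := gi _ _ r2 yO.
  have m0 := @moll_ge0 R d _ r2.
  rewrite -lte_fin EFin_Rintegral//.
  have mf := measurable_int _ gi'.
  apply: (@lt_le_trans _ _ (\int[leb d]_(z in N `&` ball y q) (g z * moll (r / 2) (y - z))%:E)%E).
    apply: ge0_integral_gt0 => //; first exact: measurable_funS mf.
    move=> z [gz yz]; rewrite lte_fin mulr_gt0//; apply: lt_le_trans c0 _; apply: hq.
    by move: yz; rewrite -ball_normE/= => /ltW.
  by apply: ge0_subset_integral => // z _; rewrite lee_fin mulr_ge0.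
pose B (p : 'rV[rat]_d * rat) : set 'rV[R]_d := ball (map_mx ratr p.1 : 'rV[R]_d) (ratr p.2).
pose G (n : nat) : set 'rV[R]_d := if unpickle n is Some p then
  if pselect ((leb d).-negligible (N `&` B p)) then N `&` B p else set0 else set0.
have Gn n : (leb d).-negligible (G n).
  rewrite /G; case: (unpickle n) => [p|]; last exact: negligible_set0.
  by case: (pselect ((leb d).-negligible (N `&` B p))) => [h|_] //=; exact: negligible_set0.
have := negligible_bigcup Gn; apply: negligibleS => y /= gy.
have Oy : Omega y by apply: contrapT => /gO.
have [W [oO' yO] nO] := loc y Oy; rewrite (open_rV_bigcup oO') in yO.
have [p /= pO yp] := yO; exists (pickle p) => //; rewrite /G pickleK.
case: pselect => [h|[]].
  by split => //; rewrite /N/= lt_neqAle g0 andbT eq_sym; apply/eqP.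
by apply: negligibleS nO => z [Nz Bz]; split => //; exact: pO.
Qed.

(** * Logarithms of nonnegative functions as monotone limits *)

Section abstract_limits.
Context {R : realType} d (T : measurableType d).
Variable mu : {measure set T -> \bar R}.

Lemma Rintegral_dominated_ae (F : nat -> T -> R) (f g : T -> R) :
  (forall n, measurable_fun setT (F n)) -> measurable_fun setT f ->
  rintegrable mu g -> {ae mu, forall x, forall n, `|F n x| <= g x} ->
  {ae mu, forall x, F n x @[n --> \oo] --> f x} ->
  \int[mu]_x F n x @[n --> \oo] --> \int[mu]_x f x.
Proof.
move=> mF mf gi Fg Ff.
have /(_ _)[] := @dominated_convergence _ _ _ mu setT measurableT
  (fun n => EFin \o F n) (EFin \o f) (EFin \o g).
- by move=> n; exact/measurable_EFinP.
- exact/measurable_EFinP.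
- by apply: filterS Ff => x h _; apply: cvg_EFin; [exact: nearW|exact: h].
- exact: gi.
- by apply: filterS Fg => x h n _ /=; rewrite lee_fin.
move=> fi _ h; apply: fine_cvg; rewrite EFin_Rintegral//.
Qed.

(** The monotone limit itself is the majorant; it takes extended real values. *)
Lemma monotone_majorant (F : nat -> T -> R) (A : R) :
  (forall n, rintegrable mu (F n)) -> (forall n x, 0 <= F n x) ->
  (forall n m x, (n <= m)%N -> F n x <= F m x) ->
  (forall n, \int[mu]_x F n x <= A) ->
  exists2 H : T -> \bar R, mu.-integrable setT H & forall n x, ((F n x)%:E <= H x)%E.
Proof.
move=> Fi F0 ndF FA.
have nd x : nondecreasing_seq (fun n => (F n x)%:E).
  by move=> n m nm; rewrite lee_fin ndF.
have mF n : measurable_fun setT (fun x => (F n x)%:E) by exact: measurable_int (Fi n).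
have cv x : cvgn (fun n => (F n x)%:E) by exact: ereal_nondecreasing_is_cvgn.
exists (fun x => limn (fun n => (F n x)%:E)); last first.
  move=> n x; apply: lime_ge => //; exists n => // m /= nm; exact: nd.
have mH : measurable_fun setT (fun x => limn (fun n => (F n x)%:E)).
  apply: (emeasurable_fun_cvg (fun n x => (F n x)%:E)) => //.
apply/integrableP; split => //.
have mc : (\int[mu]_x (F n x)%:E)%E @[n --> \oo] --> (\int[mu]_x limn (fun n => (F n x)%:E))%E.
  apply: cvg_monotone_convergence => //.
  by move=> n x _; rewrite lee_fin.
rewrite (eq_integral (fun x => limn (fun n => (F n x)%:E))); last first.
  move=> x _; rewrite gee0_abs//; apply: lime_ge => //.
  by apply: nearW => n; rewrite lee_fin.
apply: le_lt_trans (ltry A); rewrite -(cvg_lim _ mc)//.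
apply: lime_le; first by apply/cvg_ex; eexists; exact: mc.
by apply: nearW => n; rewrite -EFin_Rintegral// lee_fin.
Qed.

End abstract_limits.

Lemma radius_cvg0 {R : realType} : radius n @[n --> \oo] --> (0 : R).
Proof.
apply/cvgrPdist_le => eps eps0; near=> n.
rewrite sub0r normrN ger0_norm ?(ltW (radius_gt0 _))// ltW//; near: n; exact: near_radius.
Unshelve. all: by end_near. Qed.

Lemma ln_radius_cvg {R : realType} (y : R) : 0 < y ->
  ln (y + radius n) @[n --> \oo] --> ln y.
Proof.
move=> y0; have cy : y + radius n @[n --> \oo] --> y.
  by rewrite -[X in _ --> X]addr0; apply: cvgD; [exact: cvg_cst|exact: radius_cvg0].
exact: (continuous_cvg _ (continuous_ln y0) cy).
Qed.

(** The functions w (g - ln (g + dl)) are nonnegative for dl <= 1, increase as dl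
    decreases, and have integrals bounded by the hypothesis on C.  Their limit is
    therefore integrable, hence finite almost everywhere, which excludes g = 0
    where w > 0. *)
Section logarithm_limit.
Context {R : realType} d (T : measurableType d).
Variables (mu : {measure set T -> \bar R}) (w g : T -> R) (C : R).
Hypotheses (mw : measurable_fun setT w) (w0 : forall x, 0 <= w x).
Hypotheses (mg : measurable_fun setT g) (g0 : forall x, 0 <= g x).
Hypothesis wgi : rintegrable mu (fun x => w x * g x).
Hypothesis lni : forall dl, 0 < dl -> rintegrable mu (fun x => w x * ln (g x + dl)).
Hypothesis lnC : forall dl, 0 < dl -> C <= \int[mu]_x (w x * ln (g x + dl)).

Let F n x := w x * g x - w x * ln (g x + radius n).

Lemma radius_le1 n : radius n <= 1 :> R.
Proof. by rewrite /radius invf_le1// ler1n. Qed.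

Lemma ln_radius_le n (y : R) : 0 <= y -> ln (y + radius n) <= y.
Proof.
move=> y0; apply: le_trans (_ : ln (1 + y) <= _).
  have r0 := @radius_gt0 R n; have r1 := radius_le1 n.
  by rewrite ler_ln ?posrE; [rewrite addrC lerD2r|rewrite ltr_wpDl|rewrite ltr_wpDr].
by rewrite le_ln1Dx// (lt_le_trans (ltrN10 _)).
Qed.

Let majorant : exists2 H : T -> \bar R, mu.-integrable setT H &
  forall n x, ((F n x)%:E <= H x)%E.
Proof.
have r0 n := @radius_gt0 R n.
have li n := lni (r0 n).
apply: (monotone_majorant (A := \int[mu]_x (w x * g x) - C)).
- by move=> n; exact: rintegrableB.
- by move=> n x; rewrite /F -mulrBr mulr_ge0// subr_ge0 ln_radius_le.
- move=> n m x nm; rewrite lerD2l lerN2 ler_wpM2l//.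
  rewrite ler_ln ?posrE ?ltr_wpDl// lerD2l /radius lef_pV2 ?posrE//.
  by rewrite ler_nat ltnS.
move=> n; have E := RintegralB measurableT wgi (li n).
apply: le_trans (_ : \int[mu]_x (w x * g x) - \int[mu]_x (w x * ln (g x + radius n)) <= _).
  by rewrite -E.
by rewrite lerD2l lerN2; exact: lnC.
Qed.

Lemma ae_positive : {ae mu, forall x, 0 < w x -> 0 < g x}.
Proof.
have [H Hi FH] := majorant.
have := integrable_ae measurableT Hi; apply: filterS => x /(_ I) Hx wx.
rewrite lt_neqAle g0 andbT eq_sym; apply/eqP => gx.
have Hf := fineK Hx.
pose M := fine (H x) / w x.
have [n hn] : exists n : nat, M < ln (n.+1%:R).
  exists (Num.truncn (expR M)); rewrite -[ltLHS]expRK ltr_ln ?posrE ?expR_gt0//.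
  exact: truncnS_gt.
have := FH n x; rewrite -Hf lee_fin /F gx mulr0 add0r add0r.
rewrite /radius lnV ?posrE// mulrN opprK leNgt; apply/negP/negPn.
by rewrite mulrC -ltr_pdivrMr.
Qed.

Lemma rintegrable_ln : rintegrable mu (fun x => w x * ln (g x)).
Proof.
have [H Hi FH] := majorant.
have mln : measurable_fun setT (fun x => w x * ln (g x)).
  by apply: measurable_funM => //; exact: (measurableT_comp (@measurable_ln R)).
have D0 x : 0 <= w x * g x - w x * ln (g x).
  rewrite -mulrBr mulr_ge0// subr_ge0.
  have [gx|gx] := ltP 0 (g x); first exact/ltW/ln_sublinear.
  by rewrite ln0 ?g0.
have Di : rintegrable mu (fun x => w x * g x - w x * ln (g x)).
  apply: le_integrable Hi => //.
    apply/measurable_EFinP; apply: measurable_funB => //; exact: measurable_funM.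
  move=> x _; have H0 : (0 <= H x)%E.
    apply: le_trans (FH 0%N x); rewrite lee_fin /F -mulrBr mulr_ge0// subr_ge0.
    exact: ln_radius_le.
  rewrite /= (gee0_abs H0) ger0_norm//.
  have [gx|gx] := ltP 0 (g x); last first.
    have gz : g x = 0 by apply/eqP; rewrite eq_le gx g0.
    by rewrite gz ln0// !mulr0 subrr.
  have cF : (F n x)%:E @[n --> \oo] --> (w x * g x - w x * ln (g x))%:E.
    apply: cvg_EFin; first exact: nearW.
    apply: cvgB; first exact: cvg_cst.
    apply: cvgM; first exact: cvg_cst.
    apply: ln_radius_cvg => //.
  rewrite -(cvg_lim _ cF)//; apply: lime_le.
    by apply/cvg_ex; eexists; exact: cF.
  exact: nearW.
have := rintegrableB wgi Di; apply: eq_integrable => // x _ /=.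
by rewrite subKr.
Qed.

End logarithm_limit.

(** * The logarithm of a quotient in extended arithmetic *)

Section quotient.
Context {R : realType}.

(** The extended logarithm of a / b with its conventions made explicit: division by
    0 gives an infinite quotient with the sign of the numerator, 0 / 0 being 0, and
    the logarithm of a nonpositive number is -oo. *)
Definition lneq_ratio (a b : R) : \bar R :=
  if b == 0 then (if 0 < a then +oo%E else -oo%E)
  else if a / b <= 0 then -oo%E else (ln (a / b))%:E.

Lemma lne_ratioE (a b : R) : lne (a%:E / b%:E) = lneq_ratio a b.
Proof.
rewrite /lneq_ratio inver; case: eqP => [_|_]; last by rewrite -EFinM.
case: (ltgtP 0 a) => [a0|a0|<-].
- by rewrite gt0_muley ?lte_fin.
- by rewrite lt0_muley ?lte_fin.
by rewrite mul0e le0_lneNy.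
Qed.

Lemma measurable_lneq_ratio d (T : measurableType d) (a b : T -> R) :
  measurable_fun setT a -> measurable_fun setT b ->
  measurable_fun setT (fun x => lneq_ratio (a x) (b x)).
Proof.
move=> ma mb; have mq : measurable_fun setT (fun x => a x / b x).
  by apply: measurable_funM => //; exact: measurable_funV.
apply: measurable_fun_ifT; first exact: measurable_fun_eqr.
  by apply: measurable_fun_ifT => //; exact: measurable_fun_ltr.
apply: measurable_fun_ifT => //; first exact: measurable_fun_ler.
by apply/measurable_EFinP; apply: (measurableT_comp (@measurable_ln R)).
Qed.

Lemma lneq_ratio_pos (a b : R) : 0 < a -> 0 < b -> lneq_ratio a b = (ln a - ln b)%:E.
Proof.
move=> a0 b0; rewrite /lneq_ratio gt_eqF// leNgt divr_gt0//=.
by rewrite ln_div ?posrE.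
Qed.

End quotient.
Lemma transfer_integrable {R : realType} d (T : measurableType d)
    (mu : {measure set T -> \bar R}) (D : set T) (f : T -> \bar R) (g : T -> R) :
  measurable D -> mu.-integrable D f -> measurable_fun setT g ->
  (forall x, ~ D x -> g x = 0) -> {ae mu, forall x, D x -> f x = (g x)%:E} ->
  rintegrable mu g /\ (\int[mu]_x g x)%:E = (\int[mu]_(x in D) f x)%E.
Proof.
move=> mD fi mg g0 fg.
have mgE : measurable_fun setT (EFin \o g) by exact/measurable_EFinP.
have /integrableP[mf foo] := (integrable_mkcond f mD).1 fi.
have E : {ae mu, forall x, setT x -> (f \_ D) x = (g x)%:E}.
  apply: filterS fg => x h _; rewrite patchE; case: ifPn => [/set_mem/h//|].
  by move=> /negP xD; rewrite g0// => /mem_set.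
have gi : rintegrable mu g.
  apply/integrableP; split => //.
  rewrite -(@ge0_ae_eq_integral _ _ _ _ _ (fun x => `|(f \_ D) x|%E))//.
  - exact: measurableT_comp.
  - exact: measurableT_comp.
  - by apply: filterS E => x h _ /=; rewrite h.
split => //; rewrite EFin_Rintegral// [RHS]integral_mkcond; apply: ae_eq_integral => //.
by apply: filterS E => x h _; rewrite h.
Qed.

(** * The mollified equation *)

Section weak_solution.
Context {R : realType} (d : nat) (alpha : R).
Variables (Omega : set 'rV[R]_d) (V u0 : 'rV[R]_d -> R) (T : \bar R)
  (u : R -> 'rV[R]_d -> R).
Hypothesis halpha : 0 < alpha < 2.
Hypothesis Omega_open : open Omega.
Hypothesis Omega_bounded : bounded_set Omega.
Hypothesis V_borel : measurable_fun Omega V.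
Hypothesis V_ge0 : forall x, Omega x -> 0 <= V x.
Hypothesis u0_L2 : sq_integrable (leb d) Omega u0.
Hypothesis u_sol : is_solution alpha Omega V T u0 u.
Hypothesis u_ge0 : forall t : R, 0 <= t -> (t%:E < T)%E ->
    {ae leb d, forall x, Omega x -> 0 <= u t x}.

Local Notation X := ('rV[R]_d).
Local Notation lam := (@lebesgue_measure R).
Local Notation spacetime := (measurableTypeR R * X)%type.
Implicit Types (x y z : X) (e t s c r k kap : R).

Let mO : measurable Omega. Proof. exact: open_measurable_rV. Qed.

Lemma measurable_ltT : measurable [set t : R | (t%:E < T)%E].
Proof.
rewrite (_ : [set _ | _] = EFin @^-1` `]-oo, T[%classic).
  rewrite -[X in measurable X]setTI; apply: EFin_measurable => //.
  exact: emeasurable_itv.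
by apply/seteqP; split => t /=; rewrite in_itv.
Qed.

Lemma measurable_time_co : measurable (time_co T : set (measurableTypeR R)).
Proof.
rewrite (_ : time_co T = `[0, +oo[%classic `&` [set t : R | (t%:E < T)%E]).
  by apply: measurableI => //; exact: measurable_ltT.
by apply/seteqP; split => t /=; rewrite /time_co/= in_itv/= andbT.
Qed.

Lemma measurable_time_oo : measurable (time_oo T : set (measurableTypeR R)).
Proof.
rewrite (_ : time_oo T = `]0, +oo[%classic `&` [set t : R | (t%:E < T)%E]).
  by apply: measurableI => //; exact: measurable_ltT.
by apply/seteqP; split => t /=; rewrite /time_oo/= in_itv/= andbT.
Qed.

(** The solution is only constrained on its time interval and in Omega, and is
    nonnegative almost everywhere.  It is replaced by a Borel function on the whole
    of space-time which is nonnegative everywhere and vanishes outside Omega. *)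
Definition upatch : spacetime -> R :=
  (fun z : spacetime => u z.1 z.2) \_ (time_co T `*` Omega).

Definition ut s y : R := Num.max 0 (upatch (s, y)).

Definition Vt : X -> R := V \_ Omega.

Let mQ : measurable (time_co T `*` Omega : set spacetime).
Proof. by apply: measurableX => //; exact: measurable_time_co. Qed.

Lemma measurable_u (D : set spacetime) : measurable D -> D `<=` time_co T `*` setT ->
  measurable_fun D (fun z : spacetime => u z.1 z.2).
Proof.
move=> mD DT; apply: (measurable_funS _ DT (sol_borel u_sol)).
by apply: measurableX => //; exact: measurable_time_co.
Qed.

Lemma measurable_upatch : measurable_fun setT upatch.
Proof.
apply/(measurable_restrictT _ mQ).
have sub : time_co T `*` Omega `<=` time_co T `*` setT by move=> z [].
exact: (measurable_u mQ sub).
Qed.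

Lemma measurable_ut : measurable_fun setT (fun z : spacetime => ut z.1 z.2).
Proof.
apply: measurable_maxr => //.
rewrite [X in measurable_fun _ X](_ : _ = upatch); first exact: measurable_upatch.
by apply/funext => -[].
Qed.

Lemma ut_ge0 s y : 0 <= ut s y.
Proof. by rewrite le_max lexx. Qed.

Lemma ut_out s y : ~ Omega y -> ut s y = 0.
Proof.
move=> nO; rewrite /ut /upatch patchE memNset ?maxxx//.
by move=> [_ /=].
Qed.

Lemma utE s y : time_co T s -> Omega y -> 0 <= u s y -> ut s y = u s y.
Proof.
by move=> ts Oy us; rewrite /ut /upatch patchE mem_set//; exact/max_idPr.
Qed.

Lemma measurable_Vt : measurable_fun setT Vt.
Proof.
by apply/(measurable_restrictT _ mO).
Qed.

Lemma Vt_ge0 x : 0 <= Vt x.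
Proof.
rewrite /Vt patchE; case: ifPn => // /set_mem; exact: V_ge0.
Qed.

Lemma ut_ae s : time_co T s -> {ae leb d, forall y, Omega y -> u s y = ut s y}.
Proof.
move=> ts; have [ts1 ts2] := ts.
by apply: filterS (u_ge0 ts1 ts2) => y h Oy; rewrite utE// h.
Qed.

Lemma ut_ae2 : {ae (lam \x leb d)%E, forall z : spacetime,
  time_co T z.1 -> Omega z.2 -> u z.1 z.2 = ut z.1 z.2}.
Proof.
pose N := [set z : spacetime | upatch z < 0].
have mN : measurable N by apply: measurable_set_lt; exact: measurable_upatch.
exists N; split => //.
  rewrite /product_measure1/=; apply: integral0_eq => s _ /=.
  have mNs : measurable (xsection N s) by exact: measurable_xsection.
  have [ts|ts] := pselect (time_co T s).
    have [ts1 ts2] := ts.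
    have [M [mM M0 hM]] := u_ge0 ts1 ts2.
    apply: (subset_measure0 mNs mM _ M0) => y; rewrite /xsection/= inE/= => h.
    apply: hM => /= h'; move: h; rewrite /N/= /upatch patchE.
    case: ifPn => [/set_mem[/= _ Oy]|_]; last by rewrite ltxx.
    by rewrite ltNge h'.
  rewrite (_ : xsection N s = set0) ?measure0//.
  apply/seteqP; split => // y; rewrite /xsection/= inE/= /N/= /upatch patchE.
  by rewrite memNset ?ltxx//= => -[].
move=> z /= h; rewrite /N/= ltNge; apply/negP => h'; apply: h => tz Oz.
by move: h'; rewrite /upatch patchE mem_set// => h'; rewrite utE.
Qed.

Section test.
Variables (x : X) (e t : R).
Hypothesis e0 : 0 < e.
Hypothesis xe : forall y, `|x - y| <= e -> Omega y.
Hypothesis tT : time_co T t.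

Let phi s : X -> R := atest (theta t s) e x.
Let Lm := L0 alpha (@moll R d e).
Let h s (y : X) : R := theta t s * Lm (x - y).

Let mmoll : measurable_fun setT (fun y : X => moll e (x - y)).
Proof.
by apply: (measurableT_comp (@measurable_moll R d e)); exact: measurable_subV.
Qed.

Let mLm : measurable_fun setT Lm.
Proof. by apply: measurable_L0; exact: measurable_moll. Qed.

Let Lm_bounded : exists2 B : R, 0 <= B & forall y, `|Lm y| <= B.
Proof.
have [B hB] := L0_bounded halpha (tame_atest 1 (0 : X) e0).
exists B; first exact: le_trans (hB 0).
move=> y; have := hB (- y); rewrite L0_atest// mul1r sub0r opprK.
by [].
Qed.

Let mphi : measurable_fun setT (fun z : spacetime => phi z.1 z.2).
Proof.
apply: measurable_funM.
  by apply: (measurableT_comp (@measurable_theta R t)).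
exact: (measurableT_comp mmoll).
Qed.

Lemma is_derive_phi y s : is_derive s 1 (phi ^~ y) (dtheta t s * moll e (x - y)).
Proof.
have -> : phi ^~ y = moll e (x - y) \*: theta t.
  by apply/funext => r; rewrite /phi /atest mulrC.
have h1 := is_derive_theta t s.
have h2 : is_derive s 1 (moll e (x - y) \*: theta t) (moll e (x - y) *: dtheta t s).
  exact: is_deriveZ.
by rewrite mulrC; exact: h2.
Qed.

Lemma dt_phi s y : dt phi s y = dtheta t s * moll e (x - y).
Proof. by rewrite /dt derive1E; have -> := @derive_val _ _ _ _ _ _ _ (is_derive_phi y s). Qed.

Let sq_test (g : R -> R) : measurable_fun setT g -> (exists M, forall s, `|g s| <= M) ->
  (forall s, t + 1 <= s -> g s = 0) ->
  sq_integrable (@dtdx R d) (time_oo T `*` Omega)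
    (fun z : spacetime => g z.1 * moll e (x - z.2)).
Proof.
move=> mg [M gM] g0; have [B hB] := @moll_bounded R d e e0.
have mgm : measurable_fun setT (fun z : spacetime => g z.1 * moll e (x - z.2)).
  apply: measurable_funM; first exact: (measurableT_comp mg).
  exact: (measurableT_comp mmoll).
have M0 : 0 <= M by exact: le_trans (gM 0).
have B0 : 0 <= B by exact: le_trans (hB 0).
split; first exact: measurable_funTS.
pose S : set spacetime := `[0, t + 1]%classic `*` [set y | `|x - y| < e].
have mb : measurable [set y : X | `|x - y| < e].
  apply: measurable_set_lt; apply: (measurableT_comp (@measurable_normV R d)).
  exact: measurable_subV.
have mS : measurable S by apply: measurableX.
have mD : measurable (time_oo T `*` Omega : set spacetime).
  by apply: measurableX => //; exact: measurable_time_oo.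
have mI : measurable_fun setT (fun z : spacetime => ((M * B) ^+ 2 * \1_S z)%:E).
  by apply/measurable_EFinP; apply: measurable_funM => //; exact: measurable_indic.
apply: (@le_lt_trans _ _ (\int[(lam \x leb d)%E]_z ((M * B) ^+ 2 * \1_S z)%:E)%E).
  apply: (@le_trans _ _ (\int[(lam \x leb d)%E]_(z in time_oo T `*` Omega)
     ((M * B) ^+ 2 * \1_S z)%:E)%E); last first.
    by apply: ge0_subset_integral => // z _; rewrite lee_fin mulr_ge0// sqr_ge0.
  apply: ge0_le_integral => //.
  - by move=> z _; rewrite lee_fin sqr_ge0.
  - by apply/measurable_EFinP; apply: measurable_funX; exact: measurable_funTS.
  - exact: measurable_funTS.
  move=> -[s y] [/= [s0 _] _]; rewrite lee_fin indicE.
  have [st|st] := leP (t + 1) s.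
    by rewrite g0// mul0r expr0n mulr_ge0// sqr_ge0.
  have [ye|ye] := leP e `|x - y|.
    by rewrite moll_out// mulr0 expr0n mulr_ge0// sqr_ge0.
  rewrite mem_set ?mulr1; last by split => //=; rewrite in_itv/= !ltW.
  rewrite -real_normK ?num_real// lerXn2r ?nnegrE ?mulr_ge0//.
  by rewrite normrM ler_pM.
under eq_integral do rewrite EFinM.
rewrite ge0_integralZl_EFin ?sqr_ge0//; last first.
  by apply/measurable_EFinP; exact: measurable_indic.
rewrite integral_indic// setIT lte_mul_pinfty ?lee_fin ?sqr_ge0//.
rewrite [ltLHS](product_measure1E _ _ _ mb)//.
rewrite [X in (_ * X)%E](leb_ball_center x e0).
rewrite /= lebesgue_measure_itv/= lte_fin; case: ifPn => _.
  by rewrite -EFinB -EFinM ltry.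
by rewrite mul0e ltry.
Qed.

Lemma admissible_phi : admissible Omega T phi.
Proof.
split.
- exact: measurable_funTS.
- move=> s y ts.
  have cC : closed [set z : R * X | `|x - z.2| <= e].
    rewrite (_ : [set _ | _] = (fun z : R * X => `|x - z.2|) @^-1` [set r | r <= e]).
      apply: preimage_closed; last exact: closed_le.
      move=> z _; apply: (@continuous_comp _ _ _ (@snd R X) (fun y : X => `|x - y|)).
        exact: cvg_snd.
      apply: continuous_comp; last exact: norm_continuous.
      by apply: continuousB; [exact: cst_continuous|exact: cvg_id].
    by [].
  move/closure_id : cC => cC cl.
  have : closure [set z : R * X | `|x - z.2| <= e] (s, y).
    apply: closureS cl => -[r w] /= [_]; apply: contraNT.
    by rewrite -ltNge => /ltW h'; rewrite /phi /atest moll_out// mulr0 eqxx.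
  by rewrite -cC /= => /xe.
- by move=> s y _; have [] := is_derive_phi y s.
- apply: sq_test; first exact: measurable_theta.
    by exists 1; exact: theta_bound.
  exact: theta_ge.
- under eq_fun do rewrite dt_phi.
  apply: sq_test; first exact: measurable_dtheta.
    by exists 4; exact: dtheta_bound.
  exact: dtheta_ge.
Qed.

Let mh : measurable_fun setT (fun z : spacetime => h z.1 z.2).
Proof.
apply: measurable_funM; first exact: (measurableT_comp (@measurable_theta R t)).
apply: (measurableT_comp mLm); apply: (measurableT_comp (measurable_subV x)).
exact: measurable_snd.
Qed.

Lemma is_L0_phi s : is_L0 alpha Omega (phi s) (h s).
Proof.
have -> : h s = L0 alpha (phi s).
  by apply/funext => y; rewrite /h /phi L0_atest.
apply: is_L0_tame => //; first exact: tame_atest.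
  exact: atest_continuous.
move=> y; apply: contraNP => nO; rewrite /phi /atest moll_out ?mulr0//.
by rewrite leNgt; apply/negP => /ltW/xe.
Qed.

Lemma compact_closed_ball : compact [set y : X | `|x - y| <= e].
Proof.
apply: bounded_closed_compact.
  exists (`|x| + e); split; first exact: num_real.
  move=> r hr y /= ye; rewrite (le_trans _ (ltW hr))//.
  have := lerB_normD x (y - x); rewrite subrKC distrC.
  by have := ler_normB x (x - y); rewrite opprB addrC subrK; lra.
rewrite (_ : [set _ | _] = (fun y : X => `|x - y|) @^-1` [set r | r <= e])//.
apply: preimage_closed; last exact: closed_le.
move=> y _; apply: continuous_comp; last exact: norm_continuous.
by apply: continuousB; [exact: cst_continuous|exact: cvg_id].
Qed.

Lemma measurable_closed_ball_center : measurable [set y : X | `|x - y| <= e].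
Proof.
apply: measurable_set_le; apply: (measurableT_comp (@measurable_normV R d)).
exact: measurable_subV.
Qed.

(** The proviso of the weak identity.  Inside the ball of radius e it follows from
    the local square integrability of u and the boundedness of L0 rho; outside,
    u L0 rho is nonpositive and has no positive part.  Nothing is known yet about
    the integrability of u away from the ball. *)
Lemma positive_part_lty :
  (\int[@dtdx R d]_(z in (`]0%R, t[ `*` Omega : set spacetime))
     (Num.max (u z.1 z.2 * h z.1 z.2) 0)%:E < +oo)%E.
Proof.
have [B B0 hB] := Lm_bounded.
pose Q : set spacetime := `]0%R, t[%classic `*` Omega.
pose S : set spacetime := `[0%R, t]%classic `*` [set y : X | `|x - y| <= e].
have mb := measurable_closed_ball_center.
have mQ' : measurable Q by exact: measurableX.
have mS : measurable S by exact: measurableX.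
have subT (r : R) : 0 <= r <= t -> time_co T r.
  move=> /andP[r0 rt]; split => //; have [_ tT2] := tT.
  by rewrite (le_lt_trans _ tT2)// lee_fin.
have QT : Q `<=` time_co T `*` setT.
  move=> -[r y] [/=]; rewrite in_itv/= => /andP[r0 rt] _; split => //=.
  by apply: subT; rewrite !ltW.
have ST : S `<=` time_co T `*` setT.
  by move=> -[r y] [/=]; rewrite in_itv/= => rt _; split => //=; exact: subT.
have muS := measurable_u mS ST; have muQ := measurable_u mQ' QT.
pose G (z : spacetime) := (B * (u z.1 z.2 ^+ 2 + 1))%:E.
have G0 (z : spacetime) : (0 <= G z)%E by rewrite lee_fin mulr_ge0// addr_ge0// sqr_ge0.
have mGS : measurable_fun S G.
  apply/measurable_EFinP; apply: measurable_funM => //; apply: measurable_funD => //.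
  exact: measurable_funX.
have mGQ : measurable_fun Q G.
  apply/measurable_EFinP; apply: measurable_funM => //; apply: measurable_funD => //.
  exact: measurable_funX.
have le1 : (\int[(lam \x leb d)%E]_(z in Q) (Num.max (u z.1 z.2 * h z.1 z.2) 0)%:E <=
    \int[(lam \x leb d)%E]_(z in Q) (G \_ S) z)%E.
  apply: ae_ge0_le_integral => //.
  - by move=> z _; rewrite lee_fin le_max lexx orbT.
  - apply/measurable_EFinP; apply: measurable_maxr => //.
    by apply: measurable_funM => //; exact: measurable_funTS.
  - by move=> z _; rewrite patchE; case: ifPn.
  - by apply/(measurable_restrict _ mS mQ'); apply: measurable_funS mGQ.
  have := ut_ae2; apply: filterS => -[r y] /= hu [/=]; rewrite in_itv/= => /andP[r0 rt] Oy.
  have rr : 0 <= r <= t by rewrite (ltW r0) (ltW rt).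
  have {}hu := hu (subT _ rr) Oy; rewrite hu.
  have [ye|ye] := leP e `|x - y|.
    rewrite (max_idPr _); last first.
      apply: mulr_ge0_le0; first exact: ut_ge0.
      by rewrite /h (theta_le (ltW rt)) mul1r; exact: (L0_moll_le0 halpha e0 ye).
    by rewrite patchE; case: ifPn.
  rewrite patchE mem_set; last by split => /=; [rewrite in_itv/= !ltW|exact: ltW].
  rewrite lee_fin/= -hu ge_max; apply/andP; split; last first.
    by rewrite mulr_ge0// addr_ge0// sqr_ge0.
  rewrite /h (theta_le (ltW rt)) mul1r.
  apply: le_trans (ler_norm _) _; rewrite normrM mulrC.
  apply: ler_pM => //; rewrite -(real_normK (num_real (u r y))).
  by set v := `|u r y|; have := sqr_ge0 (v - 2^-1); nra.
apply: le_lt_trans le1 _.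
rewrite -integral_mkcondr.
apply: (@le_lt_trans _ _ (\int[(lam \x leb d)%E]_(z in S) G z)%E).
  by apply: ge0_subset_integral => //; exact: measurableI.
rewrite /G; under eq_integral do rewrite EFinM.
have mu2 : measurable_fun S (fun z : spacetime => (u z.1 z.2 ^+ 2)%:E).
  by apply/measurable_EFinP; exact: measurable_funX.
rewrite ge0_integralZl_EFin//; last 2 first.
- by move=> z _; rewrite lee_fin addr_ge0// sqr_ge0.
- by apply/measurable_EFinP; apply: measurable_funD => //; exact: measurable_funX.
rewrite lte_mul_pinfty//.
under eq_integral do rewrite EFinD.
rewrite ge0_integralD//; last by move=> z _; rewrite lee_fin sqr_ge0.
rewrite lte_add_pinfty//.
  by have := sol_L2loc u_sol tT compact_closed_ball xe.
rewrite integral_cst// mul1e [ltLHS](product_measure1E _ _ _ mb)//.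
apply: lte_mul_pinfty => //.
- by rewrite /= lebesgue_measure_itv/= lte_fin; case: ifPn => _ //; rewrite -EFinB.
apply: (@le_lt_trans _ _ (leb d [set y : X | `|x - y| < 2 * e])).
  apply: le_measure; rewrite ?inE//.
    apply: measurable_set_lt; apply: (measurableT_comp (@measurable_normV R d)).
    exact: measurable_subV.
  by move=> y /= ye; rewrite (le_lt_trans ye)// ltr_pMl// ltr1n.
by rewrite leb_ball_center ?ltry// mulr_gt0.
Qed.

Let u0t : X -> R := u0 \_ Omega.

Lemma rintegrable_u0 : rintegrable (leb d) u0t.
Proof.
have [mu0 u02] := u0_L2.
have mu0t : measurable_fun setT u0t by exact/(measurable_restrictT _ mO).
have [M [_ bM]] := Omega_bounded.
pose r := Num.max M 0 + 1.
have r0 : 0 < r by rewrite ltr_wpDl// le_max lexx orbT.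
have Or y : Omega y -> `|y| < r + 1.
  move=> Oy; rewrite (@le_lt_trans _ _ r) ?ltrDl//; apply: bM => //.
  by rewrite /r ltr_pwDr// le_max lexx.
have r1 : 0 < r + 1 by rewrite addr_gt0.
have mb := @measurable_ballV R d (r + 1).
apply: (@rintegrable_le _ _ _ _ _
   (fun y => u0t y ^+ 2 + \1_[set v : X | `|v| < r + 1] y)) => //.
  move=> y; rewrite indicE; have [yO|yO] := pselect (Omega y).
    rewrite mem_set; last exact: Or.
    rewrite -(real_normK (num_real (u0t y))) (_ : true%:R = 1 :> R)//.
    by set v := `|u0t y|; have := sqr_ge0 (v - 2^-1); nra.
  by rewrite /u0t patchE memNset// normr0 expr0n add0r.
apply: rintegrableD.
  apply: rintegrable_ge0 => //; [exact: measurable_funX|by move=> y; exact: sqr_ge0|].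
  rewrite integral_mkcond in u02; apply: le_lt_trans u02.
  rewrite le_eqVlt; apply/orP; left; apply/eqP; apply: eq_integral => y _.
  by rewrite /u0t !patchE; case: ifPn => //; rewrite expr0n.
apply: rintegrable_ge0 => //.
by rewrite integral_indic// setIT [ltLHS](leb_ball d r1) ltry.
Qed.

Let F1 (z : spacetime) : R :=
  \1_(`]0%R, t[%classic : set R) z.1 * (ut z.1 z.2 * Lm (x - z.2)).
Let F2 (z : spacetime) : R :=
  \1_(`]0%R, t[%classic : set R) z.1 * (ut z.1 z.2 * Vt z.2 * moll e (x - z.2)).

Let mI : measurable_fun setT (fun z : spacetime => \1_(`]0%R, t[%classic : set R) z.1 : R).
Proof.
have mi : measurable_fun setT (\1_(`]0%R, t[%classic : set (measurableTypeR R)) : _ -> R).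
  exact: measurable_indic.
exact: (measurableT_comp mi).
Qed.

Let mF1 : measurable_fun setT F1.
Proof.
apply: measurable_funM => //; apply: measurable_funM; first exact: measurable_ut.
apply: (measurableT_comp mLm); apply: (measurableT_comp (measurable_subV x)).
exact: measurable_snd.
Qed.

Let mF2 : measurable_fun setT F2.
Proof.
apply: measurable_funM => //; apply: measurable_funM.
  apply: measurable_funM; first exact: measurable_ut.
  exact: (measurableT_comp measurable_Vt).
exact: (measurableT_comp mmoll).
Qed.

(** The weak identity for the test function theta rho(x - .), with u replaced by
    its nonnegative representative. *)
Lemma weak_identity_moll :
  [/\ rintegrable (leb d) (fun y => ut t y * moll e (x - y)),
      rintegrable (lam \x leb d)%E F1,
      rintegrable (lam \x leb d)%E F2 &
      \int[leb d]_y (ut t y * moll e (x - y)) -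
      \int[leb d]_y (u0t y * moll e (x - y)) +
      \int[(lam \x leb d)%E]_z F1 z = \int[(lam \x leb d)%E]_z F2 z].
Proof.
have [t0 tT2] := tT.
have mQ' : measurable (`]0%R, t[%classic `*` Omega : set spacetime) by exact: measurableX.
have subT (r : R) : 0 <= r <= t -> time_co T r.
  move=> /andP[r0 rt]; split => //; by rewrite (le_lt_trans _ tT2)// lee_fin.
have mh2 : measurable_fun (time_co T `*` Omega : set spacetime)
    (fun z : spacetime => h z.1 z.2) by apply: measurable_funTS.
have [] := sol_weak u_sol tT admissible_phi mh2
  (fun s _ => is_L0_phi s) positive_part_lty.
move=> I0 I1 I2 E.
have hQ (z : spacetime) : ~ (`]0%R, t[%classic `*` Omega) z ->
    \1_(`]0%R, t[%classic : set R) z.1 = 0 :> R \/ ut z.1 z.2 = 0.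
  move=> nQ; rewrite indicE; have [/set_mem zt|_] := boolP (_ \in _); last by left.
  by right; apply: ut_out => Oz; apply: nQ.
have Qae (P : spacetime -> Prop) : (forall r y, 0 < r -> r < t -> Omega y ->
     u r y = ut r y -> P (r, y)) ->
    {ae (lam \x leb d)%E, forall z : spacetime, (`]0%R, t[%classic `*` Omega) z -> P z}.
  move=> hP; have := ut_ae2; apply: filterS => -[r y] /= hu [/=].
  rewrite in_itv/= => /andP[r0 rt] Oy; apply: hP => //; apply: hu => //.
  by apply: subT; rewrite !ltW.
have hF1 (z : spacetime) : ~ (`]0%R, t[%classic `*` Omega) z -> F1 z = 0.
  by move=> /hQ[] h0; rewrite /F1 h0 ?mul0r ?mulr0.
have hF2 (z : spacetime) : ~ (`]0%R, t[%classic `*` Omega) z -> F2 z = 0.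
  by move=> /hQ[] h0; rewrite /F2 h0 ?mul0r ?mulr0.
have ae1 : {ae (lam \x leb d)%E, forall z : spacetime,
    (`]0%R, t[%classic `*` Omega) z ->
    (u z.1 z.2 * (- dt phi z.1 z.2 + h z.1 z.2))%:E = (F1 z)%:E}.
  apply: Qae => r y r0 rt Oy hu; apply: (f_equal EFin).
  have rI : r \in (`]0%R, t[%classic : set R) by rewrite mem_set//= in_itv/= r0 rt.
  rewrite [dt _ _ _]dt_phi (dtheta_le (ltW rt)) mul0r oppr0 add0r /h.
  by rewrite (theta_le (ltW rt)) mul1r /F1/= hu indicE rI mul1r.
have ae2 : {ae (lam \x leb d)%E, forall z : spacetime,
    (`]0%R, t[%classic `*` Omega) z ->
    (u z.1 z.2 * phi z.1 z.2 * V z.2)%:E = (F2 z)%:E}.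
  apply: Qae => r y r0 rt Oy hu; apply: (f_equal EFin).
  have rI : r \in (`]0%R, t[%classic : set R) by rewrite mem_set//= in_itv/= r0 rt.
  rewrite /phi /atest/= (theta_le (ltW rt)) mul1r /F2/= hu indicE rI mul1r.
  by rewrite /Vt patchE mem_set// mulrAC.
have [F1i F1E] := transfer_integrable mQ' I1 mF1 hF1 ae1.
have [F2i F2E] := transfer_integrable mQ' I2 mF2 hF2 ae2.
have mut : measurable_fun setT (ut t).
  exact: (measurableT_comp measurable_ut (measurable_pair1 t)).
pose g0 y := ut t y * moll e (x - y) - u0t y * moll e (x - y).
have u0m : rintegrable (leb d) (fun y => u0t y * moll e (x - y)).
  have [B hB] := @moll_bounded R d e e0.
  under eq_fun do rewrite mulrC.
  exact: (rintegrableM_bounded mmoll (fun y => hB (x - y)) rintegrable_u0).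
have mg0 : measurable_fun setT g0.
  apply: measurable_funB; last exact: rintegrable_measurable u0m.
  exact: measurable_funM.
have [g0i g0E] : rintegrable (leb d) g0 /\ (\int[leb d]_y g0 y)%:E =
    (\int[leb d]_(y in Omega) (u t y * phi t y - u0 y * phi 0 y)%:E)%E.
  apply: transfer_integrable => //.
    by move=> y nO; rewrite /g0 ut_out// /u0t patchE memNset// !mul0r subrr.
  apply: filterS (ut_ae tT) => y hu Oy.
  by rewrite /phi /atest !theta_le// !mul1r /g0 -hu// /u0t patchE mem_set.
have uti : rintegrable (leb d) (fun y => ut t y * moll e (x - y)).
  have := rintegrableD g0i u0m; apply: eq_integrable => // y _ /=.
  by rewrite /g0 subrK.
split => //.
rewrite -RintegralB//.
by apply: EFin_inj; rewrite EFinD F1E F2E -E g0E.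
Qed.

(** Cauchy-Schwarz in the form u <= u^2 + 1 on a bounded set. *)
Lemma rintegrable_ut_near : rintegrable (lam \x leb d)%E (fun z : spacetime =>
  \1_(`]0%R, t[%classic : set R) z.1 *
  (\1_[set y : X | `|x - y| <= e] z.2 * ut z.1 z.2)).
Proof.
pose S : set spacetime := `[0%R, t]%classic `*` [set y : X | `|x - y| <= e].
have mb := measurable_closed_ball_center.
have mS : measurable S by exact: measurableX.
have subT (r : R) : 0 <= r <= t -> time_co T r.
  move=> /andP[r0 rt]; split => //; have [_ tT2] := tT.
  by rewrite (le_lt_trans _ tT2)// lee_fin.
have ST : S `<=` time_co T `*` setT.
  by move=> -[r y] [/=]; rewrite in_itv/= => rt _; split => //=; exact: subT.
have muS := measurable_u mS ST.
have mu2 : measurable_fun S (fun z : spacetime => (u z.1 z.2 ^+ 2)%:E).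
  by apply/measurable_EFinP; exact: measurable_funX.
have S2 : (\int[(lam \x leb d)%E]_(z in S) (u z.1 z.2 ^+ 2 + 1)%:E < +oo)%E.
  under eq_integral do rewrite EFinD.
  rewrite ge0_integralD//; last by move=> z _; rewrite lee_fin sqr_ge0.
  rewrite lte_add_pinfty//.
    by have := sol_L2loc u_sol tT compact_closed_ball xe.
  rewrite integral_cst// mul1e [ltLHS](product_measure1E _ _ _ mb)//.
  apply: lte_mul_pinfty => //.
  - by rewrite /= lebesgue_measure_itv/= lte_fin; case: ifPn => _ //; rewrite -EFinB.
  apply: (@le_lt_trans _ _ (leb d [set y : X | `|x - y| < 2 * e])).
    apply: le_measure; rewrite ?inE//.
      apply: measurable_set_lt; apply: (measurableT_comp (@measurable_normV R d)).
      exact: measurable_subV.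
    by move=> y /= ye; rewrite (le_lt_trans ye)// ltr_pMl// ltr1n.
  by rewrite leb_ball_center ?ltry// mulr_gt0.
have mg : measurable_fun setT (fun z : spacetime =>
  \1_(`]0%R, t[%classic : set R) z.1 *
  (\1_[set y : X | `|x - y| <= e] z.2 * ut z.1 z.2)).
  apply: measurable_funM => //; apply: measurable_funM; last exact: measurable_ut.
  have mi : measurable_fun setT (\1_[set y : X | `|x - y| <= e] : _ -> R).
    exact: measurable_indic.
  exact: (measurableT_comp mi).
apply: rintegrable_ge0 => //.
  by move=> z; rewrite !mulr_ge0// ut_ge0.
apply: le_lt_trans S2.
rewrite [leRHS]integral_mkcond; apply: ae_ge0_le_integral => //.
- by move=> z _; rewrite lee_fin !mulr_ge0// ut_ge0.
- exact/measurable_EFinP.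
- by move=> z _; rewrite patchE; case: ifPn => // _; rewrite lee_fin addr_ge0// sqr_ge0.
- apply/(measurable_restrictT _ mS); apply/measurable_EFinP.
  by apply: measurable_funD => //; exact: measurable_funX.
have := ut_ae2; apply: filterS => -[r y] /= hu _.
rewrite !indicE; have [/set_mem/= rt|_] := boolP (r \in _); last first.
  rewrite mul0r patchE; case: ifPn => // _.
  by rewrite lee_fin addr_ge0// sqr_ge0.
have [/set_mem/= ye|_] := boolP (y \in _); last first.
  rewrite mul0r mulr0 patchE; case: ifPn => // _.
  by rewrite lee_fin addr_ge0// sqr_ge0.
move: rt; rewrite in_itv/= => /andP[r0 rt].
have rr : 0 <= r <= t by rewrite (ltW r0) (ltW rt).
rewrite patchE mem_set; last by split => //=; rewrite in_itv/=.
rewrite lee_fin/= !mul1r -(hu (subT _ rr) (xe ye)).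
have h1 := ler_norm (u r y); apply: le_trans h1 _.
rewrite -(real_normK (num_real (u r y))).
by set v := `|u r y|; have := sqr_ge0 (v - 2^-1); nra.
Qed.

(** Away from the ball of radius e, the integrable function u L0 rho(x - .) has
    absolute value at least c u, Omega being bounded.  Thus the nonlocality of the
    operator turns local information into global integrability. *)
Lemma rintegrable_ut : rintegrable (lam \x leb d)%E (fun z : spacetime =>
  \1_(`]0%R, t[%classic : set R) z.1 * ut z.1 z.2).
Proof.
have [_ F1i _ _] := weak_identity_moll; have F3i := rintegrable_ut_near.
have [M [_ bM]] := Omega_bounded.
pose M' := `|x| + (Num.max M 0 + 1).
have M'0 : 0 <= M' by rewrite !addr_ge0// le_max lexx orbT.
have hM y : Omega y -> `|x - y| <= M'.
  move=> Oy; apply: le_trans (ler_normB _ _) _; rewrite lerD2l; apply: bM => //.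
  by rewrite ltr_pwDr// le_max lexx.
have [c c0 hc] := @L0_moll_neg _ d alpha halpha e M' e0 M'0.
have := rintegrableD F3i (rintegrableZ c^-1 (rintegrable_norm F1i)).
apply: rintegrable_le.
  by apply: measurable_funM => //; exact: measurable_ut.
move=> -[r y] /=; rewrite ger0_norm ?mulr_ge0// ?ut_ge0//.
rewrite /F1/= normrM (ger0_norm (_ : 0 <= \1__ _))//.
set I := \1__ r; have I0 : 0 <= I by [].
have u0' := ut_ge0 r y.
have [Oy|nO] := pselect (Omega y); last first.
  by rewrite ut_out// !mulr0 mul0r normr0 mulr0 mulr0 addr0.
rewrite indicE; have [_|/negP ye] := boolP (y \in _).
  by rewrite mul1r lerDl !mulr_ge0// invr_ge0 ltW.
rewrite mul0r mulr0 add0r mulrCA ler_wpM2l// normrM (ger0_norm u0').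
have ye' : e <= `|x - y|.
  by rewrite leNgt; apply/negP => h'; apply: ye; apply/mem_set; exact: ltW.
have h1 := hc _ ye' (hM _ Oy).
rewrite ler_pdivlMl// mulrC ler_wpM2l//.
rewrite ler0_norm; last by apply: le_trans h1 _; rewrite oppr_le0 ltW.
by rewrite lerNr.
Qed.

(** The time derivative of the mollified solution. *)
Definition drift e' x' r : R := - conv (ut r) (L0 alpha (moll e')) x' +
  conv (fun y => ut r y * Vt y) (moll e') x'.

(** Fubini in the weak identity. *)
Lemma weak_ode : rintegrable lam (fun r : measurableTypeR R =>
     \1_(`]0%R, t[%classic : set R) r * drift e x r) /\
  conv (ut t) (moll e) x = conv u0t (moll e) x +
  \int[lam]_r (\1_(`]0%R, t[%classic : set R) r * drift e x r).
Proof.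
have [_ F1i F2i E] := weak_identity_moll.
pose f1 (r : measurableTypeR R) (y : X) : R := F1 (r, y).
pose f2 (r : measurableTypeR R) (y : X) : R := F2 (r, y).
have F1i' : rintegrable (lam \x leb d)%E (fun p : spacetime => f1 p.1 p.2).
  by apply: eq_integrable F1i => // -[].
have F2i' : rintegrable (lam \x leb d)%E (fun p : spacetime => f2 p.1 p.2).
  by apply: eq_integrable F2i => // -[].
have hI (r : R) (g : X -> R) : \int[leb d]_y (\1_(`]0%R, t[%classic : set R) r * g y)
    = \1_(`]0%R, t[%classic : set R) r * \int[leb d]_y g y.
  rewrite indicE; have [_|_] := boolP (r \in _).
    by rewrite mul1r; apply: Rintegral_eq => y; rewrite mul1r.
  rewrite mul0r; apply: (etrans (y := \int[leb d]_y (0 : R))).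
    by apply: Rintegral_eq => y; rewrite mul0r.
  by rewrite Rintegral_cst// mul0r.
have i1 := rintegrable_prod1 F1i'; have i2 := rintegrable_prod1 F2i'.
have e1 := Rintegral_prod1 F1i'; have e2 := Rintegral_prod1 F2i'.
have dE (r : measurableTypeR R) : \1_(`]0%R, t[%classic : set R) r * drift e x r =
    \int[leb d]_y f2 r y - \int[leb d]_y f1 r y.
  by rewrite /f1 /f2 /F1 /F2 hI hI /drift /conv mulrDr mulrN addrC.
split.
  have := rintegrableB i2 i1; apply: eq_integrable => // r _ /=.
  by rewrite dE.
have -> : \int[lam]_r (\1_(`]0%R, t[%classic : set R) r * drift e x r) =
    \int[lam]_r (\int[leb d]_y f2 r y) - \int[lam]_r (\int[leb d]_y f1 r y).
  rewrite -(RintegralB measurableT i2 i1).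
  by apply: Rintegral_eq => r; exact: dE.
rewrite e1 e2.
have E1 : \int[(lam \x leb d)%E]_p f1 p.1 p.2 = \int[(lam \x leb d)%E]_p F1 p.
  by apply: Rintegral_eq => -[].
have E2 : \int[(lam \x leb d)%E]_p f2 p.1 p.2 = \int[(lam \x leb d)%E]_p F2 p.
  by apply: Rintegral_eq => -[].
rewrite E1 E2 -E /conv; ring.
Qed.

End test.

Local Notation U := ut.
Local Notation W := Vt.
Local Notation s_ := (d%:R + alpha).

Let mU2 : measurable_fun setT (fun z : spacetime => U z.1 z.2).
Proof. exact: measurable_ut. Qed.

Let mU r : measurable_fun setT (U r).
Proof. exact: (measurableT_comp mU2 (measurable_pair1 r)). Qed.

Let U_ge0 r y : 0 <= U r y. Proof. exact: ut_ge0. Qed.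

Let mW : measurable_fun setT W. Proof. exact: measurable_Vt. Qed.

Let W_ge0 y : 0 <= W y. Proof. exact: Vt_ge0. Qed.

(** * Growth of the logarithm of the mollified solution *)

(** Almost every time is good ([ae_good]); at the others the solution is set to 0
    so that convolutions with bounded functions make sense at all times. *)
Definition good_time := [set r : R | (\int[leb d]_y (U r y)%:E < +oo)%E].

Let mgood : measurable (good_time : set (measurableTypeR R)).
Proof.
have mI : measurable_fun setT (fun r : measurableTypeR R => \int[leb d]_y (U r y)%:E)%E.
  apply: (measurable_fun_fubini_tonelli_F (fun z : spacetime => (U z.1 z.2)%:E)) => //.
    by apply/measurable_EFinP.
  by move=> z; rewrite lee_fin.
rewrite (_ : good_time = setT `&` (fun r : measurableTypeR R => \int[leb d]_y (U r y)%:E)%E @^-1`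
  `]-oo, +oo%E[%classic).
  by apply: mI => //; exact: emeasurable_itv.
by apply/seteqP; split => [r h|r [_ h]]; move: h; rewrite /good_time/= in_itv/=.
Qed.

Definition Ug r y : R := \1_good_time r * U r y.

Lemma Ug_ge0 r y : 0 <= Ug r y.
Proof. by rewrite mulr_ge0. Qed.

Lemma Ug_out r y : ~ Omega y -> Ug r y = 0.
Proof. by move=> nO; rewrite /Ug ut_out// mulr0. Qed.

Lemma UgE r y : good_time r -> Ug r y = U r y.
Proof. by move=> h; rewrite /Ug indicE mem_set// mul1r. Qed.

Lemma measurable_Ug : measurable_fun setT (fun z : spacetime => Ug z.1 z.2).
Proof.
apply: measurable_funM => //.
have mi : measurable_fun setT (\1_good_time : measurableTypeR R -> R).
  exact: measurable_indic.
exact: (measurableT_comp mi).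
Qed.

Lemma rintegrable_Ug r : rintegrable (leb d) (Ug r).
Proof.
have [gr|gr] := pselect (good_time r).
  apply: rintegrable_ge0.
  - exact: (measurableT_comp measurable_Ug (measurable_pair1 r)).
  - by move=> y; exact: Ug_ge0.
  - by under eq_integral do rewrite UgE//.
apply: rintegrable_ge0.
- exact: (measurableT_comp measurable_Ug (measurable_pair1 r)).
- by move=> y; exact: Ug_ge0.
under eq_integral do rewrite /Ug indicE memNset// mul0r.
by rewrite integral0.
Qed.

Definition mass r : R := \int[leb d]_y Ug r y.

Lemma mass_ge0 r : 0 <= mass r.
Proof. by apply: Rintegral_ge0 => y _; exact: Ug_ge0. Qed.

Lemma L0_moll_bounded e : 0 < e ->
  exists B : R, forall y, `|L0 alpha (@moll R d e) y| <= B.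
Proof.
move=> e0; have [B hB] := L0_bounded halpha (tame_atest 1 (0 : X) e0).
exists B => y; have := hB (- y); rewrite L0_atest// mul1r sub0r opprK.
by [].
Qed.

Lemma measurable_L0_moll e : measurable_fun setT (L0 alpha (@moll R d e)).
Proof. by apply: measurable_L0; exact: measurable_moll. Qed.

Section final_time.
Variables (x0 : X) (eta t : R).
Hypotheses (eta0 : 0 < eta) (x0O : forall y, `|x0 - y| <= eta -> Omega y).
Hypothesis tT : time_co T t.

Let Ui := rintegrable_ut eta0 x0O tT.

Lemma ae_good : {ae lam, forall r : measurableTypeR R, 0 < r < t -> good_time r}.
Proof.
have := @ae_rintegrable1 _ _ _ _ _ lam (leb d)
  (fun r y => \1_(`]0%R, t[%classic : set R) r * U r y) Ui.
apply: filterS => r h rt.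
have := h; rewrite indicE mem_set; last by rewrite /= in_itv.
move=> hi; apply: rintegrable_lty => // .
apply: eq_integrable hi => // y _ /=; by rewrite mul1r.
Qed.

Lemma rintegrable_mass : rintegrable lam (fun r : measurableTypeR R =>
  \1_(`]0%R, t[%classic : set R) r * mass r).
Proof.
have h : rintegrable (lam \x leb d)%E (fun z : spacetime =>
    \1_(`]0%R, t[%classic : set R) z.1 * Ug z.1 z.2).
  apply: rintegrable_le Ui.
    apply: measurable_funM; last exact: measurable_Ug.
    have mi : measurable_fun setT (\1_(`]0%R, t[%classic) : measurableTypeR R -> R).
      exact: measurable_indic.
    exact: (measurableT_comp mi).
  move=> [r y] /=; rewrite ger0_norm ?mulr_ge0 ?Ug_ge0// ler_wpM2l//.
  by rewrite /Ug indicE; case: (_ \in _); rewrite ?mul1r ?mul0r.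
have := @rintegrable_prod1 _ _ _ _ _ lam (leb d)
  (fun r y => \1_(`]0%R, t[%classic : set R) r * Ug r y) h.
apply: eq_integrable => // r _ /=; apply: (f_equal EFin).
by have E := RintegralZl (\1_(`]0%R, t[%classic : set R) r) measurableT (rintegrable_Ug r).
Qed.

Section growth.
Variables (e k kap dl0 s : R) (x : X).
Hypotheses (e0 : 0 < e) (xe : forall y, `|x - y| <= e -> Omega y).
Hypotheses (k0 : 0 <= k) (kap0 : 0 <= kap) (dl00 : 0 < dl0) (s0 : 0 < s) (st : s <= t).

(** The regularisation added to the mollified solution; it decreases to dl0 at
    speed kap. *)
Definition dlt r : R := dl0 + kap * (t - r).

(** Truncation of u V, which need not be integrable; truncating weakens the lower
    bound and is undone in [main_inequality]. *)
Definition trunc r y : R := Num.min (Ug r y * W y) k.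

(** A lower bound for the logarithmic derivative of the regularised mollified
    solution. *)
Definition rate r x' : R :=
  (- conv (Ug r) (L0 alpha (moll e)) x' + conv (trunc r) (moll e) x' - kap) /
  (conv (Ug r) (moll e) x' + dlt r).

Lemma dlt_ge r : r <= t -> dl0 <= dlt r.
Proof. by move=> rt; rewrite lerDl mulr_ge0// subr_ge0. Qed.

Lemma trunc_ge0 r y : 0 <= trunc r y.
Proof. by rewrite le_min k0 andbT mulr_ge0// Ug_ge0. Qed.

Lemma trunc_le r y : trunc r y <= k.
Proof. by rewrite ge_min lexx orbT. Qed.

Lemma measurable_trunc : measurable_fun setT (fun z : spacetime => trunc z.1 z.2).
Proof.
apply: measurable_minr => //; apply: measurable_funM; first exact: measurable_Ug.
exact: (measurableT_comp mW).
Qed.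

Lemma measurable_conv2 (g : R -> X -> R) (f : X -> R) :
  measurable_fun setT (fun z : spacetime => g z.1 z.2) -> measurable_fun setT f ->
  measurable_fun setT (fun z : spacetime => conv (g z.1) f z.2).
Proof.
move=> mg mf; apply: (@measurable_Rintegral2 _ _ _ _ _ (leb d)
  (fun (z : spacetime) y => g z.1 y * f (z.2 - y))).
apply: measurable_funM.
  have mz : measurable_fun setT (fun z : spacetime * X => (z.1.1, z.2)).
    apply/measurable_fun_pairP; split; last exact: measurable_snd.
    exact: (measurableT_comp (f := fst) (g := fst)).
  exact: (measurableT_comp mg mz).
apply: (measurableT_comp mf); apply: measurable_sub2 => //.
exact: (measurableT_comp measurable_snd).
Qed.

Let LB := L0_moll_bounded e0.
Let mL := measurable_L0_moll e.

Lemma conv_trunc_bound r y : 0 <= conv (trunc r) (moll e) y <= k.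
Proof.
have m0 := @moll_ge0 R d e e0.
apply/andP; split.
  by apply: Rintegral_ge0 => z _; rewrite mulr_ge0// trunc_ge0.
have mi := rintegrable_subV y (@rintegrable_moll R d e e0).
have E := RintegralZl k measurableT mi.
have E2 : \int[leb d]_z moll e (y - z) = 1.
  by rewrite (Rintegral_subV y (@measurable_moll R d e)) Rintegral_moll.
have ti : rintegrable (leb d) (fun z => trunc r z * moll e (y - z)).
  apply: (rintegrableM_bounded (B := k) _ _ mi).
    exact: (measurableT_comp measurable_trunc (measurable_pair1 r)).
  by move=> z; rewrite ger0_norm ?trunc_ge0// trunc_le.
rewrite -[leRHS]mulr1 -E2 -E; apply: Rintegral_le => //; first exact: rintegrableZ.
by move=> z; rewrite ler_wpM2r// trunc_le.
Qed.

Lemma measurable_rate : measurable_fun setT (fun z : spacetime => rate z.1 z.2).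
Proof.
have m1 := measurable_conv2 measurable_Ug mL.
have m2 := measurable_conv2 measurable_trunc (@measurable_moll R d e).
have m3 := measurable_conv2 measurable_Ug (@measurable_moll R d e).
apply: measurable_funM.
  by apply: measurable_funB => //; apply: measurable_funD => //; exact: measurableT_comp.
apply: measurable_funV; apply: measurable_funD => //.
apply: measurable_funD => //; apply: measurable_funM => //.
exact: measurable_funB.
Qed.

Lemma rate_bound : exists2 B : R, 0 <= B & forall r x', r <= t ->
  `|rate r x'| <= B * (mass r + 1).
Proof.
have [B hB] := LB; have B0 : 0 <= B := le_trans (normr_ge0 _) (hB 0).
exists ((B + k + kap) / dl0).
  by rewrite divr_ge0 ?addr_ge0// ltW.
move=> r x' rt; have M0 := mass_ge0 r.
have c1 := conv_bounded (rintegrable_Ug r) mL hB x'.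
have nE : \int[leb d]_y `|Ug r y| = mass r.
  by apply: Rintegral_eq => y; rewrite ger0_norm// Ug_ge0.
rewrite nE in c1.
have /andP[c2 c3] := conv_trunc_bound r x'.
have c4 : 0 <= conv (Ug r) (moll e) x'.
  by apply: conv_ge0 => [y|y]; [exact: Ug_ge0|exact: moll_ge0].
have c5 := dlt_ge rt.
rewrite /rate normrM normfV mulrAC ler_pM//.
  rewrite (le_trans (ler_normB _ _))// (le_trans (lerD (ler_normD _ _) (lexx _)))//.
  rewrite normrN (ger0_norm c2) (ger0_norm kap0).
  apply: le_trans (lerD (lerD c1 c3) (lexx kap)) _.
  by have h1 : 0 <= (k + kap) * mass r; [rewrite mulr_ge0 ?addr_ge0|nra].
have c6 : 0 <= dlt r by exact: (le_trans (ltW dl00) c5).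
have c7 : dl0 <= conv (Ug r) (moll e) x' + dlt r by apply: le_trans c5 _; rewrite lerDr.
have c8 : 0 < conv (Ug r) (moll e) x' + dlt r by exact: (lt_le_trans dl00).
rewrite (ger0_norm (ltW c8)) lef_pV2 ?posrE//.
Qed.

Lemma rintegrable_co_mass : rintegrable lam (fun r => co s t r * (mass r + 1)).
Proof.
have := rintegrableD rintegrable_mass (rintegrable_co1 s t).
apply: rintegrable_le.
  apply: measurable_funM; first exact: measurable_co.
  apply: measurable_funD => //.
  exact: (@measurable_Rintegral2 _ _ _ _ _ (leb d) Ug measurable_Ug).
move=> r; rewrite normrM (ger0_norm (co_ge0 _ _ _)) coE.
have [/andP[sr rt]|_] := boolP (s <= r < t); last first.
  by rewrite mul0r addr0 mulr_ge0// mass_ge0.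
rewrite oo0E rt (lt_le_trans s0 sr) mul1r ger0_norm ?addr_ge0 ?mass_ge0//.
by rewrite mul1r.
Qed.

Lemma rintegrable_rate : rintegrable lam (fun r => co s t r * rate r x).
Proof.
have [B B0 hB] := rate_bound.
have := rintegrableZ B rintegrable_co_mass; apply: rintegrable_le.
  apply: measurable_funM; first exact: measurable_co.
  exact: (measurableT_comp measurable_rate (measurable_pair2 x)).
move=> r; rewrite normrM (ger0_norm (co_ge0 _ _ _)) coE.
have [/andP[sr rt]|_] := boolP (s <= r < t); last by rewrite mul0r mul0r mulr0.
by rewrite mul1r mul1r hB// ltW.
Qed.

(** [ln_growth] along the mollified equation at the point x. *)
Lemma growth_ln : \int[lam]_r (co s t r * rate r x) <=
  ln (conv (U t) (moll e) x + dl0) - ln (conv (U s) (moll e) x + dlt s).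
Proof.
have [t0 tT2] := tT.
have subT (r : R) : 0 <= r <= t -> time_co T r.
  by move=> /andP[r0 rt]; split => //; rewrite (le_lt_trans _ tT2)// lee_fin.
have wode p : time_co T p -> _ :=
  @weak_ode x e p e0 xe.
have [di _] := wode t tT.
have cst1 : rintegrable lam (co s t) by exact: rintegrable_co1.
pose D r := drift e x r.
pose g (r : R) := \1_(`]0%R, t[%classic : set R) r * D r - kap * co s t r.
have gi : rintegrable lam g by apply: rintegrableB di _; exact: rintegrableZ.
pose F r := conv (U r) (moll e) x + dlt r.
have mF : measurable_fun setT F.
  have m3 := measurable_conv2 mU2 (@measurable_moll R d e).
  apply: measurable_funD; first exact: (measurableT_comp m3 (measurable_pair2 x)).
  by apply: measurable_funD => //; apply: measurable_funM => //; exact: measurable_funB.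
have Fge r : s <= r <= t -> dl0 <= F r.
  move=> /andP[sr rt]; rewrite (le_trans (dlt_ge rt))// lerDr.
  by apply: conv_ge0 => y //; exact: moll_ge0.
have FE p q : s <= p -> p <= q -> q <= t -> F q - F p = \int[lam]_r (co p q r * g r).
  move=> sp pq qt; have p0 : 0 < p by exact: lt_le_trans sp.
  have tq : time_co T q by apply: subT; rewrite qt (ltW (lt_le_trans p0 pq)).
  have tp : time_co T p by apply: subT; rewrite (ltW p0) (le_trans pq).
  have [iq Eq] := wode q tq; have [ip Ep] := wode p tp.
  have cpq : rintegrable lam (co p q) by exact: rintegrable_co1.
  have icp := rintegrableZ kap cpq.
  have E1 := RintegralB measurableT iq ip.
  have E2 := RintegralB measurableT (rintegrableB iq ip) icp.
  have E3 := RintegralZl kap measurableT cpq.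
  have E4 := Rintegral_co1 pq.
  apply: (etrans (y := \int[lam]_r (\1_(`]0%R, q[%classic : set R) r * D r -
     \1_(`]0%R, p[%classic : set R) r * D r - kap * co p q r))).
    apply: etrans (esym E2); rewrite E3 E4; apply: etrans (f_equal (fun v => v - _) (esym E1)).
    by rewrite /F Eq Ep /dlt; ring.
  apply: Rintegral_eq => r; rewrite /g !coE !oo0E.
  have [r0|r0] := ltP 0 r; last first.
    by rewrite (leNgt p) (le_lt_trans r0 p0) /=; ring.
  rewrite /=; have [rp|rp] := ltP r p.
    by rewrite (lt_le_trans rp pq)/=; ring.
  have [rq|rq] := ltP r q; last by rewrite /=; ring.
  by rewrite /= (lt_le_trans rq qt) (le_trans sp rp)/=; ring.
have main := ln_growth gi st dl00 mF FE Fge.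
have Ft : F t = conv (U t) (moll e) x + dl0 by rewrite /F /dlt subrr mulr0 addr0.
rewrite -Ft; apply: le_trans main.
apply: Rintegral_le_ae; first exact: rintegrable_rate.
  exact: rintegrable_growth gi dl00 mF Fge.
have [_ _ F2i _] := weak_identity_moll e0 xe tT.
have F2ae := @ae_rintegrable1 _ _ _ _ _ lam (leb d)
  (fun r y => \1_(`]0%R, t[%classic : set R) r * (U r y * W y * moll e (x - y))) F2i.
have gae := ae_good.
near=> r.
rewrite coE; have [/andP[sr rt]|_] := boolP (s <= r < t); last by rewrite !mul0r.
rewrite !mul1r; have r0 : 0 < r := lt_le_trans s0 sr.
have gr : good_time r.
  have : 0 < r < t by rewrite r0.
  by near: r.
have Fr : rintegrable (leb d) (fun y => U r y * W y * moll e (x - y)).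
  have : rintegrable (leb d) (fun y => \1_(`]0%R, t[%classic : set R) r *
     (U r y * W y * moll e (x - y))) by near: r.
  rewrite indicE mem_set; last by rewrite /= in_itv/= r0.
  by apply: eq_integrable => // y _ /=; rewrite mul1r.
have UgU : Ug r = U r by apply/funext => y; exact: UgE.
rewrite /rate UgU /F /g oo0E r0 rt coE sr rt/= mul1r mulr1.
have Fr0 : 0 < conv (U r) (moll e) x + dlt r.
  by apply: lt_le_trans dl00 (Fge _ _); rewrite sr ltW.
rewrite ler_pM2r ?invr_gt0// lerD2r /D /drift lerD2l.
have m0 := @moll_ge0 R d e e0.
have tle y : trunc r y * moll e (x - y) <= U r y * W y * moll e (x - y).
  by rewrite ler_wpM2r// /trunc UgU ge_min lexx.
have ti : rintegrable (leb d) (fun y => trunc r y * moll e (x - y)).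
  apply: (rintegrable_le _ _ Fr).
    apply: measurable_funM.
      exact: (measurableT_comp measurable_trunc (measurable_pair1 r)).
    by apply: (measurableT_comp (@measurable_moll R d e)); exact: measurable_subV.
  move=> y; rewrite ger0_norm; last by apply: mulr_ge0 => //; exact: trunc_ge0.
  exact: tle.
exact: (Rintegral_le ti Fr tle).
Unshelve. all: by end_near. Qed.

End growth.

Section space.
Variables (Phi : X -> R) (B' e k kap dl0 c0 s : R) (D Q : set X).
Hypotheses (mPhi : measurable_fun setT Phi) (PhiB : forall x, `|Phi x| <= B').
Hypothesis PhiE : (Eform alpha Phi Phi < +oo)%E.
Hypotheses (e0 : 0 < e) (k0 : 0 <= k) (kap0 : 0 <= kap) (dl00 : 0 < dl0).
Hypotheses (s0 : 0 < s) (st : s <= t) (c00 : 0 <= c0).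
Hypothesis xe : forall x, Phi x != 0 -> forall y, `|x - y| <= e -> Omega y.
Hypotheses (mD : measurable D) (Doo : (leb d D < +oo)%E).
Hypothesis PhiD : forall x, ~ D x -> Phi x = 0.
Hypothesis hD : forall x y, Omega y -> `|x - y| < e -> D x.
Hypothesis hc : forall x y, D x -> D y -> x != y -> c0 <= calA d alpha * kern s_ (x - y).
Hypothesis hkap : {ae lam, forall r : measurableTypeR R, s <= r < t -> kap <= c0 * mass r}.
Hypothesis hQ : forall x, Phi x != 0 -> forall y, `|x - y| < e -> Q y.

Local Notation dl := (dlt kap dl0).
Local Notation tru := (trunc k).
Local Notation rho := (@moll R d e).

Let m0 := @moll_ge0 R d e e0.
Let mrho := @measurable_moll R d e.

Let Phi2i : rintegrable (leb d) (fun x => Phi x ^+ 2).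
Proof.
have iD := rintegrable_indic mD Doo.
have h : rintegrable (leb d) (fun x => Phi x ^+ 2 * \1_D x).
  apply: (rintegrableM_bounded (B := B' ^+ 2) _ _ iD); first exact: measurable_funX.
  by move=> x; rewrite normrX lerXn2r ?nnegrE// (le_trans _ (PhiB x)).
apply: eq_integrable h => // x _ /=; rewrite indicE.
have [_|h] := boolP (x \in D); first by rewrite mulr1.
by rewrite PhiD ?expr0n ?mul0r// => /mem_set; rewrite (negbTE h).
Qed.

(** Makes Phi^2 ln (u + c) integrable as soon as u is. *)
Lemma ln_shift_bound (a c : R) : 0 < c -> 0 <= a -> `|ln (a + c)| <= `|ln c| + a / c.
Proof.
move=> c0' a0; have ac : 0 < a + c by rewrite ltr_wpDl.
have h1 : ln c <= ln (a + c) by rewrite ler_ln ?posrE// lerDr.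
have h2 : ln (a + c) <= ln c + a / c.
  rewrite -lerBlDl -ln_div ?posrE// mulrDl divff ?gt_eqF// addrC le_ln1Dx//.
  by rewrite (lt_le_trans (ltrN10 _))// divr_ge0// ltW.
have h3 : 0 <= a / c by rewrite divr_ge0// ltW.
rewrite ler_norml; apply/andP; split.
  rewrite lerNl; apply: le_trans (_ : - ln c <= _); first by rewrite lerN2.
  by rewrite (le_trans (ler_norm _))// normrN lerDl.
by apply: le_trans h2 _; rewrite lerD2r ler_norm.
Qed.

Lemma rintegrable_ln_endpoint p c : 0 < c ->
  rintegrable (leb d) (fun y => \1_Q y * U p y) ->
  rintegrable (leb d) (fun x => Phi x ^+ 2 * ln (conv (U p) rho x + c)).
Proof.
move=> cp Qi; have [B hB] := @moll_bounded R d e e0.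
pose w x := conv (U p) rho x.
have w0 x : 0 <= w x by apply: conv_ge0.
pose wB := B * \int[leb d]_y `|\1_Q y * U p y|.
have wle x : Phi x != 0 -> w x <= wB.
  move=> Px; rewrite (_ : w x = conv (fun y => \1_Q y * U p y) rho x).
    exact: le_trans (ler_norm _) (conv_bounded Qi mrho hB x).
  apply: Rintegral_eq => y; have [xy|xy] := ltP `|x - y| e.
    by rewrite indicE mem_set ?mul1r//; exact: hQ xy.
  by rewrite moll_out// !mulr0.
have mw : measurable_fun setT w.
  have m3 := measurable_conv2 mU2 mrho.
  exact: (measurableT_comp m3 (measurable_pair1 p)).
have := rintegrableZ (`|ln c| + wB / c) Phi2i; apply: rintegrable_le.
  apply: measurable_funM; first exact: measurable_funX.
  by apply: (measurableT_comp (@measurable_ln R)); exact: measurable_funD.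
move=> x; rewrite normrM mulrC (ger0_norm (sqr_ge0 _)).
have [->|Px] := eqVneq (Phi x) 0; first by rewrite expr0n !mulr0.
rewrite ler_wpM2r ?sqr_ge0//; apply: le_trans (ln_shift_bound cp (w0 x)) _.
by rewrite lerD2l ler_wpM2r ?invr_ge0 ?(ltW cp)// wle.
Qed.

(** The contribution of the potential at time r. *)
Definition ratio r : R :=
  \int[leb d]_x (Phi x ^+ 2 * (conv (tru r) rho x / (conv (Ug r) rho x + dl r))).

Let Cst := calA d alpha / 2 *
    \int[(leb d \x leb d)%E]_p (energy_density alpha Phi Phi p) +
  c0 * (\int[leb d]_y \1_D y) * \int[leb d]_x Phi x ^+ 2.

Let dl_gt0 r : r <= t -> 0 < dl r.
Proof. by move=> rt; apply: lt_le_trans dl00 (dlt_ge _ _ _). Qed.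

Let wg_ge0 r x : 0 <= conv (Ug r) rho x.
Proof. by apply: conv_ge0 => // y; exact: Ug_ge0. Qed.

Let mdl : measurable_fun setT dl.
Proof. by apply: measurable_funD => //; apply: measurable_funM => //; exact: measurable_funB. Qed.

Let mratio2 : measurable_fun setT (fun z : spacetime =>
  Phi z.2 ^+ 2 * (conv (tru z.1) rho z.2 / (conv (Ug z.1) rho z.2 + dl z.1))).
Proof.
apply: measurable_funM; first by apply: measurable_funX; exact: (measurableT_comp mPhi).
apply: measurable_funM; first exact: measurable_conv2 (measurable_trunc k) mrho.
apply: measurable_funV; apply: measurable_funD.
  exact: measurable_conv2 measurable_Ug mrho.
exact: (measurableT_comp mdl).
Qed.

Let ratio_le r x : r <= t ->
  `|conv (tru r) rho x / (conv (Ug r) rho x + dl r)| <= k / dl0.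
Proof.
move=> rt; have /andP[c1 c2] := conv_trunc_bound e0 k0 r x.
have d1 := dl_gt0 rt; have d2 : dl0 <= dl r by exact: dlt_ge.
have v0 : 0 < conv (Ug r) rho x + dl r by rewrite ltr_wpDl.
rewrite normrM (ger0_norm c1) normfV (gtr0_norm v0) ler_pM ?invr_ge0 ?(ltW v0)//.
by rewrite lef_pV2 ?posrE// (le_trans d2)// lerDr.
Qed.

Lemma rintegrable_ratio_slice r : r <= t -> rintegrable (leb d) (fun x =>
  Phi x ^+ 2 * (conv (tru r) rho x / (conv (Ug r) rho x + dl r))).
Proof.
move=> rt; have := rintegrableZ (k / dl0) Phi2i; apply: rintegrable_le.
  exact: (measurableT_comp mratio2 (measurable_pair1 r)).
by move=> x; rewrite normrM mulrC (ger0_norm (sqr_ge0 _)) ler_wpM2r ?sqr_ge0// ratio_le.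
Qed.

Lemma rintegrable_ratio : rintegrable lam (fun r => co s t r * ratio r).
Proof.
have := rintegrableZ (k / dl0 * \int[leb d]_x Phi x ^+ 2) (rintegrable_co1 s t).
apply: rintegrable_le.
  apply: measurable_funM; first exact: measurable_co.
  exact: (@measurable_Rintegral2 _ _ _ _ _ (leb d) (fun r x =>
    Phi x ^+ 2 * (conv (tru r) rho x / (conv (Ug r) rho x + dl r))) mratio2).
move=> r; rewrite normrM (ger0_norm (co_ge0 _ _ _)) coE.
have [/andP[sr rt]|_] := boolP (s <= r < t); last by rewrite mul0r mulr0.
rewrite mulrC ler_wpM2r// /ratio.
have E := RintegralZl (k / dl0) measurableT Phi2i.
rewrite -E; apply: Rintegral_norm_le.
- exact: rintegrable_ratio_slice (ltW rt).
- exact: rintegrableZ.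
by move=> x; rewrite normrM mulrC (ger0_norm (sqr_ge0 _)) ler_wpM2r ?sqr_ge0// ratio_le// ltW.
Qed.

(** The Picone inequality at time r.  Its surplus c0 (mass) (integral of Phi^2 / v)
    absorbs the term produced by the decrease of the regularisation, which is
    kap (integral of Phi^2 / v). *)
Lemma spatial_rate r : r <= t -> kap <= c0 * mass r ->
  rintegrable (leb d) (fun x => Phi x ^+ 2 * rate e k kap dl0 r x) /\
  ratio r - Cst <= \int[leb d]_x (Phi x ^+ 2 * rate e k kap dl0 r x).
Proof.
move=> rt hk; have [B hB] := @moll_bounded R d e e0.
have [C C0 hC] := @moll_sdiff R d e e0.
have mL := measurable_L0_moll e.
have [LB hLB] := L0_moll_bounded e0.
have d1 := dl_gt0 rt; have d2 : dl0 <= dl r by exact: dlt_ge.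
pose v x := conv (Ug r) rho x + dl r.
have v0 x : 0 < v x by rewrite ltr_wpDl.
have ui := rintegrable_Ug r.
have mv : measurable_fun setT v by apply: measurable_funD => //; exact: measurable_conv.
have iP : rintegrable (leb d) (fun x => Phi x ^+ 2 / v x).
  have := rintegrableZ dl0^-1 Phi2i; apply: rintegrable_le.
    by apply: measurable_funM; [exact: measurable_funX|exact: measurable_funV].
  move=> x; rewrite ger0_norm ?divr_ge0 ?sqr_ge0 ?(ltW (v0 x))// mulrC.
  by rewrite ler_wpM2r ?sqr_ge0// lef_pV2 ?posrE// (le_trans d2)// lerDr.
have iA : rintegrable (leb d) (fun x => Phi x ^+ 2 / v x * conv (Ug r) (L0 alpha rho) x).
  rewrite [X in rintegrable _ X](_ : _ = fun x => conv (Ug r) (L0 alpha rho) x *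
    (Phi x ^+ 2 / v x)); last by apply/funext => x; rewrite mulrC.
  apply: rintegrableM_bounded (conv_bounded ui mL hLB) iP.
  exact: measurable_conv.
have iB := rintegrable_ratio_slice rt.
have pic := picone_conv halpha ui (Ug_ge0 r) mrho m0 hB hC mPhi PhiB PhiE mD Doo PhiD
  c00 d1 hc.
have EE x : Phi x ^+ 2 * rate e k kap dl0 r x =
    Phi x ^+ 2 * (conv (tru r) rho x / v x) - Phi x ^+ 2 / v x * conv (Ug r) (L0 alpha rho) x
    - kap * (Phi x ^+ 2 / v x).
  by rewrite /rate -/(v x); field; rewrite gt_eqF.
have iBA := rintegrableB iB iA; have iK := rintegrableZ kap iP.
split.
  have := rintegrableB iBA iK; apply: eq_integrable => // x _ /=.
  by apply: (f_equal EFin); rewrite EE.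
have E1 := RintegralB measurableT iB iA.
have E2 := RintegralB measurableT iBA iK.
have E3 := RintegralZl kap measurableT iP.
have mle : mass r <= \int[leb d]_y (\1_D y * v y).
  have [ci cE] := Rintegral_conv ui (@rintegrable_moll R d e e0).
  rewrite /mass -[leLHS]mulr1 -(Rintegral_moll d e0) -cE; apply: Rintegral_le => //.
    rewrite [X in rintegrable _ X](_ : _ = fun x => v x * \1_D x); last first.
      by apply/funext => x; rewrite mulrC.
    apply: (rintegrableM_bounded (B := B * \int[leb d]_y `|Ug r y| + dl r) mv _
      (rintegrable_indic mD Doo)) => x.
    rewrite (le_trans (ler_normD _ _))// (gtr0_norm d1) lerD2r.
    exact: conv_bounded ui mrho hB x.
  move=> x; rewrite indicE; have [_|nD] := boolP (x \in D).
    by rewrite mul1r lerDl ltW.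
  rewrite mul0r le_eqVlt; apply/orP; left; apply/eqP.
  apply: (etrans (y := \int[leb d]_y (0 : R))); last by rewrite Rintegral_cst// mul0r.
  apply: Rintegral_eq => y; have [Oy|nO] := pselect (Omega y); last first.
    by rewrite Ug_out// mul0r.
  rewrite moll_out ?mulr0// leNgt; apply/negP => h.
  by move: nD; rewrite mem_set//; exact: hD h.
apply: (@le_trans _ _ (ratio r - \int[leb d]_x (Phi x ^+ 2 / v x * conv (Ug r) (L0 alpha rho) x)
   - kap * \int[leb d]_x (Phi x ^+ 2 / v x))); last first.
  rewrite -E3; apply: le_trans (_ : _ <= \int[leb d]_x (Phi x ^+ 2 * (conv (tru r) rho x / v x) -
    Phi x ^+ 2 / v x * conv (Ug r) (L0 alpha rho) x - kap * (Phi x ^+ 2 / v x))) _.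
    by rewrite E2 E1.
  by rewrite le_eqVlt; apply/orP; left; apply/eqP; apply: Rintegral_eq => x; rewrite EE.
have P0 : 0 <= \int[leb d]_x (Phi x ^+ 2 / v x).
  by apply: Rintegral_ge0 => x _; rewrite divr_ge0 ?sqr_ge0// ltW.
have hk2 : kap * \int[leb d]_x (Phi x ^+ 2 / v x) <=
    c0 * \int[leb d]_y (\1_D y * v y) * \int[leb d]_x (Phi x ^+ 2 / v x).
  by rewrite ler_wpM2r//; apply: le_trans hk _; rewrite ler_wpM2l.
exact: cst_le pic hk2.
Qed.

(** [growth_ln] integrated against Phi^2, the order of the integrations in time and
    space being exchanged, and then bounded by [spatial_rate]. *)
Lemma growth_space :
  rintegrable (leb d) (fun y => \1_Q y * U s y) ->
  rintegrable (leb d) (fun y => \1_Q y * U t y) ->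
  \int[lam]_r (co s t r * ratio r) - (t - s) * Cst <=
  \int[leb d]_x (Phi x ^+ 2 * ln (conv (U t) rho x + dl0)) -
  \int[leb d]_x (Phi x ^+ 2 * ln (conv (U s) rho x + dl s)).
Proof.
move=> Qs Qt; have [B B0 hB] := rate_bound e0 k0 kap0 dl00.
have mR := measurable_rate e k kap dl0.
pose G (r : R) (x : X) : R := co s t r * (Phi x ^+ 2 * rate e k kap dl0 r x).
pose P2 := \int[leb d]_x Phi x ^+ 2.
have mG : measurable_fun setT (fun z : spacetime => G z.1 z.2).
  apply: measurable_funM; first exact: (measurableT_comp (measurable_co s t)).
  by apply: measurable_funM => //; apply: measurable_funX; exact: (measurableT_comp mPhi).
have mass_i := rintegrable_co_mass s0.
have Gi : rintegrable (lam \x leb d)%E (fun z : spacetime => G z.1 z.2).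
  apply: (@rintegrable_prod_bound _ _ _ _ _ lam (leb d) G
    (fun r => B * (co s t r * (mass r + 1))) P2) => //.
  - exact: rintegrableZ.
  - by move=> r; rewrite !mulr_ge0 ?co_ge0// addr_ge0// mass_ge0.
  - by apply: Rintegral_ge0 => x _; exact: sqr_ge0.
  move=> r; have iz := rintegrableZ (B * (co s t r * (mass r + 1))) Phi2i.
  have E := RintegralZl (B * (co s t r * (mass r + 1))) measurableT Phi2i.
  rewrite -E (EFin_Rintegral iz); apply: ge0_le_integral => //.
  - apply/measurable_EFinP; apply: measurableT_comp => //.
    exact: (measurableT_comp mG (measurable_pair1 r)).
  - by apply/measurable_EFinP; exact: rintegrable_measurable iz.
  move=> x _; rewrite lee_fin /G normrM (ger0_norm (co_ge0 _ _ _)) coE.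
  have [/andP[sr rt]|_] := boolP (s <= r < t); last by rewrite !mul0r mulr0 mul0r.
  rewrite !mul1r normrM (ger0_norm (sqr_ge0 _)) mulrC ler_wpM2r ?sqr_ge0//.
  exact: hB (ltW rt).
have es := rintegrable_ln_endpoint (dl_gt0 st) Qs.
have et := rintegrable_ln_endpoint dl00 Qt.
have ES := RintegralB measurableT et es.
have Sw := Rintegral_swap Gi.
have Gi' := rintegrable_swap Gi.
have ir := rintegrable_ratio; have ic := rintegrableZ Cst (rintegrable_co1 s t).
have E1 := RintegralB measurableT ir ic.
have E2 := RintegralZl Cst measurableT (rintegrable_co1 s t).
apply: (@le_trans _ _ (\int[lam]_r (co s t r * ratio r - Cst * co s t r))).
  by rewrite E1 E2 (Rintegral_co1 st) (mulrC Cst).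
apply: (@le_trans _ _ (\int[lam]_r \int[leb d]_x G r x)).
  apply: Rintegral_le_ae; first exact: rintegrableB ir ic.
    exact: (@rintegrable_prod1 _ _ _ _ _ lam (leb d) G Gi).
  apply: filterS hkap => r hk; have GE : G r = fun x => co s t r *
    (Phi x ^+ 2 * rate e k kap dl0 r x) by [].
  rewrite GE coE; have [rst|_] := boolP (s <= r < t); last first.
    rewrite mul0r mulr0 subrr; apply: Rintegral_ge0 => x _; by rewrite mul0r.
  have [sr rt] := andP rst.
  have [j1 j2] := spatial_rate (ltW rt) (hk rst).
  have E := RintegralZl true%:R measurableT j1.
  by rewrite E mul1r mul1r mulr1.
rewrite Sw -ES; apply: Rintegral_le.
- exact: (@rintegrable_prod1 _ _ _ _ _ (leb d) lam (fun x r => G r x) Gi').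
- exact: rintegrableB et es.
move=> x; have [Px|Px] := eqVneq (Phi x) 0.
  rewrite Px expr0n !mul0r subrr le_eqVlt; apply/orP; left; apply/eqP.
  apply: (etrans (y := \int[lam]_r (0 : R))); last by rewrite Rintegral_cst// mul0r.
  by apply: Rintegral_eq => r; rewrite /G Px expr0n mul0r mulr0.
have gx := growth_ln e0 (xe Px) k0 kap0 dl00 s0 st.
have ix := rintegrable_rate x e0 k0 kap0 dl00 s0.
have E := RintegralZl (Phi x ^+ 2) measurableT ix.
apply: (@le_trans _ _ (\int[lam]_r (Phi x ^+ 2 * (co s t r * rate e k kap dl0 r x)))).
  by rewrite le_eqVlt; apply/orP; left; apply/eqP; apply: Rintegral_eq => r; rewrite /G mulrCA.
by rewrite E -mulrBr ler_wpM2l// sqr_ge0.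
Qed.

End space.
End final_time.
Let time_le t p : time_co T t -> 0 <= p <= t -> time_co T p.
Proof.
by move=> [t0 tT] /andP[p0 pt]; split => //; rewrite (le_lt_trans _ tT)// lee_fin.
Qed.

(** * Persistence of nonvanishing in time *)

Definition vanishing t := {ae leb d, forall x, U t x = 0}.

Lemma conv_pos_not_vanishing t x e : 0 < conv (U t) (moll e) x -> ~ vanishing t.
Proof.
move=> h vt; move: h; rewrite (_ : conv _ _ _ = 0) ?ltxx//.
apply: (etrans (y := \int[leb d]_y (0 : R))); last by rewrite Rintegral_cst// mul0r.
apply: Rintegral_ae_eq => //.
  apply: measurable_funM => //; apply: (measurableT_comp (@measurable_moll R d e)).
  exact: measurable_subV.
by apply: filterS vt => y ->; rewrite mul0r.
Qed.

Lemma not_vanishing_conv_pos t : time_co T t -> ~ vanishing t ->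
  exists x e, [/\ 0 < e, forall y, `|x - y| <= e -> Omega y & 0 < conv (U t) (moll e) x].
Proof.
move=> tT nv; apply: exists_positive_mollification => //.
  by move=> x; exact: ut_out.
move=> x e e0 xe; have [] := weak_identity_moll e0 xe tT.
by [].
Qed.

(** Absolute continuity of the integral in [weak_ode]: the mollified solution at an
    interior point is uniformly continuous in time, down to time 0 where its value
    is the mollification of the initial datum. *)
Lemma weak_modulus t x e : time_co T t -> 0 < e -> (forall y, `|x - y| <= e -> Omega y) ->
  forall eps : R, 0 < eps -> exists2 rho : R, 0 < rho & forall p q, 0 <= p -> p <= q -> q <= t ->
    q - p < rho -> `|conv (U q) (moll e) x - conv (U p) (moll e) x| <= eps.
Proof.
move=> tT e0 xe eps eps0.
have wode p : time_co T p -> _ :=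
  @weak_ode x e p e0 xe.
have [it _] := wode t tT.
have [rho [rho0 hrho]] := integral_normr_continuous it eps0.
exists rho => // p q p0 pq qt qp.
have pT : time_co T p by apply: time_le tT _; rewrite p0 (le_trans pq).
have qT : time_co T q by apply: time_le tT _; rewrite qt (le_trans p0).
have [ip Ep] := wode p pT; have [iq Eq] := wode q qT.
pose D r := drift e x r.
have E := RintegralB measurableT iq ip.
rewrite Ep Eq opprD addrACA subrr add0r.
apply: le_trans (_ : `|\int[lam]_r (\1_(`]0%R, q[%classic : set R) r * D r -
     \1_(`]0%R, p[%classic : set R) r * D r)| <= _); first by rewrite E.
have icn := rintegrable_co p q (rintegrable_norm it).
apply: le_trans (Rintegral_norm_le (rintegrableB iq ip) icn _) _.
  move=> r; rewrite !oo0E coE normrM -mulrBl.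
  have [r0|r0] := ltP 0 r; last by rewrite /= subrr mul0r normr0 mul0r mulr0.
  have [rp|rp] := ltP r p.
    by rewrite /= (lt_le_trans rp pq) subrr mul0r normr0 mul0r.
  have [rq|rq] := ltP r q; last by rewrite /= subrr mul0r normr0 !mul0r.
  by rewrite /= (lt_le_trans rq qt) subr0 !mul1r normr1 mul1r.
have mI : measurable (`[p, q[%classic : set R) by [].
have muI : (lam `[p, q[%classic < rho%:E)%E.
  rewrite /= lebesgue_measure_itv/= lte_fin; case: ifPn => _; last by rewrite lte_fin.
  by rewrite -EFinB lte_fin.
apply: le_trans (ltW (hrho _ mI muI)).
rewrite le_eqVlt; apply/orP; left; apply/eqP.
rewrite [RHS]Rintegral_mkcond; apply: Rintegral_eq => r.
by rewrite patchE /co indicE; case: (_ \in _); rewrite ?mul1r ?mul0r.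
Qed.

Lemma not_vanishing_before t : time_co T t -> 0 < t -> ~ vanishing t ->
  exists s, [/\ 0 < s, s < t & ~ vanishing s].
Proof.
move=> tT t0 /(not_vanishing_conv_pos tT)[x [e [e0 xe w0]]].
have w2 : 0 < conv (U t) (moll e) x / 2 by rewrite divr_gt0.
have [rho rho0 hr] := weak_modulus tT e0 xe w2.
pose s := Num.max (t - rho / 2) (t / 2).
have s0 : 0 < s by rewrite lt_max divr_gt0 ?orbT.
have st : s < t.
  rewrite gt_max gtrBl divr_gt0//=.
  by rewrite ltr_pdivrMr// ltr_pMr// ltr1n.
exists s; split => //; apply: (@conv_pos_not_vanishing _ x e).
have := hr s t (ltW s0) (ltW st) (lexx _).
have ts : t - s < rho.
  have : t - rho / 2 <= s by rewrite le_max lexx.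
  by move: rho0; lra.
move=> /(_ ts) /(le_trans (ler_norm _)); move: w0; lra.
Qed.

(** The mollification of u0 is the value at time 0 of that of u. *)
Lemma not_vanishing_initial t : time_co T t -> 0 < t ->
  {ae leb d, forall x, Omega x -> 0 <= u0 x} ->
  ~ {ae leb d, forall x, Omega x -> u0 x = 0} ->
  exists s, [/\ 0 < s, s < t & ~ vanishing s].
Proof.
move=> tT t0 u00 nu0; have T0 : time_co T 0 by apply: time_le tT _; rewrite lexx ltW.
suff [x [e [e0 xe w0]]] : exists x e, [/\ 0 < e, forall y, `|x - y| <= e -> Omega y &
    0 < conv (U 0) (moll e) x].
  have w2 : 0 < conv (U 0) (moll e) x / 2 by rewrite divr_gt0.
  have [rho rho0 hr] := weak_modulus tT e0 xe w2.
  pose s := Num.min (rho / 2) (t / 2).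
  have s0 : 0 < s by rewrite lt_min !divr_gt0.
  have st : s < t.
    have t2 : t / 2 < t by rewrite ltr_pdivrMr// ltr_pMr// ltr1n.
    by rewrite gt_min t2 orbT.
  exists s; split => //; apply: (@conv_pos_not_vanishing _ x e).
  have := hr 0 s (lexx _) (ltW s0) (ltW st).
  have ts : s - 0 < rho.
    have : s <= rho / 2 by rewrite ge_min lexx.
    by move: rho0; lra.
  move=> /(_ ts); rewrite distrC => /(le_trans (ler_norm _)); move: w0; lra.
pose u0t : X -> R := u0 \_ Omega.
have ui : rintegrable (leb d) u0t := rintegrable_u0 .
have mu0 := rintegrable_measurable ui.
pose g x := Num.max (u0t x) 0.
have mg : measurable_fun setT g by exact: measurable_maxr.
have gu : {ae leb d, forall x, g x = u0t x}.
  apply: filterS u00 => x hx; rewrite /g /u0t patchE.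
  case: ifPn => [/set_mem/hx h|_]; last by rewrite maxxx.
  exact/max_idPl.
have gi : rintegrable (leb d) g.
  apply: rintegrable_le (rintegrable_norm ui) => // x.
  by rewrite /g; case: (leP (u0t x) 0) => _; rewrite ?normr0.
have [x [e [e0 xe w0]]] : exists x e, [/\ 0 < e, forall y, `|x - y| <= e -> Omega y &
    0 < conv g (moll e) x].
  apply: exists_positive_mollification => //.
  - by move=> x; rewrite le_max lexx orbT.
  - by move=> x nO; rewrite /g /u0t patchE memNset// maxxx.
  - move=> x e e0 _; have [B hB] := @moll_bounded R d e e0.
    exact: (rintegrable_conv gi (@measurable_moll R d e) hB).
  apply: contra_not nu0 => h; apply: filterS2 gu h => x -> hx Ox.
  by rewrite -hx /u0t patchE mem_set.
exists x, e; split => //.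
have [_ E] := weak_ode e0 xe T0.
rewrite E (_ : \int[lam]_r _ = 0) ?addr0; last first.
  apply: (etrans (y := \int[lam]_r (0 : R))); last by rewrite Rintegral_cst// mul0r.
  by apply: Rintegral_eq => r; rewrite oo0E lt_asym mul0r.
apply: lt_le_trans w0 _; rewrite le_eqVlt; apply/orP; left; apply/eqP.
have mm y : measurable_fun setT (fun z : X => moll e (y - z)).
  by apply: (measurableT_comp (@measurable_moll R d e)); exact: measurable_subV.
apply: Rintegral_ae_eq; [exact: measurable_funM|exact: measurable_funM|].
by apply: filterS gu => y ->.
Qed.

(** * The logarithmic inequality without mollification *)

Section test_function.
Variables (x0 : X) (eta : R) (Phi : X -> R).
Hypotheses (eta0 : 0 < eta) (x0O : forall y, `|x0 - y| <= eta -> Omega y).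
Hypotheses (cPhi : continuous Phi) (cK : compact (supp Phi)) (KO : supp Phi `<=` Omega).
Hypothesis PhiE : (Eform alpha Phi Phi < +oo)%E.

Let mPhi : measurable_fun setT Phi. Proof. exact: continuous_measurable_rV. Qed.

Let supp_in x : Phi x != 0 -> supp Phi x.
Proof. by move=> Px; exact: subset_closure. Qed.

Section box.
Variables (rD c0 : R).
Hypotheses (rD0 : 0 < rD) (hrD : forall y, Omega y -> `|y| + 1 <= rD).
Hypothesis c00 : 0 <= c0.
Let D := [set x : X | `|x| < rD].
Hypothesis hc : forall x y, D x -> D y -> x != y -> c0 <= calA d alpha * kern s_ (x - y).

(** The rate at which Phi^2 ln u may decrease: the energy of Phi, plus the cost of
    setting c0 aside in the kernel on the box D. *)
Definition energy_cost := calA d alpha / 2 *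
    \int[(leb d \x leb d)%E]_p (energy_density alpha Phi Phi p) +
  c0 * (\int[leb d]_y \1_D y) * \int[leb d]_x Phi x ^+ 2.

(** Limit of [ratio] as the radius of the mollifier tends to 0. *)
Definition limit_ratio t k kap dl0 r : R := \int[leb d]_x
  (Phi x ^+ 2 * (trunc k r x / (Ug r x + dlt t kap dl0 r))).

Let mD : measurable D. Proof. exact: measurable_ballV. Qed.

Let Doo : (leb d D < +oo)%E. Proof. by rewrite [ltLHS](leb_ball d rD0) ltry. Qed.

Let OD y : Omega y -> D y.
Proof. by move=> /hrD h; rewrite /D/= (lt_le_trans _ h)// ltrDl. Qed.

Let PhiD x : ~ D x -> Phi x = 0.
Proof.
move=> nD; apply/eqP; apply: contrapT => /negP Px; apply: nD.
by apply: OD; apply: KO; exact: supp_in.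
Qed.

Lemma rintegrable_Phi2 B : (forall x, `|Phi x| <= B) -> rintegrable (leb d) (fun x => Phi x ^+ 2).
Proof.
move=> PhiB; have iD := rintegrable_indic mD Doo.
have h : rintegrable (leb d) (fun x => Phi x ^+ 2 * \1_D x).
  apply: (rintegrableM_bounded (B := B ^+ 2) _ _ iD); first exact: measurable_funX.
  by move=> x; rewrite normrX lerXn2r ?nnegrE// (le_trans _ (PhiB x)).
apply: eq_integrable h => // x _ /=; rewrite indicE.
have [_|h] := boolP (x \in D); first by rewrite mulr1.
by rewrite PhiD ?expr0n ?mul0r// => /mem_set; rewrite (negbTE h).
Qed.

Let out_zero x : rD <= `|x| -> ~ Omega x.
Proof. by move=> h /OD; rewrite /D/= ltNge h. Qed.

(** At almost every time u is integrable on Omega, but the inequality is wanted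
    between given times; there the weak identity still gives integrability against
    every mollifier, hence near the compact support of Phi. *)
Lemma local_integrability : exists2 r : R, 0 < r &
  (forall x y, Phi x != 0 -> `|x - y| <= r -> Omega y) /\
  forall p, time_co T p ->
    rintegrable (leb d) (fun y => \1_(thick (supp Phi) r) y * U p y).
Proof.
have [e1 e10 he1] := compact_margin cK Omega_open KO.
have [r r0 hr] := thick_integrable cK e10.
have sub : thick (supp Phi) (Num.min r e1) `<=` thick (supp Phi) r.
  by move=> y [x Kx]; rewrite lt_min => /andP[xy _]; exists x.
exists (Num.min r e1); first by rewrite lt_min r0.
split; first by move=> x y Px; rewrite le_min => /andP[_ ]; apply: he1; exact: supp_in.
move=> p pT.
have h : rintegrable (leb d) (fun y => \1_(thick (supp Phi) r) y * U p y).
  apply: hr => // x Kx.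
  have [] := weak_identity_moll e10 (fun y => he1 x y Kx) pT.
  by [].
apply: rintegrable_le h.
  apply: measurable_funM => //; apply: measurable_indic; apply: open_measurable_rV.
  exact: open_thick.
move=> y; rewrite ger0_norm ?mulr_ge0// ler_wpM2r// !indicE.
have [/set_mem yK|_] := boolP (y \in thick (supp Phi) (Num.min r e1)).
  by rewrite mem_set//; exact: sub.
by [].
Qed.

(** [growth_space] with radius tending to 0: the end points converge by
    [weighted_ln_cvg], the contribution of the potential by
    [weighted_quotient_cvg] at each good time and then by dominated convergence in
    time. *)
Lemma log_inequality s t k kap dl0 : 0 < s -> s <= t -> time_co T t ->
  0 <= k -> 0 <= kap -> 0 < dl0 ->
  {ae lam, forall r : measurableTypeR R, s <= r < t -> kap <= c0 * mass r} ->
  [/\ rintegrable (leb d) (fun x => Phi x ^+ 2 * ln (U s x + dlt t kap dl0 s)),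
      rintegrable (leb d) (fun x => Phi x ^+ 2 * ln (U t x + dl0)),
      rintegrable lam (fun r => co s t r * limit_ratio t k kap dl0 r) &
      \int[lam]_r (co s t r * limit_ratio t k kap dl0 r) - (t - s) * energy_cost <=
      \int[leb d]_x (Phi x ^+ 2 * ln (U t x + dl0)) -
      \int[leb d]_x (Phi x ^+ 2 * ln (U s x + dlt t kap dl0 s))].
Proof.
move=> s0 st tT k0 kap0 dl00 hkap.
have [B PhiB] := compact_supp_bounded cPhi cK; have P2 := rintegrable_Phi2 PhiB.
have [r r0 [rO Qi]] := local_integrability.
have sT : time_co T s.
  by split; [exact: ltW|apply: le_lt_trans tT.2; rewrite lee_fin].
pose Q := thick (supp Phi) r.
have mthick : measurable Q by apply: open_measurable_rV; exact: open_thick.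
have PQ x : Phi x != 0 -> forall y, `|x - y| < r -> Q y.
  by move=> Px y xy; exists x => //; exact: supp_in.
have Qp p : time_co T p -> tcont (fun y => \1_Q y * U p y).
  move=> pT; apply: (tcont_bounded rD0); first exact: Qi.
  by move=> x /out_zero xO; rewrite ut_out// mulr0.
have B2 x : `|Phi x ^+ 2| <= B ^+ 2.
  by rewrite normrX lerXn2r ?nnegrE// (le_trans _ (PhiB x)).
have ends p c : time_co T p -> 0 < c ->
    rintegrable (leb d) (fun x => Phi x ^+ 2 * ln (U p x + c)) /\
    \int[leb d]_x (Phi x ^+ 2 * ln (conv (U p) (moll (radius n)) x + c)) @[n --> \oo] -->
    \int[leb d]_x (Phi x ^+ 2 * ln (U p x + c)).
  move=> pT cp; have ic : rintegrable (leb d) (fun x => Phi x ^+ 2 * ln (U p x + c)).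
    have := rintegrableD (rintegrableZ `|ln c| P2) (rintegrableZ (B ^+ 2 / c) (Qi p pT)).
    apply: rintegrable_le.
      apply: measurable_funM; first exact: measurable_funX.
      by apply: (measurableT_comp (@measurable_ln R)); exact: measurable_funD.
    move=> x; have Bc : 0 <= B ^+ 2 / c by rewrite divr_ge0 ?sqr_ge0// ltW.
    have [->|Px] := eqVneq (Phi x) 0.
      by rewrite expr0n mul0r normr0 mulr0 add0r mulr_ge0// mulr_ge0.
    have Qx : Q x by apply: PQ Px _ _; rewrite subrr normr0.
    rewrite [\1__ x]indicE (mem_set Qx) mul1r normrM (ger0_norm (sqr_ge0 _)).
    apply: le_trans (ler_wpM2l (sqr_ge0 _) (ln_shift_bound cp (U_ge0 p x))) _.
    rewrite mulrDr [Phi x ^+ 2 * `|_|]mulrC lerD2l mulrA mulrAC ler_wpM2r//.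
    by rewrite ler_wpM2r ?invr_ge0 ?(ltW cp)// (le_trans (ler_norm _)).
  split => //; apply: (weighted_ln_cvg PhiB mthick r0 cp) => //.
    exact: Qp.
  move=> n nr; apply: (rintegrable_ln_endpoint mPhi PhiB (radius_gt0 n)
    mD Doo PhiD _ cp (Qi p pT)).
  by move=> x Px y xy; apply: PQ Px _ _; exact: lt_trans nr.
have ds0 : 0 < dlt t kap dl0 s by apply: lt_le_trans (dlt_ge _ _ st).
have [is_ cs] := ends s _ sT ds0; have [it ct] := ends t _ tT dl00.
have dge r' : r' <= t -> dl0 <= dlt t kap dl0 r' by exact: dlt_ge.
have tr_i r' : rintegrable (leb d) (trunc k r').
  have := rintegrableZ k (rintegrable_indic mD Doo); apply: rintegrable_le.
    exact: (measurableT_comp (measurable_trunc k) (measurable_pair1 r')).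
  move=> x; rewrite ger0_norm ?(trunc_ge0 k0)// indicE.
  have [_|nD] := boolP (x \in D); first by rewrite mulr1 trunc_le.
  rewrite mulr0 /trunc Ug_out ?mul0r ?ge_min ?lexx//.
  by move=> /OD xD; move: nD; rewrite mem_set.
have tU r' : tcont (Ug r').
  apply: (tcont_bounded rD0); first exact: rintegrable_Ug _.
  by move=> x /out_zero xO; rewrite Ug_out.
have ttr r' : tcont (trunc k r').
  apply: (tcont_bounded rD0) => // x /out_zero xO.
  by rewrite /trunc Ug_out// mul0r; exact/min_idPl.
have mlim2 : measurable_fun setT (fun z : spacetime => Phi z.2 ^+ 2 *
    (trunc k z.1 z.2 / (Ug z.1 z.2 + dlt t kap dl0 z.1))).
  apply: measurable_funM; first by apply: measurable_funX; exact: (measurableT_comp mPhi).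
  apply: measurable_funM; first exact: measurable_trunc k.
  apply: measurable_funV; apply: measurable_funD; first exact: measurable_Ug.
  apply: measurable_funD => //; apply: measurable_funM => //.
  by apply: measurable_funB => //.
have slice r' : r' <= t -> rintegrable (leb d) (fun x => Phi x ^+ 2 *
    (trunc k r' x / (Ug r' x + dlt t kap dl0 r'))).
  move=> rt; have := rintegrableZ (k / dl0) P2; apply: rintegrable_le.
    exact: (measurableT_comp mlim2 (measurable_pair1 r')).
  move=> x; rewrite normrM mulrC (ger0_norm (sqr_ge0 _)) ler_wpM2r ?sqr_ge0//.
  apply: quot_bound (dge _ rt) => //; last exact: Ug_ge0.
  by rewrite trunc_le (trunc_ge0 k0).
have slice_n n r' : r' <= t -> rintegrable (leb d) (fun x => Phi x ^+ 2 *
    (conv (trunc k r') (moll (radius n)) x /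
    (conv (Ug r') (moll (radius n)) x + dlt t kap dl0 r'))).
  exact: (rintegrable_ratio_slice mPhi PhiB (radius_gt0 n) k0
    kap0 dl00 mD Doo PhiD).
pose Gb (r' : R) := (k / dl0 * \int[leb d]_x Phi x ^+ 2) * co s t r'.
have Gbi : rintegrable lam Gb by apply: rintegrableZ; exact: rintegrable_co1.
have EP := RintegralZl (k / dl0) measurableT P2.
have iP := rintegrableZ (k / dl0) P2.
have bound (a w : X -> R) r' : (forall x, 0 <= a x <= k) -> (forall x, 0 <= w x) ->
    (r' <= t -> rintegrable (leb d) (fun x => Phi x ^+ 2 * (a x / (w x + dlt t kap dl0 r')))) ->
    `|co s t r' * \int[leb d]_x (Phi x ^+ 2 * (a x / (w x + dlt t kap dl0 r')))| <= Gb r'.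
  move=> ha hw hi; rewrite /Gb normrM (ger0_norm (co_ge0 _ _ _)) coE.
  have [/andP[sr rt]|_] := boolP (s <= r' < t); last by rewrite mul0r mulr0.
  rewrite mulrC ler_wpM2r// -EP; apply: Rintegral_norm_le => //; first exact: hi (ltW rt).
  move=> x; rewrite normrM mulrC (ger0_norm (sqr_ge0 _)) ler_wpM2r ?sqr_ge0//.
  by apply: quot_bound (dge _ (ltW rt)).
have rat n := @rintegrable_ratio t Phi B
  (radius n) k kap dl0 s D mPhi PhiB (radius_gt0 n) k0 kap0 dl00 mD Doo PhiD.
have mlim : measurable_fun setT (fun r' => co s t r' * limit_ratio t k kap dl0 r').
  apply: measurable_funM; first exact: measurable_co.
  exact: (@measurable_Rintegral2 _ _ _ _ _ (leb d) (fun r' x => Phi x ^+ 2 *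
    (trunc k r' x / (Ug r' x + dlt t kap dl0 r'))) mlim2).
have tb r' x : 0 <= trunc k r' x <= k.
  by rewrite trunc_le (trunc_ge0 k0).
have rat_cvg : \int[lam]_r' (co s t r' * ratio t Phi (radius n) k kap dl0 r')
    @[n --> \oo] --> \int[lam]_r' (co s t r' * limit_ratio t k kap dl0 r').
  apply: (@Rintegral_dominated _ _ _ lam (fun n r' => co s t r' *
    ratio t Phi (radius n) k kap dl0 r')
    (fun r' => co s t r' * limit_ratio t k kap dl0 r') Gb) => //.
  - by move=> n; exact: rintegrable_measurable (rat n).
  - move=> n r'; apply: bound => [x|x|].
    + exact: (conv_trunc_bound (radius_gt0 n) k0).
    + by apply: conv_ge0 => y; [exact: Ug_ge0|exact: moll_ge0 (radius_gt0 n) y].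
    + exact: slice_n.
  move=> r'; rewrite coE; have [/andP[sr rt]|_] := boolP (s <= r' < t); last first.
    by under eq_fun do rewrite mul0r; rewrite mul0r; exact: cvg_cst.
  apply: cvgM; first exact: cvg_cst.
  apply: (weighted_quotient_cvg PhiB dl00 (dge _ (ltW rt)) (tb r')) => //.
  - by move=> x; exact: Ug_ge0.
  - by move=> n; exact: slice_n (ltW rt).
  - exact: slice (ltW rt).
split => //.
  apply: rintegrable_le Gbi => // r'; apply: bound => //.
    by move=> x; exact: Ug_ge0.
  exact: slice.
have lhs : \int[lam]_r' (co s t r' * ratio t Phi (radius n) k kap dl0 r')
    - (t - s) * energy_cost @[n --> \oo] -->
    \int[lam]_r' (co s t r' * limit_ratio t k kap dl0 r') - (t - s) * energy_cost.
  by apply: cvgB => //; exact: cvg_cst.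
apply: (ler_cvg_to lhs (cvgB ct cs)).
near=> n.
have nr : radius n < r by near: n; exact: near_radius.
have n1 : (radius n : R) < 1 by near: n; exact: (near_radius ltr01).
have xe x : Phi x != 0 -> forall y, `|x - y| <= radius n -> Omega y.
  by move=> Px y xy; apply: rO Px _; apply: le_trans xy (ltW nr).
have hD x y : Omega y -> `|x - y| < radius n -> D x.
  move=> Oy xy; rewrite /D/=; apply: lt_le_trans (hrD Oy).
  rewrite -[x](subrK y) addrC (le_lt_trans (ler_normD _ _))// ltrD2l (lt_trans xy)//.
have PQn x : Phi x != 0 -> forall y, `|x - y| < radius n -> Q y.
  by move=> Px y xy; apply: PQ Px _ _; exact: lt_trans nr.
have := growth_space
  eta0 x0O tT mPhi PhiB PhiE (radius_gt0 n) k0 kap0 dl00 s0 st c00 xe mD Doo PhiD hD hc hkap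
  PQn (Qi s sT) (Qi t tT).
by apply.
Unshelve. all: by end_near. Qed.

End box.

Lemma box_exists : exists2 rD : R, 0 < rD & forall y, Omega y -> `|y| + 1 <= rD.
Proof.
have [M [_ bM]] := Omega_bounded; exists (Num.max M 0 + 2).
  by rewrite ltr_wpDl// le_max lexx orbT.
move=> y Oy; rewrite (_ : 2 = 1 + 1)// addrA lerD2r; apply: bM => //.
by rewrite ltr_pwDr// le_max lexx.
Qed.

(** A mollification is at most a constant times the mass, is positive at time s for
    a suitable centre and radius, and moves continuously. *)
Lemma mass_lower_bound t s : time_co T t -> 0 < s -> s < t -> ~ vanishing s ->
  exists m s', [/\ 0 < m, s < s' , s' <= t &
    {ae lam, forall r : measurableTypeR R, s <= r < s' -> m <= mass r}].
Proof.
move=> tT s0 st nv.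
have sT : time_co T s by apply: time_le tT _; rewrite !ltW.
have [x [e [e0 xe w0]]] := not_vanishing_conv_pos sT nv.
have w2 : 0 < conv (U s) (moll e) x / 2 by rewrite divr_gt0.
have [rho rho0 hr] := weak_modulus tT e0 xe w2.
have [B hB] := @moll_bounded R d e e0.
have mz : 0 < moll e (0 : X).
  by apply: moll_gt0 => //; rewrite normr0 expr0n/= mulr0 exprn_gt0.
have B0 : 0 < B by apply: lt_le_trans mz _; exact: le_trans (ler_norm _) (hB 0).
have r2 : 0 < rho / 2 by rewrite divr_gt0.
exists (conv (U s) (moll e) x / 2 / B), (Num.min t (s + rho / 2)); split.
- by rewrite divr_gt0.
- by rewrite lt_min st ltrDl.
- by rewrite ge_min lexx.
have := ae_good eta0 x0O tT.
apply: filterS => r gr /andP[sr]; rewrite lt_min => /andP[rt rs].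
have {}gr : good_time r by apply: gr; rewrite (lt_le_trans s0 sr).
have rh : r - s < rho by move: rs r2; lra.
have := hr s r (ltW s0) sr (ltW rt) rh; rewrite distrC => /(le_trans (ler_norm _)) h.
have h1 : conv (U s) (moll e) x / 2 <= conv (U r) (moll e) x by move: h; lra.
rewrite ler_pdivrMr//; apply: le_trans h1 _.
have UE : U r = Ug r by apply/funext => y; rewrite UgE.
have ui := rintegrable_Ug r.
have := conv_bounded ui (@measurable_moll R d e) hB x.
rewrite UE (_ : \int[leb d]_y `|Ug r y| = mass r).
  by move=> /(le_trans (ler_norm _)); rewrite mulrC.
by apply: Rintegral_eq => y; rewrite ger0_norm// Ug_ge0.
Qed.

Lemma limit_ratio_ge0 t k kap dl r : 0 <= k -> 0 <= kap -> 0 < dl -> r <= t ->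
  0 <= limit_ratio t k kap dl r.
Proof.
move=> k0 kap0 dl0 rt; apply: Rintegral_ge0 => x _.
apply: mulr_ge0; first exact: sqr_ge0.
rewrite divr_ge0 ?(trunc_ge0 k0)//.
by rewrite addr_ge0 ?Ug_ge0// (le_trans (ltW dl0))// dlt_ge.
Qed.

Definition energy := calA d alpha / 2 *
    \int[(leb d \x leb d)%E]_p (energy_density alpha Phi Phi p).

(** The case c0 = kap = 0, with a constant regularisation: the cost reduces to the
    energy. *)
Lemma log_inequality0 s t k dl : 0 < s -> s <= t -> time_co T t -> 0 <= k -> 0 < dl ->
  [/\ rintegrable (leb d) (fun x => Phi x ^+ 2 * ln (U s x + dl)),
      rintegrable (leb d) (fun x => Phi x ^+ 2 * ln (U t x + dl)),
      rintegrable lam (fun r => co s t r * limit_ratio t k 0 dl r) &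
      \int[lam]_r (co s t r * limit_ratio t k 0 dl r) - (t - s) * energy <=
      \int[leb d]_x (Phi x ^+ 2 * ln (U t x + dl)) -
      \int[leb d]_x (Phi x ^+ 2 * ln (U s x + dl))].
Proof.
move=> s0 st tT k0 dl0; have [rD rD0 hrD] := box_exists.
have hc x y : [set x : X | `|x| < rD] x -> [set x : X | `|x| < rD] y -> x != y ->
    0 <= calA d alpha * kern s_ (x - y).
  by move=> _ _ _; rewrite mulr_ge0 ?kern_ge0// ltW// calA_gt0.
have hk : {ae lam, forall r : measurableTypeR R, s <= r < t -> 0 <= 0 * mass r}.
  by apply: aeW => r _; rewrite mul0r.
have [] := log_inequality rD0 hrD (lexx 0) hc s0 st tT k0 (lexx 0) dl0 hk.
have -> : dlt t 0 dl s = dl by rewrite /dlt mul0r addr0.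
rewrite /energy_cost mul0r mul0r addr0 -/energy => *; split => //.
Qed.

(** On a short interval [s, s'] where the mass is bounded below, the moving
    regularisation can be used; at time s it is at least kap (s' - s), which does
    not depend on dl.  From s' to t the regularisation is constant. *)
Lemma log_lower_bound s t : time_co T t -> 0 < s -> s < t -> ~ vanishing s ->
  exists C : R, forall dl, 0 < dl -> C <= \int[leb d]_x (Phi x ^+ 2 * ln (U t x + dl)).
Proof.
move=> tT s0 st nv; have [rD rD0 hrD] := box_exists.
have [m [s' [m0 ss' s't hm]]] := mass_lower_bound tT s0 st nv.
have s'T : time_co T s' by apply: time_le tT _; rewrite s't (ltW (lt_trans s0 ss')).
have rD2 : 0 <= 2 * rD by rewrite mulr_ge0// ltW.
have [k0 k00 hk0] := kern_ge d halpha rD2.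
pose c0 := calA d alpha * k0.
have cA0 : 0 < calA d alpha by exact: calA_gt0.
have c00 : 0 < c0 by exact: mulr_gt0.
have hc x y : [set x : X | `|x| < rD] x -> [set x : X | `|x| < rD] y -> x != y ->
    c0 <= calA d alpha * kern s_ (x - y).
  move=> /= xD yD xy; rewrite ler_pM2l//; apply: hk0; first by rewrite subr_eq0.
  by rewrite (le_trans (ler_normB _ _))// mulr_natl mulr2n ltW// ltrD.
(* the speed that the surplus of the Picone inequality can pay for *)
pose kap := c0 * m; have kap0 : 0 < kap by exact: mulr_gt0.
have hkap : {ae lam, forall r : measurableTypeR R, s <= r < s' -> kap <= c0 * mass r}.
  by apply: filterS hm => r hr /hr h; rewrite ler_pM2l.
pose Ec := energy_cost rD c0.
have [B PhiB] := compact_supp_bounded cPhi cK.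
pose L := ln (kap * (s' - s)).
have ks : 0 < kap * (s' - s) by rewrite mulr_gt0// subr_gt0.
have main dl : 0 < dl ->
    \int[leb d]_x (Phi x ^+ 2 * L) - (s' - s) * Ec - (t - s') * energy <=
    \int[leb d]_x (Phi x ^+ 2 * ln (U t x + dl)).
  move=> dl0.
  have [i1 i2 i3 h1] := log_inequality rD0 hrD (ltW c00) hc s0 (ltW ss') s'T (lexx 0)
    (ltW kap0) dl0 hkap.
  have [j1 j2 j3 h2] := log_inequality0 (lt_trans s0 ss') s't tT (lexx 0) dl0.
  have z1 : 0 <= \int[lam]_r (co s s' r * limit_ratio s' 0 kap dl r).
    apply: Rintegral_ge0 => r _; rewrite coE.
    have [/andP[_ rs]|_] := boolP (s <= r < s'); last by rewrite mul0r.
    by rewrite mul1r limit_ratio_ge0// ltW.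
  have z2 : 0 <= \int[lam]_r (co s' t r * limit_ratio t 0 0 dl r).
    apply: Rintegral_ge0 => r _; rewrite coE.
    have [/andP[_ rs]|_] := boolP (s' <= r < t); last by rewrite mul0r.
    by rewrite mul1r limit_ratio_ge0// ltW.
  have iL : rintegrable (leb d) (fun x => Phi x ^+ 2 * L).
    have P2 := rintegrable_Phi2 rD0 hrD PhiB.
    have := rintegrableZ L P2; apply: eq_integrable => // x _ /=.
    by rewrite mulrC.
  have z3 : \int[leb d]_x (Phi x ^+ 2 * L) <=
      \int[leb d]_x (Phi x ^+ 2 * ln (U s x + dlt s' kap dl s)).
    apply: Rintegral_le => // x; rewrite ler_wpM2l ?sqr_ge0// ler_ln ?posrE//.
      by rewrite /dlt addrA lerDr addr_ge0// ltW.
    by rewrite ltr_wpDl// /dlt ltr_wpDl// ltW.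
  move: h1 h2 z1 z2 z3; rewrite -/Ec.
  set a1 := \int[lam]_r _; set a2 := \int[lam]_r _; set b1 := \int[leb d]_x _.
  set b2 := \int[leb d]_x _; set b3 := \int[leb d]_x _.
  set b4 := \int[leb d]_x _; set e1 := _ * Ec; set e2 := _ * energy.
  exact: chain_le.
by exists (\int[leb d]_x (Phi x ^+ 2 * L) - (s' - s) * Ec - (t - s') * energy).
Qed.

Hypothesis V_L1loc : forall K : set 'rV[R]_d, compact K -> K `<=` Omega ->
    (\int[leb d]_(x in K) (V x)%:E < +oo)%E.

Let mPhi2 : measurable_fun setT (fun x => Phi x ^+ 2).
Proof. exact: measurable_funX. Qed.

Let w0 x : 0 <= Phi x ^+ 2. Proof. exact: sqr_ge0. Qed.

Let Phi_bound : exists B : R, forall x, `|Phi x ^+ 2| <= B.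
Proof.
have [B hB] := compact_supp_bounded cPhi cK; exists (B ^+ 2) => x.
by rewrite normrX lerXn2r ?nnegrE// (le_trans _ (hB x)).
Qed.

Lemma rintegrable_Phi2V : rintegrable (leb d) (fun x => Phi x ^+ 2 * W x).
Proof.
have [B hB] := Phi_bound; have VK := V_L1loc cK KO.
have mK : measurable (supp Phi).
  rewrite -[supp Phi]setCK; apply: measurableC; apply: open_measurable_rV.
  exact/closed_openC/closed_closure.
have h : rintegrable (leb d) (fun x => \1_(supp Phi) x * W x).
  apply: rintegrable_ge0 => //.
  - by apply: measurable_funM => //; exact: measurable_indic.
  - by move=> x; rewrite mulr_ge0.
  apply: le_lt_trans VK; rewrite [leRHS]integral_mkcond le_eqVlt; apply/orP; left; apply/eqP.
  apply: eq_integral => x _; rewrite patchE indicE; case: ifPn => xK; last by rewrite mul0r.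
  by rewrite mul1r /Vt patchE mem_set//; apply: KO; exact: set_mem.
have := rintegrableM_bounded mPhi2 hB h; apply: eq_integrable => // x _ /=.
have [->|Px] := eqVneq (Phi x) 0; first by rewrite expr0n !mul0r.
by rewrite indicE mem_set ?mul1r//; exact: supp_in.
Qed.

Lemma rintegrable_Phi2U r : time_co T r -> rintegrable (leb d) (fun x => Phi x ^+ 2 * U r x).
Proof.
move=> rT; have [B hB] := Phi_bound.
have [q q0 [qO Qi]] := local_integrability.
have := rintegrableM_bounded mPhi2 hB (Qi r rT); apply: eq_integrable => // x _ /=.
have [->|Px] := eqVneq (Phi x) 0; first by rewrite expr0n !mul0r.
rewrite indicE mem_set ?mul1r//; exists x; first exact: supp_in.
by rewrite subrr normr0.
Qed.

Section positive_times.
Variables (s t : R).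
Hypotheses (s0 : 0 < s) (tT : time_co T t) (nv : ~ vanishing s).

(** [log_lower_bound] is the uniform lower bound under which ln (u + dl) decreases
    to an integrable limit. *)
Lemma log_facts r : s < r -> r <= t ->
  [/\ {ae leb d, forall x, Phi x != 0 -> 0 < U r x},
      rintegrable (leb d) (fun x => Phi x ^+ 2 * ln (U r x)),
      (forall dl, 0 < dl -> rintegrable (leb d) (fun x => Phi x ^+ 2 * ln (U r x + dl))) &
      \int[leb d]_x (Phi x ^+ 2 * ln (U r x + radius n)) @[n --> \oo] -->
      \int[leb d]_x (Phi x ^+ 2 * ln (U r x))].
Proof.
move=> sr rt.
have rT : time_co T r by apply: time_le tT _; rewrite rt (ltW (lt_trans s0 sr)).
have [C hC] := log_lower_bound rT s0 sr nv.
have lni dl : 0 < dl -> rintegrable (leb d) (fun x => Phi x ^+ 2 * ln (U r x + dl)).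
  move=> dl0.
  by have [] := log_inequality0 s0 (ltW sr) rT (lexx 0) dl0.
have wgi := rintegrable_Phi2U rT.
have pos := ae_positive w0 (U_ge0 r) wgi lni hC.
have lnU := rintegrable_ln mPhi2 w0 (mU r) (U_ge0 r) wgi lni hC.
split => //.
  apply: filterS pos => x h Px; apply: h.
  by rewrite lt_neqAle sqr_ge0 andbT eq_sym sqrf_eq0.
have r0 n := @radius_gt0 R n.
apply: (Rintegral_dominated_ae _ _ (rintegrableD wgi (rintegrable_norm lnU))).
- by move=> n; exact: rintegrable_measurable (lni _ (r0 n)).
- exact: rintegrable_measurable lnU.
- apply: filterS pos => x pos n.
  have [->|Px] := eqVneq (Phi x) 0; first by rewrite expr0n !mul0r normr0 addr0.
  have Ux : 0 < U r x.
    by apply: pos; rewrite lt_neqAle sqr_ge0 andbT eq_sym sqrf_eq0.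
  rewrite 2!(normrM (Phi x ^+ 2)) (ger0_norm (w0 x)) -mulrDr ler_wpM2l//.
  have h1 : ln (U r x) <= ln (U r x + radius n).
    by rewrite ler_ln ?posrE// ?lerDl ?(ltW (r0 n))// addr_gt0.
  have h2 := ln_radius_le n (U_ge0 r x).
  have h3 : - `|ln (U r x)| <= ln (U r x) by rewrite lerNl (le_trans (ler_norm _))// normrN.
  have h4 := normr_ge0 (ln (U r x)).
  by rewrite ler_norml; apply/andP; split; move: h1 h2 h3 h4 (U_ge0 r x); lra.
apply: filterS pos => x pos.
have [->|Px] := eqVneq (Phi x) 0.
  by under eq_fun do rewrite expr0n mul0r; rewrite expr0n mul0r; exact: cvg_cst.
apply: cvgM; first exact: cvg_cst.
apply: ln_radius_cvg; apply: pos.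
by rewrite lt_neqAle sqr_ge0 andbT eq_sym sqrf_eq0.
Qed.

Let dlE t' dl r : dlt t' 0 dl r = dl. Proof. by rewrite /dlt mul0r addr0. Qed.

Let quot_le k dl r x : 0 <= k -> 0 < dl ->
  0 <= trunc k r x / (Ug r x + dl) <= W x.
Proof.
move=> k0 dl0; have g0 := Ug_ge0 r x.
have v0 : 0 < Ug r x + dl by rewrite ltr_wpDl.
rewrite divr_ge0 ?(ltW v0) ?(trunc_ge0 k0)//= ler_pdivrMr//.
rewrite /trunc; apply: (@le_trans _ _ (Ug r x * W x)); first by rewrite ge_min lexx.
by rewrite mulrC ler_wpM2l// lerDl ltW.
Qed.

Let IV := \int[leb d]_x (Phi x ^+ 2 * W x).

Let mquot n r : measurable_fun setT (fun x => Phi x ^+ 2 *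
  (trunc n%:R r x / (Ug r x + radius n))).
Proof.
apply: measurable_funM => //; apply: measurable_funM.
  exact: (measurableT_comp (measurable_trunc n%:R) (measurable_pair1 r)).
apply: measurable_funV; apply: measurable_funD => //.
exact: (measurableT_comp (measurable_Ug) (measurable_pair1 r)).
Qed.

Let mid n r := limit_ratio t n%:R 0 (radius n) r.

Let midE n r : mid n r = \int[leb d]_x (Phi x ^+ 2 *
  (trunc n%:R r x / (Ug r x + radius n))).
Proof. by apply: Rintegral_eq => x; rewrite dlE. Qed.

Let mid_bound n r : `|mid n r| <= IV.
Proof.
have hi := rintegrable_Phi2V; have r0 := @radius_gt0 R n.
have n0 : 0 <= n%:R :> R by [].
have le x : `|Phi x ^+ 2 * (trunc n%:R r x / (Ug r x + radius n))| <=
    Phi x ^+ 2 * W x.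
  have /andP[h1 h2] := quot_le r x n0 r0.
  by rewrite (ger0_norm (mulr_ge0 (w0 x) h1)); exact: ler_wpM2l.
rewrite midE; apply: Rintegral_norm_le => //.
by apply: rintegrable_le hi.
Qed.

Let mid_cvg r : s < r -> r <= t -> good_time r -> mid n r @[n --> \oo] --> IV.
Proof.
move=> sr rt gr; have [pos _ _ _] := log_facts sr rt.
under eq_fun do rewrite midE.
apply: (Rintegral_dominated_ae _ _ rintegrable_Phi2V).
- by move=> n; exact: mquot.
- exact: measurable_funM.
- apply: aeW => x n; have /andP[h1 h2] := quot_le r x (ler0n R n) (@radius_gt0 R n).
  by rewrite (ger0_norm (mulr_ge0 (w0 x) h1)); exact: ler_wpM2l.
apply: filterS pos => x pos.
have [->|Px] := eqVneq (Phi x) 0.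
  by under eq_fun do rewrite expr0n mul0r; rewrite expr0n mul0r; exact: cvg_cst.
have Ux := pos Px; apply: cvgM; first exact: cvg_cst.
have UE : Ug r x = U r x by exact: UgE.
have -> : W x = U r x * W x / (U r x + 0) by rewrite addr0 mulrAC divff ?mul1r// gt_eqF.
apply: cvgM.
  apply: cvg_near_cst; exists (Num.truncn (U r x * W x)).+1 => // n /= hn.
  rewrite /trunc UE; apply/min_idPl/ltW; apply: lt_le_trans (truncnS_gt _) _.
  by rewrite ler_nat.
apply: cvgV; first by rewrite addr0 gt_eqF.
rewrite UE; apply: cvgD; [exact: cvg_cst|exact: radius_cvg0].
Qed.

(** [log_inequality0] with regularisation 1/n and truncation at level n: the
    quotients trunc / (u + 1/n) are dominated by V and converge to V where u is
    positive. *)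
Lemma main_inequality t1 : s < t1 -> t1 < t ->
  (t - t1) * (\int[leb d]_x (Phi x ^+ 2 * W x) - energy) <=
  \int[leb d]_x (Phi x ^+ 2 * ln (U t x)) - \int[leb d]_x (Phi x ^+ 2 * ln (U t1 x)).
Proof.
move=> st1 t1t; have t10 := lt_trans s0 st1.
have [_ _ _ c1] := log_facts st1 (ltW t1t).
have [_ _ _ c2] := log_facts (lt_trans st1 t1t) (lexx t).
have ineq n := log_inequality0 t10 (ltW t1t) tT (ler0n R n) (@radius_gt0 R n).
have gi : rintegrable lam (fun r => IV * co t1 t r).
  by apply: rintegrableZ; exact: rintegrable_co1.
have E : \int[lam]_r (IV * co t1 t r) = (t - t1) * IV.
  have E1 := RintegralZl IV measurableT (rintegrable_co1 t1 t).
  by rewrite E1 (Rintegral_co1 (ltW t1t)) mulrC.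
have ca : \int[lam]_r (co t1 t r * mid n r) @[n --> \oo] --> \int[lam]_r (IV * co t1 t r).
  apply: (Rintegral_dominated_ae _ _ gi).
  - by move=> n; have [_ _ h _] := ineq n; exact: rintegrable_measurable h.
  - exact: rintegrable_measurable gi.
  - apply: aeW => r n; rewrite normrM (ger0_norm (co_ge0 _ _ _)) mulrC.
    by rewrite ler_wpM2r ?co_ge0 ?mid_bound.
  have := ae_good eta0 x0O tT.
  apply: filterS => r gr; rewrite (mulrC IV) coE.
  have [/andP[tr rt]|_] := boolP (t1 <= r < t); last first.
    by under eq_fun do rewrite mul0r; rewrite mul0r; exact: cvg_cst.
  apply: cvgM; first exact: cvg_cst.
  apply: mid_cvg; [exact: lt_le_trans tr|exact: ltW|].
  by apply: gr; rewrite rt (lt_le_trans t10 tr).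
have lhs : \int[lam]_r (co t1 t r * mid n r) - (t - t1) * energy
    @[n --> \oo] --> \int[lam]_r (IV * co t1 t r) - (t - t1) * energy.
  by apply: cvgB => //; exact: cvg_cst.
rewrite mulrBr -/IV -E; apply: (ler_cvg_to lhs (cvgB c2 c1)).
by apply: nearW => n; have [] := ineq n.
Qed.

End positive_times.
End test_function.
End weak_solution.

(** * The logarithmic estimate *)

Theorem theorem4p1 (R : realType) (d : nat) (alpha : R)
  (Omega : set 'rV[R]_d) (V u0 : 'rV[R]_d -> R) (T : \bar R)
  (u : R -> 'rV[R]_d -> R)
  (hd : (0 < d)%N)
  (halpha : 0 < alpha < Num.min 2 d%:R)
  (Omega_open : open Omega)
  (Omega_bounded : bounded_set Omega)
  (Omega_lipschitz : lipschitz_boundary Omega)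
  (V_borel : measurable_fun Omega V)
  (V_ge0 : forall x, Omega x -> 0 <= V x)
  (V_L1loc : forall K : set 'rV[R]_d, compact K -> K `<=` Omega ->
    (\int[leb d]_(x in K) (V x)%:E < +oo)%E)
  (u0_L2 : sq_integrable (leb d) Omega u0)
  (u0_ge0 : {ae leb d, forall x, Omega x -> 0 <= u0 x})
  (T_gt0 : (0 < T)%E)
  (u_sol : is_solution alpha Omega V T u0 u)
  (u_ge0 : forall t : R, 0 <= t -> (t%:E < T)%E ->
    {ae leb d, forall x, Omega x -> 0 <= u t x}) :
  forall (t1 t2 : R) (Phi : 'rV[R]_d -> R),
  0 < t1 -> t1 < t2 -> (t2%:E < T)%E -> Cc_infty Omega Phi ->
  (* excludes only the data for which u(t2)/u(t1) is 0/0 throughout Omega *)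
  ~ ({ae leb d, forall x, Omega x -> u0 x = 0} /\
     {ae leb d, forall x, Omega x -> u t2 x = 0}) ->
  (\int[leb d]_(x in Omega) (Phi x ^+ 2 * V x)%:E - Eform alpha Phi Phi <=
   (t2 - t1)^-1%:E *
   \int[leb d]_(x in Omega)
     (lne ((u t2 x)%:E / (u t1 x)%:E) * (Phi x ^+ 2)%:E))%E.
Proof.
move=> t1 t2 Phi t10 t12 t2T [CPhi cK KO] nz.
have cPhi : continuous Phi by have [] := CPhi 0%N.
have ha : 0 < alpha < 2.
  by case/andP: halpha => a0; rewrite lt_min => /andP[a2 _]; rewrite a0.
have mO : measurable Omega by exact: open_measurable_rV.
have mPhi : measurable_fun setT Phi by exact: continuous_measurable_rV.
have t20 : 0 < t2 by exact: lt_trans t12.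
have t2c : time_co T t2 by split; [exact: ltW|].
have t1c : time_co T t1.
  by split; [exact: ltW|apply: lt_trans t2T; rewrite lte_fin].
have tt0 : 0 < t2 - t1 by rewrite subr_gt0.
have PhiO x : Phi x != 0 -> Omega x by move=> Px; apply: KO; exact: subset_closure.
(* if Phi has infinite energy the left-hand side is -oo *)
have [PhiE|PhiE] := ltP (Eform alpha Phi Phi) +oo%E; last first.
  by move: PhiE; rewrite leye_eq => /eqP ->; rewrite addeNy leNye.
have [Phi0|] := pselect (forall x, Phi x = 0).
  rewrite integral0_eq; last by move=> x _; rewrite Phi0 expr0n mul0r.
  rewrite integral0_eq; last by move=> x _; rewrite Phi0 expr0n mule0.
  by rewrite mule0 add0e oppe_le0 Eform_ge0.
move=> /existsNP[x0 /eqP Px0].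
have /nbhs_ballP[r /= r0 rO] := open_nbhs_nbhs (conj Omega_open (PhiO _ Px0)).
pose eta := r / 2; have eta0 : 0 < eta by rewrite divr_gt0.
have x0O y : `|x0 - y| <= eta -> Omega y.
  move=> h; apply: rO; rewrite -ball_normE/= (le_lt_trans h)//.
  by rewrite /eta ltr_pdivrMr// ltr_pMr// ltr1n.
pose U := ut Omega T u.
(* P is open and nonempty, hence of positive measure: an almost everywhere
   statement about P is not void *)
pose P := [set x | Phi x != 0].
have oP : open P.
  have -> : P = Phi @^-1` [set y | y != 0] by [].
  apply: open_comp; first by move=> x _; exact: cPhi.
  rewrite (_ : [set y : R | y != 0] = ~` [set 0]).
    rewrite openC; exact/accessible_closed_set1/hausdorff_accessible/Rhausdorff.
  by apply/seteqP; split => y /= /eqP.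
have mP : measurable P by exact: open_measurable_rV.
have P_gt0 : (0 < leb d P)%E.
  have /nbhs_ballP[q /= q0 qP] := open_nbhs_nbhs (conj oP Px0).
  have mB : measurable [set y | `|x0 - y| < q].
    apply: open_measurable_rV; rewrite (_ : [set y | _] = ball x0 q); first exact: ball_open.
    by rewrite -ball_normE.
  apply: (@lt_le_trans _ _ (leb d [set y | `|x0 - y| < q])).
    rewrite leb_ball_center// lte_fin exprn_gt0// mulr_gt0//.
  apply: le_measure; rewrite ?inE// => y /= h; apply: qP.
  by rewrite -ball_normE.
have facts := log_facts ha Omega_open Omega_bounded V_borel V_ge0 u0_L2 u_sol u_ge0 eta0 x0O
  cPhi cK KO PhiE.
have main := main_inequality ha Omega_open Omega_bounded V_borel V_ge0 u0_L2 u_sol u_ge0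
  eta0 x0O cPhi cK KO PhiE V_L1loc.
pose a := u t2 \_ Omega; pose b := u t1 \_ Omega.
have mu t : time_co T t -> measurable_fun setT (u t \_ Omega).
  move=> tc; rewrite (_ : u t \_ Omega = fun x => upatch Omega T u (t, x)).
    exact: (measurableT_comp (measurable_upatch Omega_open u_sol) (measurable_pair1 t)).
  apply/funext => x; rewrite /upatch !patchE; case: ifPn => xO.
    by rewrite mem_set//; split => //; exact: set_mem.
  by rewrite memNset// => -[_ /= Ox]; move: xO; rewrite mem_set.
have ma : measurable_fun setT a by exact: mu.
have mb : measurable_fun setT b by exact: mu.
pose F x := (lneq_ratio (a x) (b x) * (Phi x ^+ 2)%:E)%E.
have mF : measurable_fun setT F.
  apply: emeasurable_funM; first exact: measurable_lneq_ratio.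
  by apply/measurable_EFinP; exact: measurable_funX.
have FE : (\int[leb d]_(x in Omega) (lne ((u t2 x)%:E / (u t1 x)%:E) * (Phi x ^+ 2)%:E) =
    \int[leb d]_x F x)%E.
  rewrite integral_mkcond; apply: eq_integral => x _; rewrite patchE.
  case: ifPn => xO; first by rewrite lne_ratioE /F /a /b !patchE xO.
  rewrite /F (_ : Phi x = 0) ?expr0n ?mule0//.
  apply/eqP; apply: contrapT => /negP/PhiO Ox; by move: xO; rewrite mem_set.
rewrite FE.
have ae1 := ut_ae u_ge0 t1c; have ae2 := ut_ae u_ge0 t2c.
have P_null : ~ {ae leb d, forall x, Phi x = 0}.
  move=> h; have : (leb d).-negligible P by apply: negligibleS h => x /= /eqP.
  by move/(negligibleP _ mP) => P0; move: P_gt0; rewrite P0 ltxx.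
have [vt1|nvt1] := pselect (vanishing Omega T u t1); last first.
  have [s [s0 st1 nvs]] := not_vanishing_before ha Omega_open Omega_bounded V_borel u0_L2 u_sol
    u_ge0 t1c t10 nvt1.
  have [pos1 i1 _ _] := facts _ _ s0 t2c nvs t1 st1 (ltW t12).
  have [pos2 i2 _ _] := facts _ _ s0 t2c nvs t2 (lt_trans st1 t12) (lexx _).
  have ineq := main _ _ s0 t2c nvs t1 st1 t12.
  have iG := rintegrableB i2 i1.
  have EG := RintegralB measurableT i2 i1.
  have FG : (\int[leb d]_x F x)%E = (\int[leb d]_x (Phi x ^+ 2 * ln (U t2 x)) -
      \int[leb d]_x (Phi x ^+ 2 * ln (U t1 x)))%:E.
    rewrite -EG (EFin_Rintegral iG); apply: ae_eq_integral => //.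
      exact: measurable_int iG.
    near=> x => _; rewrite /F.
    have [Px|Px] := eqVneq (Phi x) 0; first by rewrite Px expr0n mule0 !mul0r subrr.
    have Ox := PhiO _ Px.
    have e2 : a x = U t2 x.
      by rewrite /a patchE mem_set//; move: Ox; near: x.
    have e1 : b x = U t1 x.
      by rewrite /b patchE mem_set//; move: Ox; near: x.
    have p2 : 0 < U t2 x by move: Px; near: x.
    have p1 : 0 < U t1 x by move: Px; near: x.
    by rewrite e1 e2 lneq_ratio_pos// -EFinM mulrC mulrBr.
  have LE : (\int[leb d]_(x in Omega) (Phi x ^+ 2 * V x)%:E)%E =
      (\int[leb d]_x (Phi x ^+ 2 * Vt Omega V x))%:E.
    rewrite (EFin_Rintegral (rintegrable_Phi2V Omega_open V_borel V_ge0 cPhi cK KO V_L1loc)).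
    rewrite [LHS]integral_mkcond; apply: eq_integral => x _; rewrite /Vt !patchE.
    by case: ifPn => // _; rewrite mulr0.
  have EE : Eform alpha Phi Phi = (energy alpha Phi)%:E.
    by rewrite EformE /energy (EFinM (calA d alpha / 2)) (EFin_Rintegral (Eform_lty ha mPhi PhiE)).
  rewrite FG LE EE -EFinB -EFinM lee_fin.
  by rewrite ler_pdivlMl.
have nvt2 : ~ vanishing Omega T u t2.
  move=> vt2; apply: nz; split; last first.
    by apply: filterS2 vt2 ae2 => x h1 h2 Ox; rewrite h2.
  apply: contrapT => nu0.
  have [s [s0 st1 nvs]] := not_vanishing_initial ha Omega_open Omega_bounded V_borel u0_L2
    u_sol u_ge0 t1c t10 u0_ge0 nu0.
  have [pos1 _ _ _] := facts _ _ s0 t2c nvs t1 st1 (ltW t12).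
  apply: P_null; apply: filterS2 vt1 pos1 => x h1 h2.
  by apply/eqP; apply: contrapT => /negP/h2; rewrite h1 ltxx.
have [s [s0 st2 nvs]] := not_vanishing_before ha Omega_open Omega_bounded V_borel u0_L2 u_sol
  u_ge0 t2c t20 nvt2.
have [pos2 _ _ _] := facts _ _ s0 t2c nvs t2 st2 (lexx _).
have Foo : (\int[leb d]_x F x = +oo)%E.
  rewrite (_ : (\int[leb d]_x F x)%E = (\int[leb d]_(x in P) +oo)%E).
    by rewrite integral_cst// gt0_mulye.
  rewrite [RHS]integral_mkcond; apply: ae_eq_integral => //.
    by apply/(measurable_restrictT _ mP).
  near=> x => _; rewrite patchE /F.
  have [Px|Px] := eqVneq (Phi x) 0.
    by rewrite Px expr0n mule0 memNset// /P/= Px eqxx.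
  rewrite mem_set//; have Ox := PhiO _ Px.
  have e2 : a x = U t2 x by rewrite /a patchE mem_set//; move: Ox; near: x.
  have e1 : b x = 0.
    rewrite /b patchE mem_set//; have v1 : U t1 x = 0 by near: x.
    by rewrite -v1; move: Ox; near: x.
  have p2 : 0 < U t2 x by move: Px; near: x.
  rewrite e1 e2 /lneq_ratio eqxx p2 gt0_mulye// lte_fin.
  by rewrite lt_neqAle sqr_ge0 andbT eq_sym sqrf_eq0.
by rewrite Foo gt0_muley ?leey// lte_fin invr_gt0.
Unshelve. all: by end_near. Qed.
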